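(* Let $\mathcal P$ be a clustering spin model on $\mathbb Z^d$, let $k\ge1$, let $h:\{0,1\}^{W_k}\to\mathbb R$ be a function, and let $\xi$ be the local score function induced by $h$, i.e. $\xi(x,\mu)=h(\mu\cap W_k(x))$ for $\mu\subset\mathbb Z^d$, $x\in\mu$. Set $H_n=\sum_{x\in\mathcal P_n}\xi(x,\mathcal P_n)$. If for some $\nu>0$ it holds that $\operatorname{Var}(H_n)=\Omega(w_n^\nu)$, then as $n\to\infty$, $$\operatorname{Var}(H_n)^{-1/2}\bigl(H_n-\mathbb E(H_n)\bigr)\stackrel{d}{\Rightarrow}N(0,1).$$
   Context: $\mathbb Z^d$ is the Cayley graph with edges between points at $\ell_1$-distance $1$; $|x|$ is the $\ell_1$-norm, $W_r(x)=\{y\in\mathbb Z^d:|x-y|\le r\}$, $W_r=W_r(O)$ with $O$ the origin, $w_n=|W_n|$. In $h(\mu\cap W_k(x))$, the configuration $\mu\cap W_k(x)$ is identified, by translation by $-x$, with an element of $\{0,1\}^{W_k}$. $a_n=\Omega(b_n)$ means there is $c>0$ with $a_n\ge c\,b_n$ for all large $n$. A spin model is a random element $\mathcal P$ of $\{0,1\}^{\mathbb Z^d}$, identified with a random subset of $\mathbb Z^d$; $\mathcal P_n=\mathcal P\cap W_n$. It is stationary if $\mathcal P+y\stackrel d=\mathcal P$ for all $y\in\mathbb Z^d$, non-degenerate if $\mathbb P(O\in\mathcal P)\in(0,1)$. A function $\phi:[0,\infty)\to[0,\infty)$ is fast decreasing if $\phi\le1$, $\phi$ is decreasing and $\lim_{s\to\infty}s^m\phi(s)=0$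 for all $m\ge1$. A stationary non-degenerate $\mathcal P$ is a clustering spin model if there are constants $C_k,c_k\in(0,\infty)$ ($C_k$ non-decreasing, $c_k$ non-increasing in $k$) and a fast decreasing $\phi$ such that for all $p,q\ge1$ and distinct $x_1,\dots,x_{p+q}\in\mathbb Z^d$, $$|\mathbb P(\{x_1,\dots,x_{p+q}\}\subset\mathcal P)-\mathbb P(\{x_1,\dots,x_p\}\subset\mathcal P)\mathbb P(\{x_{p+1},\dots,x_{p+q}\}\subset\mathcal P)|\le C_{p+q}\phi(c_{p+q}s),$$ where $s=\min_{1\le i\le p,\,1\le j\le q}|x_i-x_{p+j}|$. *)

(* Defs.v *)
From HB Require Import structures.
From mathcomp Require Export all_boot all_order all_algebra.
From mathcomp Require Export finmap all_classical all_reals all_analysis.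

Set Implicit Arguments.
Unset Strict Implicit.
Unset Printing Implicit Defensive.

Export Order.TTheory GRing.Theory Num.Theory.
Export numFieldNormedType.Exports.

Local Open Scope classical_set_scope.
Local Open Scope ring_scope.

Notation lattice d := 'rV[int]_d.

Section Lattice.
Variable d : nat.
Implicit Types (x y : lattice d) (mu : set (lattice d)).

Definition l1norm x : nat := (\sum_(i < d) absz (x ord0 i))%N.

Definition window (r : nat) x : set (lattice d) :=
  [set y | (l1norm (x - y)%R <= r)%N].

Definition translate y mu : set (lattice d) := [set x + y | x in mu].

(* Elements of {0,1}^(Z^d) are identified with subsets of Z^d, and these sets
   generate the product sigma-algebra. *)
Definition cylinders : set (set (set (lattice d))) :=
  [set [set mu : set (lattice d) | mu x] | x in [set: lattice d]].

(* The minimum of |x_i - x_(p+1+j)| over all i and j; the first such distance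
   is the default value required by the iterated minimum. *)
Definition separation p q (x : 'I_(p.+1 + q.+1) -> lattice d) : nat :=
  let dist i j := l1norm (x (lshift q.+1 i) - x (rshift p.+1 j)) in
  \big[minn/dist ord0 ord0]_(i < p.+1) \big[minn/dist ord0 ord0]_(j < q.+1)
    dist i j.

End Lattice.

Notation spin_config d := (g_sigma_algebraType (@cylinders d)).

Definition window_size (d r : nat) : nat :=
  #|` fset_set (window r (0 : lattice d))|%fset.

Definition fast_decreasing (R : realType) (phi : R -> R) : Prop :=
  [/\ forall s, 0 <= s -> 0 <= phi s <= 1,
      forall s t, 0 <= s -> s <= t -> phi t <= phi s &
      forall m : nat, (0 < m)%N -> s ^+ m * phi s @[s --> +oo] --> 0].

Section SpinModel.
Context (R : realType) (disp : measure_display) (T : measurableType disp).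
Variables (P : probability T R) (d : nat) (X : {RV P >-> spin_config d}).

Definition stationary : Prop :=
  forall (y : lattice d) (A : set (spin_config d)), measurable A ->
    pushforward P (fun w => translate y (X w) : spin_config d) A = distribution P X A.

Definition non_degenerate : Prop :=
  (0 < P [set w | X w (0 : lattice d)%R] < 1)%E.

Definition inclusion_prob n (x : 'I_n -> lattice d) : R :=
  fine (P [set w | range x `<=` X w]).

Definition clustering (C c : nat -> R) (phi : R -> R) : Prop :=
  forall (p q : nat) (x : 'I_(p.+1 + q.+1) -> lattice d), injective x ->
    `| inclusion_prob x
       - inclusion_prob (fun i => x (lshift q.+1 i))
         * inclusion_prob (fun j => x (rshift p.+1 j)) |
    <= C (p.+1 + q.+1)%N
       * phi (c (p.+1 + q.+1)%N * (separation x)%:R).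

Definition clustering_spin_model : Prop :=
  [/\ stationary, non_degenerate &
      exists C c : nat -> R, exists phi : R -> R,
        [/\ forall k, 0 < C k /\ 0 < c k,
            {homo C : m n / (m <= n)%N >-> m <= n},
            {homo c : m n / (m <= n)%N >-> n <= m},
            fast_decreasing phi &
            clustering C c phi]].

End SpinModel.

Section Score.
Variables (R : realType) (d k : nat).

(* h is defined on {0,1}^(W_k), the points of W_k forming a subtype of Z^d. *)
Variable h : (window k (0 : lattice d) -> bool) -> R.

Definition local_config (x : lattice d) (mu : set (lattice d))
    (y : window k (0 : lattice d)) : bool :=
  `[< mu (x + set_val y) >].

Definition local_score (x : lattice d) (mu : set (lattice d)) : R :=
  h (local_config x mu).

Definition total_score (n : nat) (mu : set (lattice d)) : R :=
  let mun := mu `&` window n 0 in \sum_(x \in mun) local_score x mun.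

End Score.

Definition eventually_Omega (R : realType) (a b : nat -> R) : Prop :=
  exists2 c : R, 0 < c & \forall n \near \oo, c * b n <= a n.

Definition converges_in_distribution (R : realType) (disp : measure_display)
    (T : measurableType disp) (P : probability T R) (Z : nat -> T -> R)
    (mu : probability (measurableTypeR R) R) : Prop :=
  forall f : R -> R, continuous f -> bounded_fun f ->
    ('E_P[f \o Z n])%E @[n --> \oo] --> (\int[mu]_x (f x)%:E)%E.

(* Main.v *)
(* Every local score is a linear combination of indicators of finite inclusion
   events, so clustering passes from the inclusion probabilities to the joint
   moments of the centred scores. A finite set of points always has an empty
   annulus of width proportional to its radius around any of its points, and
   moments nearly factorize across it; hence the joint cumulants decay faster
   than any power of the diameter, and every cumulant of [H_n] is [O(w_n)].
   After normalisation the cumulants of order [j] with [nu j >= 4] tend to 0.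

   By a theorem of Janson this suffices for asymptotic normality. Along an
   ultrafilter, rescale so that the cumulants of low order stay bounded. The
   limit moments then have only finitely many nonzero cumulants, so by
   Marcinkiewicz' theorem those of order above 2 vanish. If the rescaling were
   unbounded, the limit variance would be 0 while some limit cumulant of higher
   order is not, which is absurd.

   Marcinkiewicz' theorem: if the cumulants vanish above the order [r > 2], then
   [F(z) = sum_j m_j z^j / j! = exp Q(z)] with [deg Q <= r], while positivity of
   the moments gives [|F(z)| <= F(Re z)], that is
   [Re Q(x exp(i t)) <= Q(x cos t)]; comparing the coefficients of [x^r] for
   [t = pi / r] and [t = 2 pi / r] shows that [c_r = 0]. *)

Require Import Defs.
From mathcomp Require Import measurable_realfun zify ring lra.

Set Implicit Arguments.
Unset Strict Implicit.
Unset Printing Implicit Defensive.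

Local Open Scope classical_set_scope.
Local Open Scope ring_scope.

(** Limits of moments along an ultrafilter are not known to be the moments of a measure; what
    survives of positivity is that their Hankel matrices are positive semidefinite. Marcinkiewicz'
    theorem is therefore proved for such sequences, and the ridge inequality |F(z)| <= F(Re z) comes
    from inserting truncated exponential series into the Hankel form.

    Complex exponentials appear throughout as real cosines with a free phase, which covers sines as
    well and lets the inductions close.

    For the passage from moments to laws, the normal moments grow slowly enough for Taylor's formula
    to give the limit of E cos(b + a Z). A bounded continuous f is a sum of such cosines up to an
    error e x^2 + e on the whole line, and this error is controlled by second moments alone. *)

Definition psd_moments (R : realType) (m : nat -> R) : Prop :=
  forall (n : nat) (q : nat -> R),
    0 <= \sum_(i < n) \sum_(l < n) q i * q l * m (i + l)%N.

(** The coefficientwise form of F' = Q' F for F = exp Q. As a relation it passes to rescalings and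
    limits; it leaves [c 0] free. *)
Definition cumulants_of (R : realType) (m c : nat -> R) : Prop :=
  forall j, m j.+1 = \sum_(i < j.+1) 'C(j, i)%:R * c i.+1 * m (j - i)%N.

(** * Binomial sums *)

Section Pascal.
Variable R : realType.

(** The common induction step for cosine sums, Bernstein sums and sums over tuples. *)
Lemma sum_pascal (n : nat) (F : nat -> R) :
  \sum_(i < n.+2) 'C(n.+1, i)%:R * F i =
  \sum_(i < n.+1) 'C(n, i)%:R * (F i.+1 + F i).
Proof.
rewrite big_ord_recl bin0 mul1r.
rewrite (eq_bigr (fun i : 'I_n.+1 =>
  'C(n, i.+1)%:R * F i.+1 + 'C(n, i)%:R * F i.+1)); last first.
  by move=> i _; rewrite lift0 binS natrD mulrDl.
rewrite big_split /=.
under [RHS]eq_bigr do rewrite mulrDr.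
rewrite big_split /= [RHS]addrC addrA; congr (_ + _).
rewrite [RHS]big_ord_recl bin0 mul1r; congr (_ + _).
by rewrite big_ord_recr /= (bin_small (ltnSn n)) mul0r addr0.
Qed.

(** The real part of (exp(i t) + exp(-i t))^s exp(i b). The phase b is needed for the induction,
    whose step moves it by t in both directions. *)
Lemma sum_bin_cos (s : nat) (t b : R) :
  \sum_(i < s.+1) 'C(s, i)%:R * cos (i%:R * t - (s - i)%:R * t + b) =
  (2 * cos t) ^+ s * cos b.
Proof.
elim: s b => [|s IH] b.
  by rewrite big_ord_recl big_ord0 bin0 !mul0r subr0 !add0r addr0.
rewrite (sum_pascal s (fun i => cos (i%:R * t - (s.+1 - i)%:R * t + b))).
transitivity (\sum_(i < s.+1)
   (('C(s, i)%:R * cos (i%:R * t - (s - i)%:R * t + (b + t))) +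
    ('C(s, i)%:R * cos (i%:R * t - (s - i)%:R * t + (b - t))))).
  apply: eq_bigr => -[i /= ]; rewrite ltnS => ils _; rewrite mulrDr.
  rewrite subSS subSn // -[i.+1%:R]natr1 -[(s-i).+1%:R]natr1.
  by congr (_ * cos _ + _ * cos _); ring.
rewrite big_split /= !IH cosD cosB exprS; ring.
Qed.

Lemma sum_bin_natr (s : nat) : \sum_(i < s.+1) 'C(s, i)%:R = 2 ^+ s :> R.
Proof.
rewrite -natrX -[in RHS](addn1 1) Pascal natr_sum.
by apply: eq_bigr => i _; rewrite !exp1n !muln1.
Qed.

End Pascal.

(** * Marcinkiewicz' theorem *)

Section EntireSeries.
Variable R : realType.
Implicit Types (a b c : nat -> R) (x : R).

(** Infinite radius of convergence, expressed by boundedness at every radius, which is what a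
    recursion on the coefficients yields most directly. *)
Definition entire c : Prop :=
  forall x, 0 < x -> exists C : R, forall j, `|c j| * x ^+ j <= C.

Definition psums_to c x (s : R) : Prop := pseries c x @ \oo --> s.

Definition psum c x : R := limn (pseries c x).

Lemma entire_cvg_norm c x : entire c -> cvgn (pseries (fun i => `|c i|) x).
Proof.
move=> ec.
have x0 : 0 < `|x| + 1 by rewrite ltr_wpDl.
(* Boundedness at twice the radius leaves a geometric majorant of ratio 1/2; the summand 1 keeps the
   radius positive. *)
have [C hC] := ec ((`|x| + 1) * 2) (mulr_gt0 x0 (ltr0Sn _ _)).
apply: normed_cvg.
have C0 : 0 <= C by apply: le_trans (hC 0%N); rewrite mulr_ge0.
apply: (@series_le_cvg _ _ (geometric C 2^-1)) => //=.
- by move=> n; rewrite mulr_ge0// exprn_ge0.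
- move=> n; rewrite normrM normr_id normrX exprVn ler_pdivlMr ?exprn_gt0//.
  apply: le_trans (hC n); rewrite exprMn mulrA ler_wpM2r ?exprn_ge0//.
  by rewrite ler_wpM2l// lerXn2r ?nnegrE ?lerDl// ltW.
- apply: is_cvg_geometric_series; rewrite ger0_norm ?invr_ge0//.
  by rewrite invf_lt1// ltr1n.
Qed.

Lemma entire_cvg c x : entire c -> cvgn (pseries c x).
Proof.
move=> ec; apply: normed_cvg.
have := @entire_cvg_norm _ `|x| ec.
rewrite /pseries /normed_series_of /=.
under [X in _ -> cvgn (series X)]eq_fun do rewrite normrM normrX.
exact.
Qed.

Lemma entire_psum c x : entire c -> psums_to c x (psum c x).
Proof. exact: entire_cvg. Qed.

Lemma psums_to_psum c x s : psums_to c x s -> psum c x = s.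
Proof. by move=> h; apply/cvg_lim. Qed.

Lemma entire_le a c : (forall j, `|a j| <= `|c j|) -> entire c -> entire a.
Proof.
move=> ac ec x x0; have [C hC] := ec x x0; exists C => j.
by apply: le_trans (hC j); rewrite ler_wpM2r// exprn_ge0// ltW.
Qed.

Lemma entire_diffs c : entire c -> entire (pseries_diffs c).
Proof.
move=> ec x x0.
(* Doubling the radius absorbs the factor j + 1 <= 2^(j+1) of the derivative. *)
have [C hC] := ec (x * 2) (mulr_gt0 x0 (ltr0Sn _ _)); exists (C / x) => j.
rewrite ler_pdivlMr// -mulrA -exprSr /pseries_diffs normrM.
apply: le_trans (hC j.+1); rewrite exprMn (ger0_norm (ler0n _ _)).
rewrite [X in X * _]mulrC -mulrA; apply: ler_wpM2l => //.
rewrite mulrC ler_wpM2l ?exprn_ge0 ?(ltW x0)//.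
by rewrite -natrX ler_nat ltnW// ltn_expl.
Qed.

Lemma is_derive_psum c x : entire c ->
  is_derive x (1 : R) (psum c) (psum (pseries_diffs c) x).
Proof.
move=> ec; apply: (@pseries_snd_diffs _ c (`|x| + 1)).
- exact: entire_cvg.
- exact/entire_cvg/entire_diffs.
- exact/entire_cvg/entire_diffs/entire_diffs.
- by rewrite [ltRHS]ger0_norm ?addr_ge0// ltrDl.
Qed.

Lemma psums_toD a c x s t : psums_to a x s -> psums_to c x t ->
  psums_to (fun i => a i + c i) x (s + t).
Proof.
move=> ha hc; rewrite /psums_to (_ : pseries _ x = pseries a x \+ pseries c x).
  exact: (cvgD ha hc).
apply/funext => n; rewrite /pseries /series /= -big_split /=.
by apply: eq_bigr => i _; rewrite mulrDl.
Qed.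

Lemma psums_toZ a x s k : psums_to a x s ->
  psums_to (fun i => k * a i) x (k * s).
Proof.
move=> ha; rewrite /psums_to (_ : pseries _ x = fun n => k * pseries a x n).
  exact: cvgMr.
apply/funext => n; rewrite /pseries /series /= mulr_sumr.
by apply: eq_bigr => i _; rewrite mulrA.
Qed.

Lemma psums_to0 x : psums_to (fun=> 0) x 0.
Proof.
rewrite /psums_to (_ : pseries _ _ = cst 0); first exact: cvg_cst.
by apply/funext => n; rewrite /pseries /series /= big1// => i _; rewrite mul0r.
Qed.

Lemma psums_to_sum (I : Type) (r : seq I) (a : I -> nat -> R) x (s : I -> R) :
  (forall i, psums_to (a i) x (s i)) ->
  psums_to (fun j => \sum_(i <- r) a i j) x (\sum_(i <- r) s i).
Proof.
move=> h; elim: r => [|i r IH].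
  rewrite big_nil (_ : (fun _ => _) = fun=> 0); first exact: psums_to0.
  by apply/funext => j; rewrite big_nil.
rewrite big_cons (_ : (fun _ => _) = fun j => a i j + \sum_(i <- r) a i j).
  exact: psums_toD.
by apply/funext => j; rewrite big_cons.
Qed.

(** Multiplication of a series by x^i. As Q' is a polynomial, the product Q' F is a finite
    combination of such shifts. *)
Definition shift_coef i c j : R := if (j < i)%N then 0 else c (j - i)%N.

Lemma psums_to_shift i a x s : psums_to a x s ->
  psums_to (shift_coef i a) x (x ^+ i * s).
Proof.
move=> ha; rewrite /psums_to -(cvg_shiftn i).
rewrite (_ : (fun _ => _) = fun n => x ^+ i * pseries a x n).
  exact: cvgMr.
apply/funext => n; rewrite /pseries /series /=.
rewrite (big_cat_nat (n:=i)) //= ?leq_addl//.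
rewrite [X in X + _ = _]big_nat [X in X + _ = _]big1 ?add0r; last first.
  by move=> j /andP[_ ji]; rewrite /shift_coef ji mul0r.
rewrite -{1}[i]add0n big_addn addnK mulr_sumr; apply: eq_bigr => j _.
rewrite /shift_coef ltnNge leq_addl /= addnK exprD; ring.
Qed.

End EntireSeries.

Section Marcinkiewicz.
Variable R : realType.
Implicit Types (m c : nat -> R) (x t : R).

Lemma ler_sum_support (f : nat -> R) (n r : nat) :
  (forall i, 0 <= f i) -> (forall i, (r <= i)%N -> f i = 0) ->
  \sum_(i < n) f i <= \sum_(i < r) f i.
Proof.
move=> f0 fr; apply: (@le_trans _ _ (\sum_(i < r + n) f i)).
  rewrite -!(big_mkord xpredT) (big_cat_nat (n:=n) (p:=(r + n)%N))//= ?leq_addl//.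
  by rewrite lerDl sumr_ge0.
rewrite big_split_ord /= [X in _ + X]big1 ?addr0// => i _.
by rewrite fr// leq_addr.
Qed.

Definition egf m j : R := m j / j`!%:R.

Lemma egf_rec m c j : cumulants_of m c ->
  j.+1%:R * egf m j.+1 =
  \sum_(i < j.+1) c i.+1 / i`!%:R * egf m (j - i)%N.
Proof.
move=> mc; rewrite /egf factS natrM mc.
have nf n : n`!%:R != 0 :> R by rewrite pnatr_eq0 -lt0n fact_gt0.
rewrite mulrCA invfM mulVKf ?pnatr_eq0// mulr_suml.
apply: eq_bigr => -[i /=]; rewrite ltnS => ij _.
rewrite -(bin_fact ij) !natrM; field.
by rewrite !nf pnatr_eq0 -lt0n bin_gt0 ij.
Qed.

(** Put g_j = |m_j| x^j / j! and s = sum |c_(i+1)| x^(i+1) / i!. By the recursion, (j+1) g_(j+1) is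
    at most s times a bound for the earlier terms; so once j + 1 > N >= s, the sum C of the first N
    + 1 terms remains a bound. *)
Lemma entire_egf m c r : cumulants_of m c ->
  (forall j, (r < j)%N -> c j = 0) -> entire (egf m).
Proof.
move=> mc cr x x0.
pose f i := `|c i.+1| / i`!%:R * x ^+ i.+1.
have f0 i : 0 <= f i by rewrite !mulr_ge0// exprn_ge0// ltW.
pose s := \sum_(i < r) f i.
have s0 : 0 <= s by apply: sumr_ge0.
pose N := (Num.bound s).
have sN : s <= N%:R by rewrite ltW// archi_boundP.
pose g j := `|egf m j| * x ^+ j.
have g0 i : 0 <= g i by rewrite !mulr_ge0// exprn_ge0// ltW.
pose C := \sum_(i < N.+1) g i.
have C0 : 0 <= C by apply: sumr_ge0.
exists C => j; rewrite -/(g j).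
elim/ltn_ind: j => -[|j] IH.
  by rewrite /C big_ord_recl lerDl sumr_ge0.
have [jN|Nj] := leqP j.+1 N.
  rewrite /C (bigD1 (inord j.+1)) //= inordK//.
  by rewrite lerDl sumr_ge0.
suff h : j.+1%:R * g j.+1 <= j.+1%:R * C by rewrite ler_pM2l in h.
have -> : j.+1%:R * g j.+1 =
    `|\sum_(i < j.+1) c i.+1 / i`!%:R * egf m (j - i)%N| * x ^+ j.+1.
  by rewrite -(egf_rec _ mc) normrM ger0_norm// mulrA.
apply: (@le_trans _ _ (\sum_(i < j.+1) f i * C)).
  apply: (@le_trans _ _ (\sum_(i < j.+1) f i * g (j - i)%N)).
    apply: le_trans (ler_wpM2r _ (ler_norm_sum _ _ _)) _.
      by rewrite exprn_ge0// ltW.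
    rewrite mulr_suml; apply: ler_sum => -[i /=]; rewrite ltnS => ij _.
    rewrite normrM normrM normfV (ger0_norm (ler0n R i`!)) /f /g.
    have -> : x ^+ j.+1 = x ^+ i.+1 * x ^+ (j - i) by rewrite -exprD addSn subnKC.
    rewrite le_eqVlt; apply/orP; left; apply/eqP; ring.
  apply: ler_sum => -[i /=]; rewrite ltnS => ij _.
  by apply: ler_wpM2l => //; apply: IH; rewrite ltnS leq_subr.
rewrite -mulr_suml; apply: ler_wpM2r => //.
apply: le_trans (@ler_sum_support f j.+1 r f0 _) _.
  by move=> i ri; rewrite /f cr// normr0 !mul0r.
by apply: le_trans sN _; rewrite ler_nat ltnW.
Qed.

(* [egf_cos m t] and [egf_sin m t] are the coefficients in [x] of the real and
   imaginary parts of [sum_j m_j z^j / j!] at [z = x exp(i t)]. *)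
Definition egf_cos m t j : R := egf m j * cos (j%:R * t).
Definition egf_sin m t j : R := egf m j * sin (j%:R * t).

Lemma entire_egf_cos m t : entire (egf m) -> entire (egf_cos m t).
Proof.
apply: entire_le => j; rewrite normrM ler_piMr//; exact: cos_max.
Qed.

Lemma entire_egf_sin m t : entire (egf m) -> entire (egf_sin m t).
Proof.
apply: entire_le => j; rewrite normrM ler_piMr//; exact: sin_max.
Qed.

(** The derivative of F(x exp(i t)) in x is exp(i t) Q' F, whence the angles (i+1) t. The weights
    (1, 0) and (0, 1) select the real and the imaginary part, so that one computation serves
    both. *)
Lemma psum_diffs_egf m c r t x (w1 w2 : R) : cumulants_of m c ->
  (forall j, (r < j)%N -> c j = 0) ->
  psum (pseries_diffs (fun j => egf m j *
     (w1 * cos (j%:R * t) + w2 * sin (j%:R * t)))) x =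
  \sum_(i < r) c i.+1 / i`!%:R * x ^+ i *
     (w1 * (cos (i.+1%:R * t) * psum (egf_cos m t) x
            - sin (i.+1%:R * t) * psum (egf_sin m t) x) +
      w2 * (sin (i.+1%:R * t) * psum (egf_cos m t) x
            + cos (i.+1%:R * t) * psum (egf_sin m t) x)).
Proof.
move=> mc cr; have ee := entire_egf mc cr.
have eA := @entire_psum _ _ x (entire_egf_cos t ee).
have eB := @entire_psum _ _ x (entire_egf_sin t ee).
apply: psums_to_psum.
pose d i l := c i.+1 / i`!%:R * shift_coef i (fun l =>
     (w1 * cos (i.+1%:R * t) + w2 * sin (i.+1%:R * t)) * egf_cos m t l +
     (w2 * cos (i.+1%:R * t) - w1 * sin (i.+1%:R * t)) * egf_sin m t l) l.
rewrite (_ : pseries_diffs _ = fun l => \sum_(i < r) d i l); last first.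
  apply/funext => j; rewrite /pseries_diffs mulrA (egf_rec _ mc) mulr_suml.
  pose F i := c i.+1 / i`!%:R * shift_coef i (egf m) j *
    (w1 * cos (j.+1%:R * t) + w2 * sin (j.+1%:R * t)).
  transitivity (\sum_(i < j.+1) F i).
    apply: eq_bigr => -[i /=]; rewrite ltnS => ij _.
    by rewrite /F /shift_coef ltnNge ij.
  have Fr i : (r <= i)%N -> F i = 0 by move=> ri; rewrite /F cr// !mul0r.
  have Fj i : (j.+1 <= i)%N -> F i = 0.
    by move=> ji; rewrite /F /shift_coef ji mulr0 mul0r.
  (* Both ranges are extended to [j.+1 + r], where the added terms vanish. *)
  transitivity (\sum_(i < r) F i).
    transitivity (\sum_(i < j.+1 + r) F i).
      by rewrite big_split_ord /= [X in _ + X]big1 ?addr0// => i _; rewrite Fj ?leq_addr.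
    by rewrite addnC big_split_ord /= [X in _ + X]big1 ?addr0// => i _; rewrite Fr ?leq_addr.
  apply: eq_bigr => i _; rewrite /F /d /shift_coef.
  have [ji|ij] := ltnP j i; first by rewrite !mulr0 mul0r.
  rewrite /egf_cos /egf_sin -mulrA; congr (_ * _).
  rewrite -{2 3}(subnKC ij) -addSn natrD mulrDl cosD sinD; ring.
apply: psums_to_sum => i /=.
rewrite /d -mulrA; apply: psums_toZ; apply: psums_to_shift.
rewrite [X in psums_to _ _ X](_ : _ =
   (w1 * cos (i.+1%:R * t) + w2 * sin (i.+1%:R * t)) * psum (egf_cos m t) x +
   (w2 * cos (i.+1%:R * t) - w1 * sin (i.+1%:R * t)) * psum (egf_sin m t) x); last by ring.
by apply: psums_toD; apply: psums_toZ.
Qed.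

(** This is Re Q(x exp(i t)), the logarithm of |F| along the ray of angle t. *)
Definition log_growth c r t x : R :=
  \sum_(i < r) c i.+1 / i.+1`!%:R * cos (i.+1%:R * t) * x ^+ i.+1.

Lemma is_derive_log_growth c r t x : is_derive x (1 : R) (log_growth c r t)
  (\sum_(i < r) c i.+1 / i`!%:R * cos (i.+1%:R * t) * x ^+ i).
Proof.
pose h (i : 'I_r) := (c i.+1 / i.+1`!%:R * cos (i.+1%:R * t)) \*: (@id R) ^+ i.+1.
rewrite (_ : log_growth c r t = \sum_(i < r) h i); last first.
  apply/funext => y; rewrite fct_sumE; apply: eq_bigr => i _.
  by rewrite /h /= /GRing.scale /= exprfctE.
apply: is_derive_sum => i; apply: is_derive_eq.
rewrite /GRing.scale /= factS natrM; field.
by rewrite nat1r !pnatr_eq0 -!lt0n fact_gt0.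
Qed.

(* The entire function [F(z) = sum_j m_j z^j / j!] solves [F' = Q' F] with
   [Q(z) = sum_j c_j z^j / j!], so that [|F|^2 = exp (2 Re Q)] along each ray. *)
Lemma egf_modulus m c r t x : cumulants_of m c -> m 0%N = 1 ->
  (forall j, (r < j)%N -> c j = 0) ->
  psum (egf_cos m t) x ^+ 2 + psum (egf_sin m t) x ^+ 2 =
  expR (2 * log_growth c r t x).
Proof.
move=> mc m0 cr; have ee := entire_egf mc cr.
set A := psum (egf_cos m t); set B := psum (egf_sin m t).
pose u x := \sum_(i < r) c i.+1 / i`!%:R * cos (i.+1%:R * t) * x ^+ i.
pose v x := \sum_(i < r) c i.+1 / i`!%:R * sin (i.+1%:R * t) * x ^+ i.
have dA y : is_derive y (1 : R) A (u y * A y - v y * B y).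
  have := is_derive_psum y (entire_egf_cos t ee).
  rewrite (_ : egf_cos m t = fun j => egf m j * (1 * cos (j%:R * t) + 0 * sin (j%:R * t))); last first.
    by apply/funext => j; rewrite mul1r mul0r addr0.
  rewrite (psum_diffs_egf _ _ _ _ mc cr).
  rewrite (_ : (fun j => egf m j * (1 * cos (j%:R * t) + 0 * sin (j%:R * t))) = egf_cos m t); last first.
    by apply/funext => j; rewrite mul1r mul0r addr0.
  congr (is_derive _ _ _ _); rewrite /u /v !mulr_suml -sumrB.
  by apply: eq_bigr => i _; rewrite -/A -/B; ring.
have dB y : is_derive y (1 : R) B (v y * A y + u y * B y).
  have := is_derive_psum y (entire_egf_sin t ee).
  rewrite (_ : egf_sin m t = fun j => egf m j * (0 * cos (j%:R * t) + 1 * sin (j%:R * t))); last first.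
    by apply/funext => j; rewrite mul1r mul0r add0r.
  rewrite (psum_diffs_egf _ _ _ _ mc cr).
  rewrite (_ : (fun j => egf m j * (0 * cos (j%:R * t) + 1 * sin (j%:R * t))) = egf_sin m t); last first.
    by apply/funext => j; rewrite mul1r mul0r add0r.
  congr (is_derive _ _ _ _); rewrite /u /v !mulr_suml -big_split /=.
  by apply: eq_bigr => i _; rewrite -/A -/B; ring.
(* The rotation terms with v cancel in the derivative of A^2 + B^2, which is 2 u (A^2 + B^2); so g
   is constant, equal to its value 1 at 0. *)
pose g y := (A y ^+ 2 + B y ^+ 2) * expR (- (2 * log_growth c r t y)).
have dg y : is_derive y (1 : R) g 0.
  have dU := is_derive_log_growth c r t y.
  rewrite /g; apply: is_derive_eq.
  rewrite /GRing.scale /= -/(u y); ring.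
have := is_derive_0_is_cst x 0 dg; rewrite /g.
have A0 : A 0 = 1.
  apply: psums_to_psum; rewrite /psums_to -(cvg_shiftn 1).
  rewrite (_ : (fun _ => _) = cst 1); first exact: cvg_cst.
  apply/funext => n; rewrite /pseries /series /= addn1 big_nat_recl//= big1; last first.
    by move=> i _; rewrite expr0n mulr0.
  by rewrite addr0 expr0 mulr1 /egf_cos mul0r cos0 /egf m0 fact0 divr1 mulr1.
have B0 : B 0 = 0.
  apply: psums_to_psum; rewrite /psums_to -(cvg_shiftn 1).
  rewrite (_ : (fun _ => _) = cst 0); first exact: cvg_cst.
  apply/funext => n; rewrite /pseries /series /= addn1 big_nat_recl//= big1; last first.
    by move=> i _; rewrite expr0n mulr0.
  by rewrite addr0 expr0 mulr1 /egf_sin mul0r sin0 mulr0.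
have -> : log_growth c r t 0 = 0.
  by rewrite /log_growth big1// => i _; rewrite expr0n mulr0.
rewrite A0 B0 mulr0 oppr0 expR0 expr1n expr0n /= addr0 mulr1 expRN => h.
have := expR_gt0 (2 * log_growth c r t x) => /lt0r_neq0 ne0.
by apply: (mulIf (invr_neq0 ne0)); rewrite h mulfV.
Qed.

End Marcinkiewicz.

Section Ridge.
Variable R : realType.
Implicit Types (m c : nat -> R) (x t : R).

(** A square sorted by s = i + l: the antidiagonals are complete for s < N and cut off for N <= s <
    2N. *)
Lemma sum_square_diagonals (N : nat) (G : nat -> nat -> R) :
  \sum_(i < N) \sum_(l < N) G i l =
  \sum_(0 <= s < N) \sum_(i < s.+1) G i (s - i)%N +
  \sum_(N <= s < N.*2) \sum_(0 <= i < N | (i <= s < N + i)%N) G i (s - i)%N.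
Proof.
transitivity (\sum_(0 <= i < N) \sum_(0 <= s < N.*2)
    if (i <= s < N + i)%N then G i (s - i)%N else 0).
  rewrite big_mkord; apply: eq_bigr => i _.
  transitivity (\sum_(i <= s < N + i) G i (s - i)%N).
    rewrite -{2}[i : nat]add0n big_addn addnK big_mkord.
    by apply: eq_bigr => l _; rewrite addnK.
  rewrite (@big_nat_widenl _ _ _ i 0)// (@big_nat_widen _ _ _ 0 (N + i) N.*2).
    by rewrite big_mkcond.
  by rewrite -addnn leq_add2l ltnW.
rewrite exchange_big_nat /=.
rewrite (big_cat_nat (n:=N)) //=; last by rewrite -addnn leq_addr.
congr (_ + _).
- rewrite big_nat [RHS]big_nat; apply: eq_bigr => s /andP[_ sN].
  rewrite -(big_mkord xpredT (fun i => G i (s - i)%N)).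
  rewrite (@big_nat_widen _ _ _ 0 s.+1 N)// big_mkcond [RHS]big_mkcond /=.
  apply: eq_bigr => i _; rewrite ltnS.
  by rewrite (leq_trans sN (leq_addr _ _)) andbT.
- by apply: eq_bigr => s _; rewrite -big_mkcond.
Qed.

(** If m were the moments of X, this would be the expectation of the square of Re((x - i y) exp(rho
    exp(i t) X)), whose Taylor coefficients are [q]. In the Hankel form of order N, the complete
    antidiagonals give partial sums of the three series, and the cut-off ones are dominated by a
    tail of the convergent series of [h]. *)
Lemma ridge_form m rho t x y : psd_moments m -> entire (egf m) -> 0 <= rho ->
  0 <= (x ^+ 2 + y ^+ 2) / 2 * psum (egf m) (2 * rho * cos t) +
       ((x ^+ 2 - y ^+ 2) / 2 * psum (egf_cos m t) (2 * rho) +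
        x * y * psum (egf_sin m t) (2 * rho)).
Proof.
move=> mpsd ee rho0.
pose u s := (x ^+ 2 + y ^+ 2) / 2 * (egf m s * (2 * rho * cos t) ^+ s) +
       ((x ^+ 2 - y ^+ 2) / 2 * (egf_cos m t s * (2 * rho) ^+ s) +
        x * y * (egf_sin m t s * (2 * rho) ^+ s)).
pose K := (`|x| + `|y|) ^+ 2.
pose h s := K * (`|egf m s| * (2 * rho) ^+ s).
have nf n : n`!%:R != 0 :> R by rewrite pnatr_eq0 -lt0n fact_gt0.
have cu : series u @ \oo --> (x ^+ 2 + y ^+ 2) / 2 * psum (egf m) (2 * rho * cos t) +
       ((x ^+ 2 - y ^+ 2) / 2 * psum (egf_cos m t) (2 * rho) +
        x * y * psum (egf_sin m t) (2 * rho)).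
  rewrite (_ : series u = fun n => (x ^+ 2 + y ^+ 2) / 2 * pseries (egf m) (2 * rho * cos t) n +
       ((x ^+ 2 - y ^+ 2) / 2 * pseries (egf_cos m t) (2 * rho) n +
        x * y * pseries (egf_sin m t) (2 * rho) n)).
    apply: cvgD; first by apply: cvgMr; exact: entire_psum.
    apply: cvgD; apply: cvgMr; apply: entire_psum.
      exact: entire_egf_cos.
    exact: entire_egf_sin.
  apply/funext => n; rewrite /pseries /series /= !mulr_sumr -!big_split /=.
  by [].
have ch : cvgn (series h).
  rewrite (_ : h = K *: (fun s => `|egf m s| * (2 * rho) ^+ s)); last first.
    by apply/funext.
  by apply: is_cvg_seriesZ; exact: entire_cvg_norm.
have tail0 : series h n.*2 - series h n @[n --> \oo] --> (0 : R).
  rewrite -[X in _ --> X](subrr (limn (series h))); apply: cvgB => //.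
  apply: (@cvg_comp _ _ _ double (series h) _ \oo) => //.
  rewrite (_ : double = muln^~ 2%N); first exact: cvg_mulnr.
  by apply/funext => n; rewrite muln2.
pose q i := rho ^+ i * (x * cos (i%:R * t) + y * sin (i%:R * t)) / i`!%:R.
pose G i l := q i * q l * m (i + l)%N.
have Gdiag s i : (i <= s)%N -> G i (s - i)%N =
   egf m s * rho ^+ s * ((x ^+ 2 + y ^+ 2) / 2 * ('C(s, i)%:R * cos (i%:R * t - (s - i)%:R * t + 0)) +
     ((x ^+ 2 - y ^+ 2) / 2 * cos (s%:R * t) + x * y * sin (s%:R * t)) * 'C(s, i)%:R).
  move=> si.
  have -> : s%:R * t = i%:R * t + (s - i)%:R * t by rewrite -mulrDl -natrD subnKC.
  rewrite addr0 cosB cosD sinD /G /q subnKC// /egf.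
  have -> : rho ^+ s = rho ^+ i * rho ^+ (s - i) by rewrite -exprD subnKC.
  have -> : (s`!%:R)^-1 = (i`!%:R)^-1 * ((s-i)`!%:R)^-1 / 'C(s, i)%:R :> R.
    rewrite -(bin_fact si) !natrM; field.
    by rewrite !nf pnatr_eq0 -lt0n bin_gt0 si.
  field.
  by rewrite !nf pnatr_eq0 -lt0n bin_gt0 si.
have Gabs s i : (i <= s)%N -> `|G i (s - i)%N| <= K * (`|egf m s| * rho ^+ s) * 'C(s, i)%:R.
  move=> si.
  have qb j : `|q j| <= rho ^+ j * (`|x| + `|y|) / j`!%:R.
    rewrite /q normrM normrM normfV (ger0_norm (exprn_ge0 _ rho0)) (ger0_norm (ler0n _ _)).
    apply: ler_wpM2r; first by rewrite invr_ge0.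
    apply: ler_wpM2l; first exact: exprn_ge0.
    apply: le_trans (ler_normD _ _) _; rewrite !normrM.
    by apply: lerD; rewrite ler_piMr// ?cos_max ?sin_max.
  rewrite /G subnKC// normrM normrM.
  have := ler_pM (normr_ge0 _) (normr_ge0 _) (qb i) (qb (s - i)%N).
  move=> /(ler_wpM2r (normr_ge0 (m s))) /le_trans; apply.
  rewrite /egf normrM normfV (ger0_norm (ler0n _ s`!)).
  have -> : rho ^+ s = rho ^+ i * rho ^+ (s - i) by rewrite -exprD subnKC.
  have -> : (s`!%:R)^-1 = (i`!%:R)^-1 * ((s-i)`!%:R)^-1 / 'C(s, i)%:R :> R.
    rewrite -(bin_fact si) !natrM; field.
    by rewrite !nf pnatr_eq0 -lt0n bin_gt0 si.
  rewrite /K le_eqVlt; apply/orP; left; apply/eqP; field.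
  by rewrite !nf pnatr_eq0 -lt0n bin_gt0 si.
have key N : 0 <= series u N + (series h N.*2 - series h N).
  apply: le_trans (mpsd N q) _.
  rewrite (sum_square_diagonals N G); apply: lerD.
    rewrite /series /= le_eqVlt; apply/orP; left; apply/eqP; apply: eq_bigr => s _.
    transitivity (\sum_(i < s.+1) egf m s * rho ^+ s * ((x ^+ 2 + y ^+ 2) / 2 *
     ('C(s, i)%:R * cos (i%:R * t - (s - i)%:R * t + 0)) +
     ((x ^+ 2 - y ^+ 2) / 2 * cos (s%:R * t) + x * y * sin (s%:R * t)) * 'C(s, i)%:R)).
      by apply: eq_bigr => -[i /=]; rewrite ltnS => si _; rewrite Gdiag.
    rewrite -mulr_sumr big_split /= -!mulr_sumr sum_bin_cos sum_bin_natr cos0 mulr1.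
    rewrite /u /egf_cos /egf_sin !exprMn; ring.
  rewrite sub_series -addnn leq_addr addnn.
  rewrite big_nat [leRHS]big_nat; apply: ler_sum => s /andP[Ns sN].
  apply: le_trans (ler_norm _) _; apply: le_trans (ler_norm_sum _ _ _) _.
  apply: (@le_trans _ _ (\sum_(0 <= i < N | (i <= s < N + i)%N)
      K * (`|egf m s| * rho ^+ s) * 'C(s, i)%:R)).
    by apply: ler_sum => i /andP[si _]; apply: Gabs.
  (* The binomials that occur belong to row s, so they add up to at most 2^s, which turns rho^s into
     (2 rho)^s. *)
  rewrite -mulr_sumr /h exprMn [2 ^+ s * _]mulrC !mulrA; apply: ler_wpM2l.
    by rewrite !mulr_ge0// ?exprn_ge0// addr_ge0.
  rewrite -sum_bin_natr -(big_mkord xpredT (fun i => 'C(s, i)%:R)).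
  rewrite [leRHS](big_cat_nat (n:=N))//= ?(leq_trans Ns)//.
  rewrite -[leLHS]addr0; apply: lerD; last exact: sumr_ge0.
  by rewrite big_mkcond /=; apply: ler_sum => i _; case: ifP.
have := cvgD cu tail0; rewrite addr0 => cv.
by apply: (cvgr_to_ge (cv _)); exact: nearW.
Qed.

Lemma psd_form_det (p q b : R) :
  (forall x y, 0 <= x ^+ 2 * p + 2 * x * y * b + y ^+ 2 * q) -> b ^+ 2 <= p * q.
Proof.
move=> H.
have p0 : 0 <= p by have := H 1 0; nra.
have q0 : 0 <= q by have := H 0 1; nra.
have := H 1 1; have := H 1 (-1) => h1 h2.
(* These vectors give p (p q - b^2) >= 0 and q (p q - b^2) >= 0; if p = q = 0, the vectors (1, 1)
   and (1, -1) force b = 0. *)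
have h3 := H (- b) p; have h4 := H q (- b).
have [p1|p1] := ltP 0 p.
  have : 0 <= p * (p * q - b ^+ 2) by nra.
  by rewrite pmulr_rge0// subr_ge0.
have [q1|q1] := ltP 0 q.
  have : 0 <= q * (p * q - b ^+ 2) by nra.
  by rewrite pmulr_rge0// subr_ge0.
have -> : b = 0 by lra.
by rewrite expr0n /= mulr_ge0.
Qed.

Lemma egf_ridge m rho t : psd_moments m -> entire (egf m) -> 0 <= rho ->
  psum (egf_cos m t) (2 * rho) ^+ 2 + psum (egf_sin m t) (2 * rho) ^+ 2
    <= psum (egf m) (2 * rho * cos t) ^+ 2.
Proof.
move=> mp ee r0.
set A := psum (egf_cos _ _) _; set B := psum _ (2 * rho); set F := psum (egf m) _.
have : B ^+ 2 <= (F + A) * (F - A).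
  apply: psd_form_det => x y.
  have := ridge_form t x y mp ee r0; rewrite -/A -/B -/F => h.
  by have := mulr_ge0 (ler0n R 2) h; congr (0 <= _); field.
by nra.
Qed.

Lemma lead_coef_ge0 (d : nat -> R) n :
  (forall y, 0 < y -> 0 <= \sum_(i < n.+1) d i * y ^+ i) -> 0 <= d n.
Proof.
move=> H; rewrite leNgt; apply/negP => dn.
pose S := \sum_(i < n) `|d i|.
have S0 : 0 <= S by apply: sumr_ge0.
(* At this point (y - 1) |d_n| = S, so the leading term outweighs S y^(n-1), a bound for all lower
   terms. *)
pose y := 1 + S / - d n.
have y1 : 1 <= y by rewrite lerDl divr_ge0// oppr_ge0 ltW.
have y0 : 0 < y by apply: lt_le_trans y1.
have yS : (y - 1) * - d n = S.
  by rewrite /y addrAC subrr add0r divfK// oppr_eq0 lt_eqF.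
have := H y y0; rewrite big_ord_recr /= leNgt => /negP; apply.
have le1 : \sum_(i < n) d i * y ^+ i <= S * y ^+ n.-1.
  rewrite /S mulr_suml; apply: ler_sum => i _.
  apply: (@le_trans _ _ (`|d i| * y ^+ i)).
    by apply: ler_wpM2r; [exact/exprn_ge0/ltW | exact: ler_norm].
  apply: ler_wpM2l => //; apply: ler_weXn2l => //.
  by rewrite -ltnS (leq_trans (ltn_ord i))// leqSpred.
apply: le_lt_trans (lerD le1 (lexx _)) _.
have yn : 0 < y ^+ n.-1 by exact: exprn_gt0.
case: n @S S0 y y1 y0 le1 dn H yS yn => [|n] S S0 y y1 y0 le1 dn H yS yn /=.
  by rewrite /S big_ord0 mul0r add0r expr0 mulr1.
rewrite exprS mulrA -mulrDl pmulr_llt0//; nra.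
Qed.

Lemma cos_itv_lt1 t : 0 < t < pi -> `|cos t| < 1.
Proof.
move=> /andP[t0 tpi].
have tin : t \in `[0, pi]%R by rewrite in_itv /= !ltW.
have zin : 0 \in `[0, @pi R]%R by rewrite in_itv /= lexx pi_ge0.
have pin : pi \in `[0, @pi R]%R by rewrite in_itv /= lexx pi_ge0.
have := @ltr_cos R 0 t zin tin; have := @ltr_cos R t pi tin pin.
by rewrite cos0 cospi tpi t0 ltr_norml => -> ->.
Qed.

Lemma marcinkiewicz_step m c r : psd_moments m -> m 0%N = 1 ->
  cumulants_of m c -> (forall j, (r.+3 < j)%N -> c j = 0) -> c r.+3 = 0.
Proof.
move=> mp m0 mc cr; have ee := entire_egf mc cr.
have lead t : 0 <= c r.+3 * (cos t ^+ r.+3 - cos (r.+3%:R * t)).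
  pose e i := c i / i`!%:R * (cos t ^+ i - cos (i%:R * t)).
  have : 0 <= e r.+3.
    apply: lead_coef_ge0 => y y0.
    have := egf_ridge t mp ee (ltW (divr_gt0 y0 (ltr0Sn R 1))).
    have := egf_modulus 0 (y * cos t) mc m0 cr.
    have := egf_modulus t y mc m0 cr.
    have -> : 2 * (y / 2) = y by field.
    have -> : psum (egf_cos m 0) (y * cos t) = psum (egf m) (y * cos t).
      by congr psum; apply/funext => j; rewrite /egf_cos mulr0 cos0 mulr1.
    have -> : psum (egf_sin m 0) (y * cos t) = 0.
      rewrite (_ : egf_sin m 0 = fun=> 0); first exact/psums_to_psum/psums_to0.
      by apply/funext => j; rewrite /egf_sin mulr0 sin0 mulr0.
    rewrite [0 ^+ 2]expr0n /= addr0 => -> ->; rewrite ler_expR ler_pM2l// -subr_ge0.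
    rewrite /log_growth -sumrB => h; rewrite big_ord_recl.
    (* [log_growth] starts at degree 1; the constant coefficient is added only to fit
       [lead_coef_ge0]. *)
    rewrite (_ : e (ord0 : 'I_r.+4) = 0) ?mul0r ?add0r.
      move: h; congr (0 <= _); apply: eq_bigr => i _; rewrite lift0 /e.
      by rewrite mulr0 cos0 exprMn; ring.
    by rewrite /e expr0 mul0r cos0 subrr mulr0.
  rewrite /e mulrAC pmulr_lge0// invr_gt0 ltr0n; exact: fact_gt0.
have r3 : r.+3%:R != 0 :> R by rewrite pnatr_eq0.
apply/eqP; rewrite eq_le; apply/andP; split.
  have := lead (2 * pi / r.+3%:R).
  have -> : r.+3%:R * (2 * pi / r.+3%:R) = pi *+ 2 :> R by field.
  rewrite cos2pi; set x := cos _ => h.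
  (* Here the order being at least 3 matters: 2 pi / r.+3 stays strictly below pi. In the same way
     pi / r.+3 stays below pi / 2 in the second half. *)
  have x1 : `|x| < 1.
    apply: cos_itv_lt1; rewrite divr_gt0 ?mulr_gt0 ?pi_gt0//=.
    rewrite ltr_pdivrMr// mulrC ltr_pM2l ?pi_gt0//.
    by rewrite ltr_nat.
  have xr : x ^+ r.+3 < 1.
    by apply: le_lt_trans (ler_norm _) _; rewrite normrX exprn_ilt1.
  by move: h; rewrite nmulr_lge0// subr_lt0.
have := lead (pi / r.+3%:R).
have -> : r.+3%:R * (pi / r.+3%:R) = pi :> R by field.
rewrite cospi opprK pmulr_lge0// ltr_pwDr// exprn_ge0// ltW//.
apply: cos_gt0_pihalf; rewrite (@lt_trans _ _ 0) ?oppr_lt0 ?divr_gt0 ?pi_gt0//=.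
by rewrite ltr_pM2l ?pi_gt0// ltf_pV2 ?posrE// ltr_nat.
Qed.

Lemma marcinkiewicz m c r : psd_moments m -> m 0%N = 1 ->
  cumulants_of m c -> (forall j, (r < j)%N -> c j = 0) ->
  forall j, (2 < j)%N -> c j = 0.
Proof.
move=> mp m0 mc; elim: r => [|r IH] cr j j2; first by rewrite cr// (ltn_trans _ j2).
have [r2|r2] := leqP r.+1 2; first by rewrite cr// (leq_ltn_trans r2).
case: r IH cr r2 => [|[|r]] // IH cr _.
apply: IH j2 => i ri; have [ri1|] := ltnP r.+3 i; first exact: cr.
move=> ir; have -> : i = r.+3 by apply/eqP; rewrite eqn_leq ir.
exact: marcinkiewicz_step mp m0 mc cr.
Qed.

End Ridge.

Fixpoint gauss_moment (R : realType) (n : nat) : R :=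
  match n with
  | 0 => 1
  | 1 => 0
  | (n'.+1 as p).+1 => p%:R * gauss_moment R n'
  end.

Lemma cvg_bigsum (R : realType) (I J : Type) (U : set_system I) (UF : Filter U)
    (r : seq J) (F : J -> I -> R) (l : J -> R) :
  (forall k, F k @ U --> l k) ->
  \sum_(k <- r) F k i @[i --> U] --> \sum_(k <- r) l k.
Proof.
move=> h; elim: r => [|k r IH].
  rewrite big_nil (_ : (fun _ => _) = cst 0); first exact: cvg_cst.
  by apply/funext => i; rewrite big_nil.
rewrite big_cons (_ : (fun _ => _) = fun i => F k i + \sum_(k <- r) F k i).
  exact: cvgD.
by apply/funext => i; rewrite big_cons.
Qed.

(** * Janson's theorem on high cumulants *)

Section UltraLimits.
Variables (R : realType) (I : Type) (U : set_system I).
Context {UU : UltraFilter U}.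
Implicit Types (f : I -> R) (M c : I -> nat -> R).

(** The reason for using ultrafilters: bounded sequences converge outright, so all limit moments and
    cumulants exist at once and no subsequences have to be extracted. *)
Lemma ultra_bounded_cvg f (B : R) : (\forall i \near U, `|f i| <= B) ->
  cvg (f @ U).
Proof.
move=> fB; have cB := @segment_compact R (- B) B.
have FB : (f @ U) `[- B, B]%classic.
  by near=> i; rewrite /= in_itv /= -ler_norml; near: i.
have [p [_ clp]] := cB _ (@fmap_proper_filter _ _ f U _) FB.
apply/cvg_ex; exists p => V Vp.
have [//|UnV] := in_ultra_setVsetC (f @^-1` V) UU.
have /set0P/negP[] : ~` V `&` V !=set0 by exact: clp.
by rewrite setICl.
Unshelve. all: by end_near. Qed.

Lemma moments_cvg M c : (forall i, M i 0%N = 1) ->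
  (forall i, cumulants_of (M i) (c i)) ->
  (forall j, cvg (c^~ j.+1 @ U)) -> forall j, cvg (M^~ j @ U).
Proof.
move=> M0 mc cc; elim/ltn_ind => -[|j] IH.
  rewrite (_ : M^~ 0%N = cst 1); last by apply/funext => i; exact: M0.
  exact: is_cvg_cst.
rewrite (_ : M^~ j.+1 = fun i => \sum_(k < j.+1) 'C(j, k)%:R * c i k.+1 * M i (j - k)%N).
  apply/cvg_ex; exists (\sum_(k < j.+1) 'C(j, k)%:R * lim (c^~ k.+1 @ U) * lim (M^~ (j - k)%N @ U)).
  apply: cvg_bigsum => k; apply: cvgM; last by apply: IH; rewrite ltnS leq_subr.
  by apply: cvgMr; exact: cc.
by apply/funext => i; rewrite mc.
Qed.

Lemma lim_cumulants M c : (forall i, M i 0%N = 1) ->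
  (forall i, cumulants_of (M i) (c i)) ->
  (forall j, cvg (c^~ j.+1 @ U)) ->
  cumulants_of (fun j => lim (M^~ j @ U)) (fun j => lim (c^~ j @ U)).
Proof.
move=> M0 mc cc j; apply/cvg_lim => //.
rewrite (_ : M^~ j.+1 = fun i => \sum_(k < j.+1) 'C(j, k)%:R * c i k.+1 * M i (j - k)%N).
  apply: cvg_bigsum => k; apply: cvgM; last exact: moments_cvg mc cc _.
  by apply: cvgMr; exact: cc.
by apply/funext => i; rewrite mc.
Qed.

Lemma lim_psd M : (forall i, psd_moments (M i)) ->
  (forall j, cvg (M^~ j @ U)) -> psd_moments (fun j => lim (M^~ j @ U)).
Proof.
move=> mp cM n q.
have : \sum_(k < n) \sum_(l < n) q k * q l * M i (k + l)%N @[i --> U] -->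
    \sum_(k < n) \sum_(l < n) q k * q l * lim (M^~ (k + l)%N @ U).
  by apply: cvg_bigsum => k; apply: cvg_bigsum => l; apply: cvgMr; exact: cM.
by move/cvgr_to_ge; apply; apply: nearW => i; exact: mp.
Qed.

(** Cauchy-Schwarz for X and X^j, read off from the Hankel form on vectors supported at the indices
    1 and j. *)
Lemma psd_moments_CS (m : nat -> R) j : psd_moments m -> (1 < j)%N ->
  m j.+1 ^+ 2 <= m 2 * m j.*2.
Proof.
move=> mp j1; apply: psd_form_det => x y.
pose q k := if k == 1%N then x else if k == j then y else 0.
have := mp j.+1 q.
have E (F : nat -> R) : \sum_(l < j.+1) q l * F l = x * F 1%N + y * F j.
  have j1' : (1 < j.+1)%N by rewrite ltnW.
  rewrite (bigD1 (Ordinal j1')) //= (bigD1 ord_max) /=; last first.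
    by rewrite -val_eqE /= gtn_eqF.
  rewrite big1 ?addr0; first by rewrite /q eqxx (gtn_eqF j1) eqxx.
  by move=> k /andP[]; rewrite -!val_eqE /= /q => /negPf-> /negPf->; rewrite mul0r.
have -> : \sum_(i < j.+1) \sum_(l < j.+1) q i * q l * m (i + l)%N =
    x * (x * m 2 + y * m j.+1) + y * (x * m j.+1 + y * m j.*2).
  transitivity (\sum_(i < j.+1) q i * (x * m (i + 1)%N + y * m (i + j)%N)).
    apply: eq_bigr => i _; rewrite -(E (fun l => m (i + l)%N)) mulr_sumr.
    by apply: eq_bigr => l _; rewrite mulrA.
  by rewrite (E (fun i => x * m (i + 1)%N + y * m (i + j)%N)) [(j + j)%N]addnn [(j + 1)%N]addn1.
by congr (0 <= _); ring.
Qed.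

(* By Cauchy-Schwarz [m_(j+1)^2 <= m_2 m_(2j)], so that the moments vanish in
   the limit. *)
Lemma vanishing_cumulants M c : (forall i, M i 0%N = 1) ->
  (forall i, psd_moments (M i)) ->
  (forall i, cumulants_of (M i) (c i)) ->
  (forall i, c i 1%N = 0) -> c^~ 2%N @ U --> 0 ->
  (forall j, cvg (c^~ j.+1 @ U)) -> forall j, c^~ j.+1 @ U --> 0.
Proof.
move=> M0 mp mc c1 c2 cc j.
have cM := moments_cvg M0 mc cc; have lp := lim_psd mp cM.
have lc := lim_cumulants M0 mc cc.
pose m j := lim (M^~ j @ U); pose k j := lim (c^~ j @ U).
have m0 : m 0%N = 1.
  by apply/cvg_lim => //; rewrite (_ : M^~ 0%N = cst 1);
    [exact: cvg_cst|apply/funext => i; exact: M0].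
have k1 : k 1%N = 0.
  by apply/cvg_lim => //; rewrite (_ : c^~ 1%N = cst 0);
    [exact: cvg_cst|apply/funext => i; exact: c1].
have k2 : k 2%N = 0 by apply/cvg_lim.
have m1 : m 1%N = 0.
  by rewrite /m lc big_ord_recl big_ord0 -/(k 1%N) k1 mulr0 mul0r addr0.
have m2 : m 2%N = 0.
  rewrite /m lc !big_ord_recl big_ord0 -/(k 1%N) /bump /= -/(k 2%N) k1 k2.
  by rewrite !mulr0 !mul0r !addr0.
have mj l : (0 < l)%N -> m l = 0.
  case: l => [//|[//|[//|l]]] _.
  have := @psd_moments_CS _ l.+2 lp isT; rewrite -/(m _) -/(m 2%N) m2 mul0r.
  rewrite -/(m _) => h; apply/eqP; rewrite -sqrf_eq0 eq_le h /=; exact: sqr_ge0.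
suff <- : k j.+1 = 0 by exact: cc.
have := lc j; rewrite -/(m j.+1) mj// big_ord_recr /= subnn -/(m 0%N) m0 mulr1 binn mul1r.
rewrite big1 ?add0r// => l _; rewrite -/(m (j - l)%N) mj ?mulr0// subn_gt0//.
Qed.

End UltraLimits.

Section Janson.
Variables (R : realType) (I : Type) (U : set_system I).
Context {UU : UltraFilter U}.
Variables (M c : I -> nat -> R) (K : nat).
Hypotheses (M0 : forall i, M i 0%N = 1) (mp : forall i, psd_moments (M i)).
Hypotheses (mc : forall i, cumulants_of (M i) (c i)).
Hypotheses (c1 : forall i, c i 1%N = 0) (c2 : c^~ 2%N @ U --> (1 : R)).
Hypothesis cK : forall j, (K <= j)%N -> c^~ j @ U --> (0 : R).

(* [scale] is the [K!]-th power of the factor by which the variable has to be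
   divided to make the largest cumulant of order below [K] of unit size. *)
Let ex j := (K`! %/ j)%N.
Let scale i : R := \sum_(j < K | (2 < j)%N) `|c i j| ^+ ex j.

Let ex_gt0 j : (0 < j < K)%N -> (0 < ex j)%N.
Proof.
move=> /andP[j0 jK]; rewrite divn_gt0//.
by apply: dvdn_leq; rewrite ?fact_gt0// dvdn_fact// j0 ltnW.
Qed.

Let ex_mul j : (0 < j < K)%N -> (j * ex j)%N = K`!.
Proof.
by move=> /andP[j0 jK]; rewrite mulnC divnK// dvdn_fact// j0 ltnW.
Qed.

Let scale_ge0 i : 0 <= scale i.
Proof. by apply: sumr_ge0 => j _; rewrite exprn_ge0. Qed.

Let scale_ge i j : (2 < j < K)%N -> `|c i j| ^+ ex j <= scale i.
Proof.
move=> /andP[j2 jK]; rewrite /scale (bigD1 (Ordinal jK))//= lerDl sumr_ge0//.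
Qed.

Let bounded_cumulants (B : R) : (\forall i \near U, scale i <= B) ->
  forall j, cvg (c^~ j.+1 @ U).
Proof.
move=> sB j.
have [jK|Kj] := ltnP j.+1 K; last by apply/cvg_ex; exists 0; exact: cK.
case: j jK => [|[|j]] jK.
- apply/cvg_ex; exists 0; rewrite (_ : c^~ 1%N = cst 0); first exact: cvg_cst.
  exact/funext.
- by apply/cvg_ex; exists 1.
apply: (@ultra_bounded_cvg _ _ _ _ _ (1 + B)).
apply: filterS sB => i sB.
have B0 : 0 <= B := le_trans (scale_ge0 i) sB.
(* A cumulant above 1 is at most its own [ex]-th power, hence at most [scale]. *)
have [h|h] := leP `|c i j.+3| 1; first by rewrite (le_trans h)// lerDl.
rewrite (@le_trans _ _ B) ?lerDr//; apply: le_trans sB.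
apply: le_trans (scale_ge i (j := j.+3) _); last exact: jK.
by apply: ler_eXnr; [apply: ex_gt0|exact: ltW].
Qed.

(** Multiplying the variable by [il i] multiplies every term of [scale] by the same factor, the
    K!-th power of [il i], and so brings [scale] to 1. *)
Let il i : R := (scale i `^ (K`!%:R^-1))^-1.

Let il_pow i : 0 < scale i -> scale i * il i ^+ K`! = 1.
Proof.
move=> s0; rewrite /il exprVn -powR_mulrn ?powR_ge0// -powRrM mulVf.
  by rewrite powRr1 ?ltW// mulfV// gt_eqF.
by rewrite pnatr_eq0 -lt0n fact_gt0.
Qed.

Let unbounded_cumulants :
  ~ (forall B : R, \forall i \near U, B < scale i).
Proof.
move=> sB.
have il0 : il @ U --> (0 : R).
  apply/cvgrPdist_le => e e0; near=> i.
  rewrite sub0r normrN ger0_norm ?invr_ge0 ?powR_ge0//.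
  rewrite /il -[e]invrK lef_pV2 ?posrE ?invr_gt0//; last first.
    by rewrite powR_gt0//; near: i; exact: sB.
  have h : (e^-1) ^+ K`! <= scale i by apply: ltW; near: i; exact: sB.
  have e1 : 0 <= e^-1 by rewrite invr_ge0 ltW.
  have fK : K`!%:R != 0 :> R by rewrite pnatr_eq0 -lt0n fact_gt0.
  have -> : e^-1 = (e^-1 ^+ K`!) `^ (K`!%:R^-1).
    by rewrite -powR_mulrn// -powRrM mulfV// powRr1.
  by apply: ge0_ler_powR; rewrite ?nnegrE ?exprn_ge0 ?invr_ge0 ?scale_ge0 ?(ltW e0).
pose M' i j := M i j * il i ^+ j.
pose c' i j := c i j * il i ^+ j.
have M'0 i : M' i 0%N = 1 by rewrite /M' M0 expr0 mulr1.
have mp' i : psd_moments (M' i).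
  move=> n q; have := mp i n (fun k => q k * il i ^+ k).
  congr (0 <= _); apply: eq_bigr => k _; apply: eq_bigr => l _.
  by rewrite /M' exprD; ring.
have mc' i : cumulants_of (M' i) (c' i).
  move=> j; rewrite /M' /c' mc mulr_suml; apply: eq_bigr => -[k /=].
  rewrite ltnS => kj _.
  have -> : il i ^+ j.+1 = il i ^+ k.+1 * il i ^+ (j - k).
    by rewrite -exprD addSn subnKC.
  by ring.
have c1' i : c' i 1%N = 0 by rewrite /c' c1 mul0r.
have ilX j : il i ^+ j.+1 @[i --> U] --> (0 : R).
  elim: j => [|j IH]; first by [].
  rewrite -[X in _ --> X](mulr0 0) (_ : (fun i => il i ^+ j.+2) = fun i => il i * il i ^+ j.+1); last first.
    by apply/funext => i; rewrite exprS.
  exact: cvgM.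
have c2' : c'^~ 2%N @ U --> (0 : R).
  by rewrite -[X in _ --> X](mulr0 1); apply: cvgM.
have scaled i : 0 < scale i ->
    \sum_(j < K | (2 < j)%N) `|c' i j| ^+ ex j = 1.
  move=> s0; rewrite -(il_pow s0) /scale mulr_suml; apply: eq_bigr => j j2.
  rewrite /c' normrM exprMn; congr (_ * _).
  rewrite ger0_norm ?exprn_ge0 ?invr_ge0 ?powR_ge0// -exprM ex_mul//.
  by rewrite (ltn_trans _ j2) /=.
have cc' j : cvg (c'^~ j.+1 @ U).
  have [jK|Kj] := ltnP j.+1 K; last first.
    by apply/cvg_ex; exists (0 * 0); apply: cvgM; [exact: cK|exact: ilX].
  case: j jK => [|[|j]] jK.
  - apply/cvg_ex; exists 0; rewrite (_ : c'^~ 1%N = cst 0); first exact: cvg_cst.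
    exact/funext.
  - by apply/cvg_ex; exists 0.
  apply: (@ultra_bounded_cvg _ _ _ _ _ 1); near=> i.
  have s0 : 0 < scale i by near: i; exact: sB.
  have := scaled _ s0; rewrite (bigD1 (Ordinal jK))//= => h.
  have : `|c' i j.+3| ^+ ex j.+3 <= 1.
    by rewrite -h lerDl sumr_ge0// => k _; rewrite exprn_ge0.
  by rewrite expr_le1// ex_gt0.
have van := vanishing_cumulants M'0 mp' mc' c1' c2' cc'.
have : \sum_(j < K | (2 < j)%N) `|c' i j| ^+ ex j @[i --> U] --> (0 : R).
  rewrite (_ : (fun i => _) = fun i => \sum_(j < K) if (2 < j)%N then `|c' i j| ^+ ex j else 0); last first.
    by apply/funext => i; rewrite big_mkcond.
  rewrite -[X in _ --> X](_ : \sum_(j < K) (0 : R) = 0); last by rewrite big1.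
  apply: cvg_bigsum => -[j jK] /=; case: (boolP (2 < j)%N) => j2; last exact: cvg_cst.
  have := @ex_gt0 j; rewrite (ltn_trans _ j2)//= jK => /(_ isT).
  case: (ex j) => // e _.
  have cj : `|c' i j| @[i --> U] --> (0 : R).
    rewrite -[X in _ --> X](@normr0 _ R); apply: cvg_norm.
    by case: j j2 {jK} => // j _; exact: van.
  elim: e => [|e IH]; first by [].
  rewrite -[X in _ --> X](mulr0 0) (_ : (fun i => _) = fun i => `|c' i j| * `|c' i j| ^+ e.+1); last first.
    by apply/funext => i; rewrite exprS.
  exact: cvgM.
move=> h0.
have h1 : \sum_(j < K | (2 < j)%N) `|c' i j| ^+ ex j @[i --> U] --> (1 : R).
  apply: cvg_near_cst; near=> i; apply: scaled; near: i; exact: sB.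
have := cvg_unique _ h0 h1; move=> /(_ _) h.
by have := oner_neq0 R; rewrite -h ?eqxx.
Unshelve. all: by end_near. Qed.

Lemma janson_ultra j : M^~ j @ U --> gauss_moment R j.
Proof.
have cc : forall j, cvg (c^~ j.+1 @ U).
  have [[B hB]|hB] := pselect (exists B, \forall i \near U, scale i <= B).
    exact: bounded_cumulants hB.
  exfalso; apply: unbounded_cumulants => B.
  (* An ultrafilter decides every bound B, so if no bound holds near U, then [scale] exceeds each B
     near U. *)
  have [h|h] := in_ultra_setVsetC [set i | scale i <= B] UU.
    by exfalso; apply: hB; exists B.
  by apply: filterS h => i /= /negP; rewrite -ltNge.
have cM j := moments_cvg (UU := UU) M0 mc cc j.
have lp := lim_psd (UU := UU) mp cM; have lc := lim_cumulants (UU := UU) M0 mc cc.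
pose m j := lim (M^~ j @ U); pose k j := lim (c^~ j @ U).
have m0 : m 0%N = 1.
  by apply/cvg_lim => //; rewrite (_ : M^~ 0%N = cst 1);
    [exact: cvg_cst|apply/funext => i; exact: M0].
have k1 : k 1%N = 0.
  by apply/cvg_lim => //; rewrite (_ : c^~ 1%N = cst 0);
    [exact: cvg_cst|apply/funext => i; exact: c1].
have k2 : k 2%N = 1 by apply/cvg_lim.
have kK l : (K < l)%N -> k l = 0 by move=> Kl; apply/cvg_lim => //; apply: cK; exact: ltnW.
have k3 := marcinkiewicz lp m0 lc kK.
suff <- : m j = gauss_moment R j by exact: cM.
elim/ltn_ind: j => -[|[|j]] IH //.
  by rewrite /m lc big_ord_recl big_ord0 -/(k 1%N) k1 mulr0 mul0r addr0.
rewrite /m lc !big_ord_recl -/(k 1%N) /bump /= -/(k 2%N) k1 k2 mulr0 mul0r add0r.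
rewrite big1 ?addr0 => [|i _]; last by rewrite [X in _ * X * _]k3 ?mulr0 ?mul0r.
by rewrite bin1 mulr1 subSS subn0 -/(m j) IH// ltnS ltnW.
Qed.

End Janson.

(** * The moments of the normal distribution *)

Section NormalIntegral.
Import HBNNSimple.
Variable R : realType.
Notation mu := (@lebesgue_measure R).
Let N : probability (measurableTypeR R) R := normal_prob 0 1.
Let phi : R -> R := normal_pdf 0 1.

Let mphi : measurable_fun setT phi. Proof. exact: measurable_normal_pdf. Qed.
Let phi_ge0 x : 0 <= phi x. Proof. exact: normal_pdf_ge0. Qed.

Let integral_normal_indic (E : set R) : measurable E ->
  (\int[N]_x (\1_E x)%:E = \int[mu]_x ((\1_E x)%:E * (phi x)%:E))%E.
Proof.
move=> mE; rewrite integral_indic// setIT.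
rewrite [LHS]integral_mkcond; apply: eq_integral => x _.
by rewrite patchE indicE; case: ifPn => xE; rewrite ?mul1e ?mul0e.
Qed.

Let integral_normal_nnsfun (f : {nnsfun _ >-> R}) :
  (\int[N]_x (f x)%:E = \int[mu]_x ((f x)%:E * (phi x)%:E))%E.
Proof.
under [LHS]eq_integral do rewrite fimfunE -fsumEFin//.
rewrite [LHS]ge0_integral_fsum//; last 2 first.
  - by move=> r; exact/measurable_EFinP/measurableT_comp.
  - by move=> n x _; rewrite EFinM nnfun_muleindic_ge0.
under [RHS]eq_integral.
  move=> x xD; rewrite fimfunE -fsumEFin// ge0_mule_fsuml; last first.
    by move=> r; rewrite EFinM nnfun_muleindic_ge0.
  over.
rewrite [RHS]ge0_integral_fsum//; last 2 first.
  - move=> r; apply: emeasurable_funM; last exact/measurable_EFinP.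
    by apply/measurable_EFinP/measurableT_comp.
  - by move=> n x _; apply: mule_ge0; [rewrite EFinM nnfun_muleindic_ge0|rewrite lee_fin].
apply: eq_fsbigr => r _.
have mr : measurable (f @^-1` [set r]).
  by apply: (measurable_funPTI f); exact: measurable_set1.
rewrite integralZl_indic_nnsfun//= integral_normal_indic//.
have [r0|r0] := leP 0 r.
  rewrite -ge0_integralZl//=.
  - by apply: eq_integral => x _; rewrite muleA.
  - apply: emeasurable_funM; last exact/measurable_EFinP.
    exact/measurable_EFinP/measurable_indic.
  - by move=> x _; rewrite mule_ge0 ?lee_fin.
rewrite preimage_nnfun0//.
by rewrite !integral0_eq ?mule0// => x _; rewrite indic0 ?mulr0 mul0e.
Qed.

Lemma ge0_integral_normal_prob (f : R -> \bar R) :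
  measurable_fun [set: measurableTypeR R] f -> (forall x, 0 <= f x)%E ->
  (\int[N]_x f x = \int[mu]_x (f x * (phi x)%:E))%E.
Proof.
move=> mf f0.
pose f_ := nnsfun_approx measurableT mf.
transitivity (lim (\int[N]_x (f_ n x)%:E @[n --> \oo])%E).
  rewrite -monotone_convergence//=.
  - apply: eq_integral => ? /[!inE] xD; apply/esym/cvg_lim => //=.
    exact: cvg_nnsfun_approx.
  - by move=> n; exact/measurable_EFinP/measurable_funTS.
  - by move=> n ? _; rewrite lee_fin.
  - by move=> ? _ ? ? mn; rewrite lee_fin; exact/lefP/nd_nnsfun_approx.
transitivity (lim (\int[mu]_x ((f_ n x)%:E * (phi x)%:E) @[n --> \oo])%E).
  by apply: congr_lim; apply/funext => n /=; exact: integral_normal_nnsfun.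
rewrite -monotone_convergence//=.
- apply: eq_integral => x _; apply/cvg_lim => //=.
  apply: cvgeMr => //; exact: cvg_nnsfun_approx.
- move=> n; apply: emeasurable_funM; last exact/measurable_EFinP.
  exact/measurable_EFinP/measurable_funTS.
- by move=> n ? _; rewrite mule_ge0 ?lee_fin.
- move=> x _ ? ? mn; rewrite lee_wpmul2r ?lee_fin//.
  exact/lefP/nd_nnsfun_approx.
Qed.

Lemma integral_normal_prob (f : R -> R) : measurable_fun setT f ->
  mu.-integrable setT (fun x => (f x * phi x)%:E) ->
  N.-integrable setT (EFin \o f) /\
  (\int[N]_x f x = \int[mu]_x (f x * phi x))%R.
Proof.
move=> mf fi.
have mf' : measurable_fun [set: measurableTypeR R] f by [].
have normE : (\int[N]_x `|(f x)%:E| = \int[mu]_x `|(f x * phi x)%:E|)%E.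
  rewrite ge0_integral_normal_prob//=; last first.
    by do 2 apply: measurableT_comp => //.
  by apply: eq_integral => x _; rewrite -EFinM normrM (ger0_norm (phi_ge0 x)).
have Ni : N.-integrable setT (EFin \o f).
  apply/integrableP; split; first exact/measurable_EFinP.
  by rewrite normE; case/integrableP : fi.
split => //.
have ai : mu.-integrable setT (fun x => (`|f x| * phi x)%:E).
  apply: eq_integrable (integrable_abse fi) => // x _ /=.
  by rewrite normrM (ger0_norm (phi_ge0 x)).
have Nai : N.-integrable setT (EFin \o (fun x => `|f x|)).
  by apply: eq_integrable (integrable_abse Ni).
have pos (g : R -> R) : measurable_fun setT g -> (forall x, 0 <= g x) ->
    \int[N]_x g x = \int[mu]_x (g x * phi x).
  move=> mg g0; rewrite /Rintegral ge0_integral_normal_prob//.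
  exact/measurable_EFinP.
(* Writing f as (f + |f|) - |f| reduces the claim to nonnegative functions. *)
have <- : \int[N]_x ((f x + `|f x|) - `|f x|) = \int[N]_x f x.
  by apply: eq_Rintegral => x _; rewrite addrK.
have <- : \int[mu]_x ((f x + `|f x|) * phi x - `|f x| * phi x) = \int[mu]_x (f x * phi x).
  by apply: eq_Rintegral => x _; rewrite -mulrBl addrK.
have Nsi : N.-integrable setT (EFin \o (fun x => f x + `|f x|)).
  by apply: eq_integrable (integrableD _ Ni Nai).
have si : mu.-integrable setT (EFin \o (fun x => (f x + `|f x|) * phi x)).
  by apply: eq_integrable (integrableD _ fi ai) => // x _ /=; rewrite mulrDl.
rewrite RintegralB// RintegralB//.
rewrite !pos//; first exact: measurableT_comp.
  by apply: measurable_funD => //; exact: measurableT_comp.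
by move=> x; have := ler_norm (- f x); rewrite normrN; lra.
Qed.

End NormalIntegral.

Section NormalMoments.
Variable R : realType.
Notation mu := (@lebesgue_measure R).
Notation phi := (@normal_pdf R 0 1).

Lemma std_normal_pdfE (x : R) : phi x = normal_peak 1 * expR (- (x ^+ 2 / 2)).
Proof.
rewrite normal_pdfE ?oner_eq0// /normal_fun subr0 expr1n.
by rewrite mulNr.
Qed.

(** Split exp(-x^2/2) as exp(-3x^2/8) exp(-x^2/8): the first factor absorbs any power of x, and the
    second is the normal density of standard deviation 2 up to a constant, which is known to be
    integrable. *)
Lemma std_normal_pdf_tail (k : nat) : exists2 D : R, 0 <= D &
  forall x : R, `|x| ^+ k * phi x <= D * normal_pdf 0 2 x.
Proof.
have p1 : 0 < normal_peak 1 :> R by rewrite normal_peak_gt0 ?oner_eq0.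
have p2 : 0 < normal_peak 2 :> R by rewrite normal_peak_gt0.
have even_case l : exists2 D : R, 0 <= D &
    forall x, x ^+ l.*2 * phi x <= D * normal_pdf 0 2 x.
  pose D : R := (8 / 3) ^+ l * l`!%:R * normal_peak 1 / normal_peak 2.
  have c0 : 0 <= (8 / 3) ^+ l * l`!%:R :> R.
    by rewrite mulr_ge0// exprn_ge0// divr_ge0.
  exists D; first by rewrite !mulr_ge0 ?invr_ge0// ?exprn_ge0 ?divr_ge0// ltW.
  move=> x; rewrite std_normal_pdfE normal_pdfE// /normal_fun subr0 /D.
  rewrite mulrA [leRHS]mulrA divfK ?gt_eqF// mulrAC [leRHS]mulrAC ler_pM2r//.
  have -> : - (x ^+ 2 / 2) = - (3 / 8 * x ^+ 2) + - x ^+ 2 / (2 ^+ 2 *+ 2) :> R by field.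
  rewrite expRD mulrA ler_wpM2r ?expR_ge0// expRN ler_pdivrMr ?expR_gt0//.
  pose y : R := 3 / 8 * x ^+ 2.
  have y0 : 0 <= y by rewrite mulr_ge0 ?sqr_ge0.
  have -> : x ^+ l.*2 = (8 / 3) ^+ l * y ^+ l.
    by rewrite -exprMn -mul2n exprM; congr (_ ^+ _); rewrite /y; field.
  rewrite -[leRHS]mulrA; apply: ler_wpM2l.
    by rewrite exprn_ge0// divr_ge0.
  case: (l) => [|l']; first by rewrite expr0 mul1r; have := expR_ge1Dx y; lra.
  have := @expR_ge1Dxn _ y l' y0 => h.
  rewrite mulrC -ler_pdivrMr ?ltr0n ?fact_gt0//.
  by apply: le_trans h; rewrite lerDr.
(* An arbitrary exponent reduces to the even ones 0 and 2k by z <= 1 + z^2 with z = |x|^k. *)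
have [D0 D00 H0] := even_case 0%N; have [D1 D10 H1] := even_case k.
exists (D0 + D1) => [|x]; first exact: addr_ge0.
rewrite mulrDl; apply: le_trans (lerD (H0 x) (H1 x)).
rewrite -mulrDl; apply: ler_wpM2r; first exact: normal_pdf_ge0.
rewrite -[x ^+ k.*2](_ : `|x| ^+ k.*2 = _); last first.
  by rewrite -mul2n !exprM real_normK// num_real.
rewrite expr0 -addnn exprD.
have : 0 <= `|x| ^+ k by rewrite exprn_ge0.
move: (_ ^+ k) => z z0; nra.
Qed.

Lemma measurable_exprn (k : nat) : measurable_fun setT (fun x : R => x ^+ k).
Proof. exact: measurable_funX. Qed.

Lemma measurable_pow_pdf (k : nat) : measurable_fun setT (fun x : R => x ^+ k * phi x).
Proof. by apply: measurable_funM; [exact: measurable_exprn|exact: measurable_normal_pdf]. Qed.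

Lemma integrable_pow_pdf (k : nat) :
  mu.-integrable setT (fun x => (x ^+ k * phi x)%:E).
Proof.
have [D D0 H] := std_normal_pdf_tail k.
apply: (@le_integrable _ _ _ mu _ measurableT _ (fun x => (D%:E * (normal_pdf 0 2 x)%:E)%E)).
- by apply/measurable_EFinP; exact: measurable_pow_pdf.
- move=> x _; rewrite -EFinM /= lee_fin normrM normrX (ger0_norm (normal_pdf_ge0 _ _ x)).
  by rewrite (le_trans (H x))// ler_norm.
- by apply: integrableZl => //; exact: integrable_normal_pdf.
Qed.

Lemma is_derive_pow_pdf (k : nat) (x : R) : is_derive x (1 : R)
  (fun x => x ^+ k * phi x) ((k%:R * x ^+ k.-1 - x ^+ k.+1) * phi x).
Proof.
rewrite (_ : (fun x => x ^+ k * phi x) =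
  (id ^+ k) * (normal_peak 1 \*: (expR \o (- (2^-1 : R) \*: (id ^+ 2))))); last first.
  apply/funext => y; rewrite mulrfctE exprfctE std_normal_pdfE /= /GRing.scale /=.
  by rewrite exprfctE mulNr [2^-1 * _]mulrC.
rewrite std_normal_pdfE.
apply: is_derive_eq.
rewrite /= /GRing.scale /= !exprfctE !expr1 mulNr [2^-1 * _]mulrC [x ^+ k.+1]exprS.
by move: (x ^+ k.-1) (expR _) => z e; field.
Qed.

Lemma continuous_pow_pdf (k : nat) : continuous (fun x : R => x ^+ k * phi x).
Proof.
move=> x; apply: cvgM; first exact: exprn_continuous.
exact: continuous_normal_pdf.
Qed.

Lemma cvg_pow_pdf (k : nat) (s : R) : `|s| = 1 ->
  (s * n.+1%:R) ^+ k * phi (s * n.+1%:R) @[n --> \oo] --> (0 : R).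
Proof.
move=> s1; have [D D0 H] := std_normal_pdf_tail k.+1.
pose B := D * normal_peak 2.
have bound n : `|(s * n.+1%:R) ^+ k * phi (s * n.+1%:R)| <= B * harmonic n.
  rewrite /harmonic /= ler_pdivlMr// normrM normrX (ger0_norm (normal_pdf_ge0 _ _ _)).
  rewrite normrM s1 mul1r ger0_norm// mulrAC -exprSr.
  have := H (s * n.+1%:R); rewrite normrM s1 mul1r ger0_norm// => /le_trans; apply.
  by rewrite /B ler_wpM2l// normal_pdf_ub.
apply/norm_cvg0P.
apply: (@squeeze_cvgr _ _ _ _ (cst 0) (fun n => B * harmonic n)).
- by apply: nearW => n; rewrite normr_ge0 bound.
- exact: cvg_cst.
- by rewrite -[X in _ --> X](mulr0 B); apply: cvgMr; exact: cvg_harmonic.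
Qed.

(** Integration by parts, the source of the moment recursion: the integrand is the derivative of x^k
    phi, whose boundary values at -(n+1) and n+1 tend to 0. For k = 0 the factor k disposes of the
    truncated exponent [k.-1]. *)
Lemma integral_derive_pow_pdf (k : nat) :
  (\int[mu]_x ((k%:R * x ^+ k.-1 - x ^+ k.+1) * phi x)%:E = 0)%E.
Proof.
pose H (x : R) := x ^+ k * phi x.
pose h (x : R) := (k%:R * x ^+ k.-1 - x ^+ k.+1) * phi x.
have hE x : h x = k%:R * (x ^+ k.-1 * phi x) - x ^+ k.+1 * phi x.
  by rewrite /h mulrBl mulrA.
have ch : continuous h.
  move=> x; rewrite (_ : h = fun x => k%:R * (x ^+ k.-1 * phi x) - x ^+ k.+1 * phi x); last exact/funext.
  apply: cvgB; last exact: continuous_pow_pdf.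
  by apply: cvgMr; exact: continuous_pow_pdf.
have mh : measurable_fun setT h by exact: continuous_measurable_fun.
have ih : mu.-integrable setT (EFin \o h).
  apply: eq_integrable (integrableB _ (integrableZl _ k%:R (integrable_pow_pdf k.-1)) (integrable_pow_pdf k.+1)) => //.
  by move=> x _ /=; rewrite hE.
pose D n := `[- n.+1%:R, n.+1%:R : R]%classic.
pose h_ n := (EFin \o h) \_ (D n).
have [|||||_ _] := @dominated_convergence _ _ _ mu setT measurableT h_ (EFin \o h) (abse \o (EFin \o h)).
- move=> n; apply/(measurable_restrictT _ _).1 => //; first exact: measurable_itv.
  by apply/measurable_funTS/measurable_EFinP.
- exact/measurable_EFinP.
- apply: aeW => x _; apply: cvg_near_cst; near=> n.
  rewrite /h_ patchE ifT// inE /D /= in_itv /= -ler_norml.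
  apply: ltW; apply: (lt_le_trans (archi_boundP (normr_ge0 x))).
  by rewrite ler_nat; apply: leqW; near: n; exact: nbhs_infty_ge.
- exact: integrable_abse.
- apply: aeW => x n _; rewrite /h_ patchE; case: ifP => // _.
  by rewrite abse0 abse_ge0.
move=> c1.
have c2 : [sequence (\int[mu]_x h_ n x)%E]_n @ \oo --> 0%:E.
  rewrite (_ : [sequence _]_n = EFin \o (fun n => H (1 * n.+1%:R) - H (-1 * n.+1%:R))); last first.
    apply/funext => n /=; rewrite /h_ -integral_mkcond /D mul1r mulN1r.
    rewrite (@continuous_FTC2 _ h H); first by rewrite EFinB.
    - by rewrite (@lt_trans _ _ 0)// oppr_lt0.
    - by apply: continuous_subspaceT => x; exact: ch.
    - have cH x : H y @[y --> x] --> H x by exact: continuous_pow_pdf.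
      split; [|exact/cvg_at_right_filter|exact/cvg_at_left_filter] => x _.
      by have [] := is_derive_pow_pdf k x.
    - by move=> x _; rewrite derive1E; have [_] := is_derive_pow_pdf k x.
  apply: cvg_EFin; first exact: nearW.
  rewrite -[X in _ --> X](subrr (0 : R)); apply: cvgB; apply: cvg_pow_pdf.
    by rewrite normr1.
  by rewrite normrN1.
exact: (cvg_unique _ c1 c2).
Unshelve. all: by end_near. Qed.

Lemma integrable_normal_pow (k : nat) :
  (normal_prob 0 1 : probability (measurableTypeR R) R).-integrable setT
    (EFin \o (fun x => x ^+ k)).
Proof. by have [] := integral_normal_prob (measurable_exprn k) (integrable_pow_pdf k). Qed.

Lemma normal_moments (k : nat) :
  \int[normal_prob 0 1]_(x in [set: measurableTypeR R]) (x : R) ^+ k = gauss_moment R k.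
Proof.
have mE j : \int[normal_prob 0 1]_(x in [set: measurableTypeR R]) (x : R) ^+ j =
    \int[mu]_x (x ^+ j * phi x).
  by have [_] := integral_normal_prob (measurable_exprn j) (integrable_pow_pdf j).
have rec j : \int[mu]_x (x ^+ j.+1 * phi x) = j%:R * \int[mu]_x (x ^+ j.-1 * phi x).
  rewrite -RintegralZl//; last exact: integrable_pow_pdf.
  have iz : mu.-integrable setT (EFin \o (fun x => j%:R * (x ^+ j.-1 * phi x))).
    by apply: eq_integrable (integrableZl _ j%:R (integrable_pow_pdf j.-1)).
  apply/esym/eqP; rewrite -subr_eq0 -RintegralB//; last exact: integrable_pow_pdf.
  rewrite /Rintegral; apply/eqP.
  transitivity (fine (\int[mu]_x ((j%:R * x ^+ j.-1 - x ^+ j.+1) * phi x)%:E)%E).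
    by congr fine; apply: eq_integral => x _; rewrite mulrBl mulrA.
  by rewrite integral_derive_pow_pdf.
rewrite mE; elim/ltn_ind: k => -[|[|k]] IH.
- rewrite /Rintegral; under eq_integral do rewrite expr0 mul1r.
  by rewrite integral_normal_pdf.
- by rewrite rec mul0r.
- by rewrite rec IH// ltnS ltnW.
Qed.

End NormalMoments.

(** * The method of moments *)

Section CosTaylor.
Variable R : realType.

(** The mean value theorem for x^(n+1) / (n+1)! - F on [0, x]; passing to -F and to the reflection
    of F yields absolute values and negative arguments. *)
Lemma derive_bound_integrate (F dF : R -> R) (n : nat) : F 0 = 0 ->
  (forall x, is_derive x (1 : R) F (dF x)) ->
  (forall x, `|dF x| <= `|x| ^+ n / n`!%:R) ->
  forall x, `|F x| <= `|x| ^+ n.+1 / n.+1`!%:R.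
Proof.
have pos (G dG : R -> R) x : 0 <= x -> G 0 = 0 ->
    (forall x, is_derive x (1 : R) G (dG x)) ->
    (forall x, `|dG x| <= `|x| ^+ n / n`!%:R) -> G x <= x ^+ n.+1 / n.+1`!%:R.
  move=> x0 G0 dGP dGb.
  pose K := n.+1`!%:R^-1 \*: (@id R) ^+ n.+1 - G.
  pose dK y := y ^+ n / n`!%:R - dG y.
  have KP y : is_derive y (1 : R) K (dK y).
    rewrite /K /dK; apply: is_derive_eq.
    rewrite /GRing.scale /= factS natrM; field.
    by rewrite nat1r !pnatr_eq0 -!lt0n fact_gt0.
  have cK : {within `[0, x], continuous K}.
    apply: continuous_subspaceT => y; apply: differentiable_continuous.
    by apply/derivable1_diffP; have [] := KP y.
  have [c cx] := MVT_segment x0 (fun y _ => KP y) cK.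
  have -> : K 0 = 0.
    by rewrite /K !fctE /= G0 subr0 expr0n /GRing.scale /= mulr0.
  rewrite subr0 /K !fctE /= /GRing.scale /= [_^-1 * _]mulrC => e.
  have cn : 0 <= c by move: cx; rewrite in_itv => /andP[].
  rewrite -subr_ge0 e subr0 mulr_ge0// /dK subr_ge0.
  by apply: le_trans (ler_norm _) _; rewrite -[X in X ^+ n](ger0_norm cn).
have posn (G dG : R -> R) x : 0 <= x -> G 0 = 0 ->
    (forall x, is_derive x (1 : R) G (dG x)) ->
    (forall x, `|dG x| <= `|x| ^+ n / n`!%:R) -> `|G x| <= x ^+ n.+1 / n.+1`!%:R.
  move=> x0 G0 dGP dGb; rewrite ler_norml (pos _ _ _ x0 G0 dGP dGb) andbT.
  rewrite lerNl; apply: (pos (- G) (fun y => - dG y) x x0).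
  - by rewrite opprfctE G0 oppr0.
  - by move=> y; rewrite normrN.
move=> F0 dFP dFb x; have [x0|x0] := leP 0 x.
  by rewrite [X in X ^+ _]ger0_norm//; exact: posn dFP dFb.
have := @posn (F \o -%R) (fun y => - dF (- y)) (- x).
rewrite /= opprK oppr0 F0 oppr_ge0 (ltW x0) (ltr0_norm x0).
apply=> //.
  move=> y; have := @is_derive1_comp R F -%R y _ _ (dFP (- y)) (is_deriveNid y 1).
  by rewrite mulrN1.
by move=> y; rewrite normrN (le_trans (dFb _))// normrN.
Qed.

(** Differentiating the cosine shifts the phase by pi/2, so the induction on the order runs over all
    phases b simultaneously. *)
Lemma cos_taylor (n : nat) (b x : R) :
  `|cos (b + x) - \sum_(j < n) cos (b + j%:R * (pi / 2)) * x ^+ j / j`!%:R|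
    <= `|x| ^+ n / n`!%:R.
Proof.
elim: n b x => [|n IH] b x.
  by rewrite big_ord0 subr0 expr0 fact0 divr1 cos_max.
apply: (@derive_bound_integrate
  (fun x => cos (b + x) - \sum_(j < n.+1) cos (b + j%:R * (pi / 2)) * x ^+ j / j`!%:R)
  (fun x => cos ((b + pi / 2) + x) -
     \sum_(j < n) cos ((b + pi / 2) + j%:R * (pi / 2)) * x ^+ j / j`!%:R) n _ _ (IH (b + pi / 2))).
  rewrite big_ord_recl big1; last by move=> i _; rewrite lift0 expr0n mulr0 mul0r.
  by rewrite expr0 fact0 divr1 mulr1 mul0r addr0 addr0 subrr.
move=> {}x.
pose p (j : 'I_n.+1) := (cos (b + j%:R * (pi / 2)) / j`!%:R) \*: (@id R) ^+ j.
rewrite (_ : (fun x => _) = (cos \o (cst b + id)) - \sum_(j < n.+1) p j); last first.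
  apply/funext => y; rewrite /= !fctE /= fct_sumE; congr (_ - _).
  apply: eq_bigr => j _; rewrite /p /= /GRing.scale /= exprfctE; ring.
have dp j : is_derive x (1 : R) (p j)
    (cos (b + j%:R * (pi / 2)) / j`!%:R * (j%:R * x ^+ j.-1)).
  by apply: is_derive_eq; rewrite /GRing.scale /= mulr1.
have := is_deriveB (is_derive1_comp (is_derive_cos _) (is_deriveD (is_derive_cst b x 1) (is_derive_id x 1))) (is_derive_sum dp).
congr (is_derive _ _ _ _); rewrite !fctE add0r mulr1 /=; congr (_ - _).
  by rewrite addrAC cosDpihalf.
rewrite big_ord_recl [X in X + _ = _](_ : _ = 0) ?add0r; last by rewrite [X in _ * X = _]mul0r mulr0.
 apply: eq_bigr => j _.
rewrite lift0 /= factS natrM -(natr1 j) mulrDl mul1r -addrA [_ + pi / 2]addrC.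
field.
by rewrite natr1 !pnatr_eq0 -!lt0n fact_gt0.
Qed.

(** It makes the Taylor remainder of order 2J, integrated against the normal law, equal to (a^2/2)^J
    / J!, which tends to 0. *)
Lemma gauss_moment_even (J : nat) :
  gauss_moment R J.*2 / J.*2`!%:R = (2 ^+ J * J`!%:R)^-1.
Proof.
elim: J => [|J IH]; first by rewrite double0 expr0 fact0 !mul1r.
have nf n : n`!%:R != 0 :> R by rewrite pnatr_eq0 -lt0n fact_gt0.
rewrite doubleS [LHS]/= !factS exprS !natrM -[gauss_moment R J.*2](divfK (nf J.*2)) IH.
rewrite -muln2 -!natr1 natrM; field.
have p2 : (0 + 1 + 1 : R) != 0 by rewrite add0r -[1 + 1]/(2%:R) pnatr_eq0.
by rewrite !nf (expf_neq0 _ p2) -natrM !natr1 !pnatr_eq0.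
Qed.

Section CosMoments.
Context (dd : measure_display) (T : measurableType dd) (P : probability T R).

Lemma integrable_cos (Y : T -> R) (a b : R) : measurable_fun setT Y ->
  P.-integrable setT (EFin \o (fun w => cos (b + a * Y w))).
Proof.
move=> mY; apply: measurable_bounded_integrable => //.
- by rewrite fin_num_fun_lty//; exact: fin_num_measure.
- apply: (@measurableT_comp _ _ _ _ _ _ (@cos R)).
    exact: (continuous_measurable_fun (@continuous_cos R)).
  by apply: measurable_funD => //; apply: measurable_funM.
- exists 1; split => // y y1 w _ /=; rewrite (le_trans (cos_max _))// ltW//.
Qed.

(** The order is even so that the remainder, an absolute power, is itself a moment. *)
Lemma cos_moment_approx (Y : T -> R) (a b : R) (J : nat) : measurable_fun setT Y ->
  (forall k, P.-integrable setT (EFin \o (fun w => Y w ^+ k))) ->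
  `|\int[P]_w cos (b + a * Y w) -
     \sum_(j < J.*2) cos (b + j%:R * (pi / 2)) * a ^+ j / j`!%:R * \int[P]_w (Y w ^+ j)|
  <= a ^+ J.*2 / J.*2`!%:R * \int[P]_w (Y w ^+ J.*2).
Proof.
move=> mY iY.
pose c j := cos (b + j%:R * (pi / 2)) * a ^+ j / j`!%:R.
have iZ x j : P.-integrable setT (EFin \o (fun w => x * Y w ^+ j)).
  by apply: eq_integrable (integrableZl _ x (iY j)).
have [iS eS] : P.-integrable setT (EFin \o (fun w => \sum_(j < J.*2) c j * Y w ^+ j)) /\
    \int[P]_w (\sum_(j < J.*2) c j * Y w ^+ j) =
    \sum_(j < J.*2) c j * \int[P]_w (Y w ^+ j).
  elim: J.*2 => [|n [IH1 IH2]].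
    split.
      apply: eq_integrable (integrable0 P setT) => // w _ /=.
      by rewrite big_ord0.
    rewrite big_ord0 /Rintegral integral0_eq// => w _.
    by rewrite big_ord0.
  split.
    apply: eq_integrable (integrableD _ IH1 (iZ (c n) n)) => // w _ /=.
    by rewrite big_ord_recr EFinD.
  rewrite big_ord_recr /= -IH2 -RintegralZl// -RintegralD//.
  by apply: eq_Rintegral => w _; rewrite big_ord_recr.
rewrite -eS -RintegralB//; last exact: integrable_cos.
have iB : P.-integrable setT (EFin \o (fun w => cos (b + a * Y w) - \sum_(j < J.*2) c j * Y w ^+ j)).
  by apply: eq_integrable (integrableB _ (integrable_cos a b mY) iS).
apply: le_trans (le_normr_Rintegral _ iB) _ => //.
rewrite -RintegralZl//; apply: le_Rintegral => //.
  by apply: eq_integrable (integrable_abse iB).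
move=> w _.
have := cos_taylor J.*2 b (a * Y w).
have -> : `|a * Y w| ^+ J.*2 / J.*2`!%:R = a ^+ J.*2 / J.*2`!%:R * Y w ^+ J.*2.
  rewrite -mul2n exprM real_normK ?num_real// -exprM exprMn; ring.
congr (`|_ - _| <= _); apply: eq_bigr => j _.
by rewrite /c exprMn; ring.
Qed.

End CosMoments.

Lemma cvg_cos_moments (dd : measure_display) (T : measurableType dd)
    (P : probability T R) (I : Type) (U : set_system I) (UF : Filter U)
    (Z : I -> T -> R) (a b : R) :
  (forall i, measurable_fun setT (Z i)) ->
  (forall i k, P.-integrable setT (EFin \o (fun w => Z i w ^+ k))) ->
  (forall k, \int[P]_w (Z i w ^+ k) @[i --> U] --> gauss_moment R k) ->
  \int[P]_w cos (b + a * Z i w) @[i --> U] -->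
  \int[normal_prob 0 1]_(x in [set: measurableTypeR R]) cos (b + a * (x : R)).
Proof.
move=> mZ iZ cZ.
have Nb J := @cos_moment_approx _ _ (normal_prob 0 1) (idfun : measurableTypeR R -> R) a b J
  (@measurable_id _ _ setT) (@integrable_normal_pow R).
set EN := Rintegral _ _ _.
pose t J := a ^+ J.*2 / J.*2`!%:R * gauss_moment R J.*2.
have tE J : t J = exp_coeff (a ^+ 2 / 2) J.
  rewrite /t -mulrA [_^-1 * _]mulrC gauss_moment_even /exp_coeff /= expr_div_n.
  rewrite -exprM mul2n invfM mulrA; ring.
have t0 J : 0 <= t J.
  by rewrite tE /exp_coeff /= divr_ge0// exprn_ge0// divr_ge0// sqr_ge0.
apply/cvgrPdist_le => e e0.
(* With J fixed, the error splits into e/4 for the Taylor sums, e/2 for the remainder of Z and e/4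
   for that of the normal law. *)
have [J hJ] : exists J, t J <= e / 4.
  have := @cvg_exp_coeff R (a ^+ 2 / 2); move/cvgrPdist_le => /(_ (e / 4)).
  rewrite divr_gt0// => /(_ isT) [J _ /(_ J (leqnn J))] /=.
  by rewrite sub0r normrN -tE ger0_norm// => h; exists J.
pose c j := cos (b + j%:R * (pi / 2)) * a ^+ j / j`!%:R.
pose err i := \sum_(j < J.*2) c j * (\int[P]_w (Z i w ^+ j) - gauss_moment R j).
have err0 : err i @[i --> U] --> (0 : R).
  rewrite -[X in _ --> X](_ : \sum_(j < J.*2) (c j * (gauss_moment R j - gauss_moment R j)) = 0).
    apply: cvg_bigsum => j; apply: cvgMr; apply: cvgB; [exact: cZ|exact: cvg_cst].
  by rewrite big1// => j _; rewrite subrr mulr0.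
have tl : a ^+ J.*2 / J.*2`!%:R * \int[P]_w (Z i w ^+ J.*2) @[i --> U] --> t J.
  by apply: cvgMr; exact: cZ.
near=> i.
have h1 : `|err i| <= e / 4.
  by rewrite -[err i]subr0 distrC; near: i; move/cvgrPdist_le : err0; apply; rewrite divr_gt0.
have h2 : a ^+ J.*2 / J.*2`!%:R * \int[P]_w (Z i w ^+ J.*2) <= e / 2.
  have : `|t J - a ^+ J.*2 / J.*2`!%:R * \int[P]_w (Z i w ^+ J.*2)| <= e / 4.
    by near: i; move/cvgrPdist_le : tl; apply; rewrite divr_gt0.
  by rewrite ler_norml => /andP[]; lra.
have h3 := cos_moment_approx a b J (mZ i) (iZ i).
have h4 := Nb J; rewrite -/EN in h4.
have h5 : a ^+ J.*2 / J.*2`!%:R *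
   \int[normal_prob 0 1]_(x in [set: measurableTypeR R]) (x : R) ^+ J.*2 = t J.
  by rewrite normal_moments.
have h6 : err i = \sum_(j < J.*2) c j * \int[P]_w (Z i w ^+ j) -
   \sum_(j < J.*2) c j *
     \int[normal_prob 0 1]_(x in [set: measurableTypeR R]) (x : R) ^+ j.
  rewrite -sumrB; apply: eq_bigr => j _.
  by rewrite normal_moments mulrBr.
rewrite h5 in h4; move: h1 h3 h4; rewrite h6 -/c.
rewrite !ler_norml => /andP[? ?] /andP[? ?] /andP[? ?].
by apply/andP; split; lra.
Unshelve. all: by end_near. Qed.

End CosTaylor.

(** * Weierstrass approximation by Bernstein polynomials *)

Section Weierstrass.
Variable R : realType.

(** Uniform continuity on [-B, B]: pairs violating it at distance below 1/(n+1) have a common limit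
    along an ultrafilter, contradicting continuity there. *)
Lemma heine_itv (f : R -> R) (B e : R) : continuous f -> 0 < e ->
  exists2 dl : R, 0 < dl & forall s t, `|s| <= B -> `|t| <= B ->
    `|s - t| < dl -> `|f s - f t| <= e.
Proof.
move=> cf e0; apply: contrapT => H.
have nx (n : nat) : exists st : R * R, [/\ `|st.1| <= B, `|st.2| <= B,
    `|st.1 - st.2| < harmonic n & e < `|f st.1 - f st.2|].
  apply: contrapT => Hn; apply: H; exists (harmonic n); first by rewrite /harmonic /=.
  move=> s t sB tB st; rewrite leNgt; apply/negP => h; apply: Hn.
  by exists (s, t).
have [st stP] := choice nx.
have [U [UU sU]] := ultraFilterLemma (F := \oo) _.
have cs : cvg ((fun n => (st n).1) @ U).
  by apply: (ultra_bounded_cvg (B := B)); apply: nearW => n; have [] := stP n.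
pose p := lim ((fun n => (st n).1) @ U).
have cd : (st n).1 - (st n).2 @[n --> U] --> (0 : R).
  apply/norm_cvg0P; apply: (@squeeze_cvgr _ _ _ _ (cst 0) (@harmonic R)).
  - by apply: nearW => n; rewrite normr_ge0 ltW//; have [] := stP n.
  - exact: cvg_cst.
  - by apply: cvg_trans cvg_harmonic => A hA; exact: sU.
have ct : (st n).2 @[n --> U] --> p.
  rewrite -[p]subr0 (_ : (fun n => (st n).2) = fun n => (st n).1 - ((st n).1 - (st n).2)).
    exact: cvgB.
  by apply/funext => n; rewrite subKr.
have cfs : f (st n).1 @[n --> U] --> f p by apply: continuous_cvg => //; exact: cf.
have cft : f (st n).2 @[n --> U] --> f p by apply: continuous_cvg => //; exact: cf.
have cz : `|f (st n).1 - f (st n).2| @[n --> U] --> (0 : R).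
  by rewrite -[X in _ --> X](@normr0 _ R) -(subrr (f p)); apply: cvg_norm; exact: cvgB.
have : e <= 0.
  by apply: (cvgr_to_ge cz); apply: nearW => n; apply: ltW; have [] := stP n.
by rewrite leNgt e0.
Qed.

Definition bernstein_sum (n : nat) (t : R) (g : nat -> R) : R :=
  \sum_(k < n.+1) 'C(n, k)%:R * (t ^+ k * (1 - t) ^+ (n - k) * g k).

Lemma bernstein_sumS n t g : bernstein_sum n.+1 t g =
  t * bernstein_sum n t (fun k => g k.+1) + (1 - t) * bernstein_sum n t g.
Proof.
rewrite /bernstein_sum (sum_pascal n (fun k => t ^+ k * (1 - t) ^+ (n.+1 - k) * g k)).
rewrite !mulr_sumr -big_split /=; apply: eq_bigr => -[k /=].
by rewrite ltnS => kn _; rewrite subSS subSn// !exprS; ring.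
Qed.

Lemma bernstein_sum1 n t : bernstein_sum n t (fun=> 1) = 1.
Proof.
elim: n => [|n IH]; last by rewrite bernstein_sumS IH; ring.
by rewrite /bernstein_sum big_ord_recl big_ord0 bin0 !expr0; ring.
Qed.

(** The centre c is arbitrary because the induction step replaces it by c - 1; the case c = n t is
    the binomial variance. *)
Lemma bernstein_variance n t c : bernstein_sum n t (fun k => (k%:R - c) ^+ 2) =
  n%:R * t * (1 - t) + (n%:R * t - c) ^+ 2.
Proof.
elim: n c => [|n IH] c.
  by rewrite /bernstein_sum big_ord_recl big_ord0 bin0 !expr0 /=; ring.
rewrite bernstein_sumS (_ : (fun k => (k.+1%:R - c) ^+ 2) = fun k => (k%:R - (c - 1)) ^+ 2); last first.
  by apply/funext => k; rewrite -natr1; ring.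
by rewrite !IH -natr1; ring.
Qed.

Lemma bernstein_le n t (g1 g2 : nat -> R) : 0 <= t <= 1 ->
  (forall k, (k <= n)%N -> g1 k <= g2 k) ->
  bernstein_sum n t g1 <= bernstein_sum n t g2.
Proof.
move=> /andP[t0 t1] H; apply: ler_sum => -[k /=]; rewrite ltnS => kn _.
rewrite ler_wpM2l// ler_wpM2l ?H// mulr_ge0// exprn_ge0//.
by rewrite subr_ge0.
Qed.

Lemma bernstein_sumB n t (g1 g2 : nat -> R) :
  bernstein_sum n t (fun k => g1 k - g2 k) = bernstein_sum n t g1 - bernstein_sum n t g2.
Proof. by rewrite /bernstein_sum -sumrB; apply: eq_bigr => k _; ring. Qed.

Lemma bernstein_norm n t (g : nat -> R) : 0 <= t <= 1 ->
  `|bernstein_sum n t g| <= bernstein_sum n t (fun k => `|g k|).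
Proof.
move=> /andP[t0 t1]; apply: le_trans (ler_norm_sum _ _ _) _.
apply: ler_sum => k _; rewrite !normrM (ger0_norm (ler0n _ _)).
rewrite [X in _ * (X * _ * _) <= _]ger0_norm ?exprn_ge0//.
by rewrite [X in _ * (_ * X * _) <= _]ger0_norm// exprn_ge0// subr_ge0.
Qed.

Lemma weierstrass01 (f : R -> R) (B e : R) : continuous f ->
  (forall x, `|f x| <= B) -> 0 < e ->
  exists p : {poly R}, forall t, 0 <= t <= 1 -> `|f t - p.[t]| <= e.
Proof.
move=> cf fB e0; have e2 : 0 < e / 2 by rewrite divr_gt0.
have B0 : 0 <= B := le_trans (normr_ge0 _) (fB 0).
have [dl dl0 hdl] := heine_itv 1 cf e2.
(* Chebyshev's constant: where |t - k/n| >= dl, the difference of values is at most 2B <= C (t -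
   k/n)^2, and the Bernstein mean of the right side is C t (1 - t) / n. *)
pose C := 2 * B / dl ^+ 2.
have C0 : 0 <= C by rewrite !mulr_ge0// invr_ge0 exprn_ge0// ltW.
have [n n0 hn] : exists2 n : nat, (0 < n)%N & C / n%:R <= e / 2.
  exists (Num.bound (2 * C / e)).+1 => //.
  set n := (_.+1); have : 2 * C / e < n%:R.
    apply: lt_trans (archi_boundP _) _; last by rewrite ltr_nat.
    by apply: divr_ge0; [exact: mulr_ge0|exact: ltW].
  by rewrite ltr_pdivrMr// ler_pdivrMr// => h; lra.
pose p : {poly R} := \sum_(k < n.+1) ('C(n, k)%:R * f (k%:R / n%:R)) *: ('X ^+ k * (1 - 'X) ^+ (n - k)).
exists p => t t01; have /andP[t0 t1] := t01.
have -> : p.[t] = bernstein_sum n t (fun k => f (k%:R / n%:R)).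
  rewrite /p horner_sum; apply: eq_bigr => k _.
  by rewrite hornerZ hornerM hornerXn horner_exp !hornerE /=; ring.
have -> : f t = bernstein_sum n t (fun=> f t).
  rewrite -[LHS]mul1r -(bernstein_sum1 n t) /bernstein_sum mulr_suml.
  by apply: eq_bigr => k _; ring.
rewrite -bernstein_sumB; apply: le_trans (bernstein_norm _ _ t01) _.
have nn : n%:R != 0 :> R by rewrite pnatr_eq0 -lt0n.
have := @bernstein_le n t (fun k => `|f t - f (k%:R / n%:R)|)
  (fun k => e / 2 + C / n%:R ^+ 2 * (k%:R - n%:R * t) ^+ 2) t01.
move=> /(_ _) /le_trans; apply.
  move=> k kn.
  have k1 : `|k%:R / n%:R| <= 1 :> R.
    by rewrite ger0_norm// ler_pdivrMr ?ltr0n// mul1r ler_nat.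
  have t1' : `|t| <= 1 by rewrite ger0_norm.
  have [h|h] := ltP `|t - k%:R / n%:R| dl.
    rewrite (le_trans (hdl _ _ t1' k1 h))// lerDl mulr_ge0 ?sqr_ge0//.
    by rewrite divr_ge0// exprn_ge0.
  apply: (@le_trans _ _ (2 * B)).
    apply: le_trans (ler_normB _ _) _.
    by have := fB t; have := fB (k%:R / n%:R); lra.
  have -> : C / n%:R ^+ 2 * (k%:R - n%:R * t) ^+ 2 = 2 * B * (`|t - k%:R / n%:R| / dl) ^+ 2.
    have -> : (`|t - k%:R / n%:R| / dl) ^+ 2 = (t - k%:R / n%:R) ^+ 2 / dl ^+ 2.
      by rewrite expr_div_n real_normK ?num_real.
    by rewrite /C; field; rewrite nn gt_eqF.
  have h1 : 1 <= `|t - k%:R / n%:R| / dl by rewrite ler_pdivlMr// mul1r.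
  have h2 : 1 <= (`|t - k%:R / n%:R| / dl) ^+ 2 by rewrite exprn_ege1.
  have : 2 * B <= 2 * B * (`|t - k%:R / n%:R| / dl) ^+ 2 by rewrite ler_peMr// mulr_ge0.
  by move: (2 * B * _) => z; lra.
have -> : bernstein_sum n t (fun k => e / 2 + C / n%:R ^+ 2 * (k%:R - n%:R * t) ^+ 2) =
  e / 2 * bernstein_sum n t (fun=> 1) +
  C / n%:R ^+ 2 * bernstein_sum n t (fun k => (k%:R - n%:R * t) ^+ 2).
  rewrite /bernstein_sum !mulr_sumr -big_split /=.
  by apply: eq_bigr => k _; ring.
rewrite bernstein_sum1 bernstein_variance subrr expr0n /= addr0 mulr1.
have -> : C / n%:R ^+ 2 * (n%:R * t * (1 - t)) = C / n%:R * (t * (1 - t)) by field.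
have : C / n%:R * (t * (1 - t)) <= C / n%:R.
  rewrite ler_piMr ?divr_ge0//; nra.
move: hn; set z := C / _ * _; set y := C / _; lra.
Qed.

Lemma weierstrass_sym (f : R -> R) (B e : R) : continuous f ->
  (forall x, `|f x| <= B) -> 0 < e ->
  exists p : {poly R}, forall u, -1 <= u <= 1 -> `|f u - p.[u]| <= e.
Proof.
move=> cf fB e0; pose g x := f (2 * x - 1).
have cg : continuous g.
  move=> x; apply: continuous_comp; last exact: cf.
  by apply: cvgB; [apply: cvgMr; exact: cvg_id|exact: cvg_cst].
have [p hp] := weierstrass01 cg (fun x => fB _) e0.
exists (p \Po (2^-1 *: ('X + 1))) => u /andP[u1 u2].
rewrite horner_comp !hornerE.
have -> : f u = g (2^-1 * (u + 1)) by rewrite /g; congr f; field.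
by apply: hp; apply/andP; split; lra.
Qed.

End Weierstrass.

(** * From moments to bounded continuous test functions *)

Section MethodOfMoments.
Variable R : realType.
Local Notation N := (normal_prob 0 1 : probability (measurableTypeR R) R).

(** A triple holds the amplitude, the frequency and the phase of one cosine. *)
Definition trig (l : seq (R * R * R)) (x : R) : R :=
  \sum_(c <- l) c.1.1 * cos (c.2 + c.1.2 * x).

Lemma trig_cons c l x : trig (c :: l) x = c.1.1 * cos (c.2 + c.1.2 * x) + trig l x.
Proof. by rewrite /trig big_cons. Qed.

Lemma trig_nil x : trig [::] x = 0. Proof. by rewrite /trig big_nil. Qed.

Lemma trig_mul_sin l s : exists l', forall x, trig l x * sin (s * x) = trig l' x.
Proof.
elim: l => [|[[c a] b] l [l' IH]].
  by exists [::] => x; rewrite !trig_nil mul0r.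
(* The product formula for two cosines, with sin v = cos(v - pi/2). *)
exists [:: (c / 2, a + s, b - pi / 2), (c / 2, a - s, b + pi / 2) & l'] => x.
rewrite !trig_cons mulrDl IH /= addrA; congr (_ + _).
rewrite -cosBpihalf.
have -> : b - pi / 2 + (a + s) * x = (b + a * x) + (s * x - pi / 2) by ring.
have -> : b + pi / 2 + (a - s) * x = (b + a * x) - (s * x - pi / 2) by ring.
by move: (b + a * x) (s * x - pi / 2) => u v; rewrite cosD cosB; field.
Qed.

Lemma trig_poly_sin (p : {poly R}) s : exists l, forall x, p.[sin (s * x)] = trig l x.
Proof.
elim/poly_ind: p => [|p c [l IH]].
  by exists [::] => x; rewrite horner0 trig_nil.
have [l' hl'] := trig_mul_sin l s.
exists ((c, 0, 0) :: l') => x.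
by rewrite !hornerE /= IH hl' trig_cons /= mul0r addr0 cos0 mulr1 addrC.
Qed.

Section Convergence.
Context (dd : measure_display) (T : measurableType dd) (P : probability T R).

Lemma integrable_trig (Y : T -> R) l : measurable_fun setT Y ->
  P.-integrable setT (EFin \o (fun w => trig l (Y w))).
Proof.
move=> mY; elim: l => [|[[c a] b] l IH].
  apply: eq_integrable (integrable0 P setT) => // w _ /=.
  by rewrite trig_nil.
apply: eq_integrable (integrableD _ (integrableZl _ c (integrable_cos P a b mY)) IH) => //.
by move=> w _ /=; rewrite trig_cons.
Qed.

Lemma Rintegral_trig_cons (Y : T -> R) c l : measurable_fun setT Y ->
  \int[P]_w trig (c :: l) (Y w) =
  c.1.1 * \int[P]_w cos (c.2 + c.1.2 * Y w) + \int[P]_w trig l (Y w).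
Proof.
move=> mY; rewrite -RintegralZl//; last exact: integrable_cos.
have iZ : P.-integrable setT (EFin \o (fun w => c.1.1 * cos (c.2 + c.1.2 * Y w))).
  by apply: eq_integrable (integrableZl _ c.1.1 (integrable_cos P c.1.2 c.2 mY)).
rewrite -RintegralD//; last exact: integrable_trig.
by apply: eq_Rintegral => w _; rewrite trig_cons.
Qed.

Lemma integrable_bounded_comp (Y : T -> R) (f : R -> R) (B : R) :
  measurable_fun setT Y -> measurable_fun setT f -> (forall x, `|f x| <= B) ->
  P.-integrable setT (EFin \o (fun w => f (Y w))).
Proof.
move=> mY mf fB; apply: measurable_bounded_integrable => //.
- by rewrite fin_num_fun_lty//; exact: fin_num_measure.
- exact: measurableT_comp.
- exists B; split; first exact: num_real.
  by move=> y y1 w _ /=; rewrite (le_trans (fB _))// ltW.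
Qed.

Lemma expectation_approx (Y : T -> R) (f g : R -> R) (B M e : R) l :
  measurable_fun setT Y ->
  P.-integrable setT (EFin \o (fun w => Y w ^+ 2)) ->
  measurable_fun setT f -> (forall x, `|f x| <= B) ->
  (forall x, `|f x - trig l x| <= M * x ^+ 2 + e) ->
  `|\int[P]_w f (Y w) - \int[P]_w trig l (Y w)| <= M * \int[P]_w (Y w ^+ 2) + e.
Proof.
move=> mY iY mf fB H.
have i1 := integrable_bounded_comp mY mf fB.
have i2 := integrable_trig l mY.
have iB : P.-integrable setT (EFin \o (fun w => f (Y w) - trig l (Y w))).
  by apply: eq_integrable (integrableB _ i1 i2).
have iM : P.-integrable setT (EFin \o (fun w => M * Y w ^+ 2)).
  by apply: eq_integrable (integrableZl _ M iY).
have ic : P.-integrable setT (EFin \o (fun _ : T => e)).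
  by apply: finite_measure_integrable_cst.
rewrite -RintegralB//; apply: le_trans (le_normr_Rintegral _ iB) _ => //.
have -> : M * \int[P]_w (Y w ^+ 2) + e = \int[P]_w (M * Y w ^+ 2 + e).
  rewrite RintegralD// RintegralZl//; congr (_ + _).
  rewrite Rintegral_cst//; transitivity (e * fine 1%E); first by rewrite mulr1.
  by congr (_ * fine _); apply/esym; exact: probability_setT.
apply: le_Rintegral => //; first exact: eq_integrable (integrable_abse iB).
exact: eq_integrable (integrableD _ iM ic).
Qed.

End Convergence.

Lemma cvg_trig (dd : measure_display) (T : measurableType dd)
    (P : probability T R) (I : Type) (U : set_system I) (UF : Filter U)
    (Z : I -> T -> R) l :
  (forall i, measurable_fun setT (Z i)) ->
  (forall i k, P.-integrable setT (EFin \o (fun w => Z i w ^+ k))) ->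
  (forall k, \int[P]_w (Z i w ^+ k) @[i --> U] --> gauss_moment R k) ->
  \int[P]_w trig l (Z i w) @[i --> U] -->
  \int[N]_(x in [set: measurableTypeR R]) trig l (x : R).
Proof.
move=> mZ iZ cZ; elim: l => [|c l IH].
  rewrite (_ : (fun i => _) = cst 0); last first.
    by apply/funext => i; rewrite /Rintegral integral0_eq// => w _; rewrite trig_nil.
  rewrite /Rintegral integral0_eq//; last by move=> w _; rewrite trig_nil.
  exact: cvg_cst.
rewrite (@Rintegral_trig_cons _ (measurableTypeR R) N idfun); last exact: measurable_id.
rewrite (_ : (fun i => _) = fun i => c.1.1 * \int[P]_w cos (c.2 + c.1.2 * Z i w) +
    \int[P]_w trig l (Z i w)); last first.
  by apply/funext => i; rewrite Rintegral_trig_cons.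
by apply: cvgD => //; apply: cvgMr; exact: cvg_cos_moments.
Qed.

(** For |x| <= M the angle s x lies within pi/4 of 0, so f(x) = G(sin(s x)) with G built from
    [asin]; a polynomial approximation of G turns into a trigonometric sum by [trig_poly_sin]. For
    |x| > M the distance between f(x) and G(sin(s x)) is at most 2B <= e M^2 <= e x^2. *)
Lemma bounded_trig_approx (f : R -> R) (B e : R) : continuous f ->
  (forall x, `|f x| <= B) -> 0 < e ->
  exists l, forall x, `|f x - trig l x| <= e * x ^+ 2 + e.
Proof.
move=> cf fB e0.
have B0 : 0 <= B := le_trans (normr_ge0 _) (fB 0).
pose M := 1 + 2 * B / e.
have M1 : 1 <= M by rewrite lerDl divr_ge0 ?mulr_ge0// ltW.
have M0 : 0 < M by rewrite (lt_le_trans _ M1).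
have BM : 2 * B <= e * M ^+ 2.
  have : 2 * B <= e * M by rewrite mulrDr mulrCA mulfV ?gt_eqF// mulr1 mulr1 lerDr ltW.
  by move/le_trans; apply; rewrite ler_wpM2l ?(ltW e0)// expr2 ler_peMr// ltW.
pose q : R := pi / 4; pose s := q / M.
have pi0 := @pi_gt0 R.
have q0 : 0 < q by rewrite divr_gt0.
have s0 : 0 < s by rewrite divr_gt0.
have qin : q \in `[- (pi / 2), @pi R / 2]%R by rewrite in_itv /= /q; apply/andP; split; lra.
have pin : pi / 2 \in `[- (pi / 2), @pi R / 2]%R by rewrite in_itv /=; apply/andP; split; lra.
(* Clamping to [-sin q, sin q] keeps the argument inside ]-1, 1[, where [asin] is continuous, and
   makes G continuous on the whole line. *)
pose cl u : R := Num.max (- sin q) (Num.min (sin q) u).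
have sq1 : sin q < 1 by rewrite -sin_pihalf ltr_sin//; rewrite /q; lra.
have sq0 : 0 < sin q by rewrite sin_gt0_pi//; apply/andP; split; rewrite // /q; lra.
have clin u : -1 < cl u < 1.
  rewrite /cl lt_max gt_max gt_min sq1 /=; apply/andP; split; last by lra.
  by apply/orP; left; lra.
pose G u := f (asin (cl u) / s).
have ccl : continuous cl.
  move=> u; apply: (@continuous_max _ _ (fun=> - sin q) ((fun=> sin q) \min id)).
    exact: cvg_cst.
  by apply: (@continuous_min _ _ (fun=> sin q) id); [exact: cvg_cst|exact: cvg_id].
have cG : continuous G.
  move=> u; apply: (@continuous_comp _ _ _ (fun u => asin (cl u) / s) f); last exact: cf.
  apply: cvgMl; apply: (@continuous_comp _ _ _ cl asin); first exact: ccl.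
  exact: continuous_asin.
have [p hp] := weierstrass_sym cG (fun u => fB _) e0.
have [l hl] := trig_poly_sin p s.
exists l => x.
rewrite -hl.
have sin1 : -1 <= sin (s * x) <= 1 by rewrite sin_geN1 sin_le1.
have := hp _ sin1.
have Gf : `|f x - G (sin (s * x))| <= e * x ^+ 2.
  have [xM|xM] := leP `|x| M.
    suff -> : G (sin (s * x)) = f x by rewrite subrr normr0 mulr_ge0 ?sqr_ge0// ltW.
    have sx : `|s * x| <= q.
      by rewrite normrM (gtr0_norm s0) /s mulrAC ler_pdivrMr// ler_wpM2l// ltW//.
    have /andP[sx1 sx2] : - q <= s * x <= q by rewrite -ler_norml.
    have sxin : s * x \in `[- (pi / 2), @pi R / 2]%R.
      by rewrite in_itv /=; move: sx1 sx2; rewrite /q => ? ?; apply/andP; split; lra.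
    have Nqin : - q \in `[- (pi / 2), @pi R / 2]%R by rewrite in_itv /= /q; apply/andP; split; lra.
    rewrite /G (_ : cl (sin (s * x)) = sin (s * x)).
      by rewrite sinK// mulrC mulKf// gt_eqF.
    have h1 : sin (s * x) <= sin q by rewrite leNgt ltr_sin// -leNgt.
    have h2 : - sin q <= sin (s * x) by rewrite -sinN leNgt ltr_sin// -leNgt.
    by rewrite /cl min_r// max_r.
  apply: (@le_trans _ _ (2 * B)).
    by apply: le_trans (ler_normB _ _) _; have := fB x; have := fB (asin (cl (sin (s * x))) / s); rewrite /G; lra.
  apply: (le_trans BM); rewrite ler_wpM2l ?(ltW e0)//.
  by rewrite -[x ^+ 2]real_normK ?num_real// lerXn2r ?nnegrE ?(ltW M0) ?(ltW xM).
move=> h; apply: le_trans (lerD Gf h).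
by rewrite -[X in `|X| <= _](subrKA (G (sin (s * x)))) ler_normD.
Qed.

Lemma method_of_moments (dd : measure_display) (T : measurableType dd)
    (P : probability T R) (I : Type) (U : set_system I) (UF : Filter U)
    (Z : I -> T -> R) (f : R -> R) (B : R) :
  (forall i, measurable_fun setT (Z i)) ->
  (forall i k, P.-integrable setT (EFin \o (fun w => Z i w ^+ k))) ->
  (forall k, \int[P]_w (Z i w ^+ k) @[i --> U] --> gauss_moment R k) ->
  continuous f -> (forall x, `|f x| <= B) ->
  \int[P]_w f (Z i w) @[i --> U] -->
  \int[N]_(x in [set: measurableTypeR R]) f (x : R).
Proof.
move=> mZ iZ cZ cf fB.
have mf := continuous_measurable_fun cf.
apply/cvgrPdist_le => e e0.
(* The second moment of Z is eventually at most 2 and that of the normal law is 1, so the three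
   errors are at most 3, 1 and 2 tenths of e. *)
have e10 : 0 < e / 10 by rewrite divr_gt0.
have [l hl] := bounded_trig_approx cf fB e10.
set EN := Rintegral _ _ _.
have := @expectation_approx _ _ N (idfun : measurableTypeR R -> R) f f B _ _ l
  (@measurable_id _ _ setT) (@integrable_normal_pow R 2) mf fB hl.
rewrite -/EN normal_moments /= => hN.
have ct := cvg_trig (l := l) UF mZ iZ cZ.
near=> i.
have h1 := expectation_approx f (mZ i) (iZ i 2) mf fB hl.
have h2 : `|gauss_moment R 2 - \int[P]_w (Z i w ^+ 2)| <= 1.
  by near: i; move/cvgrPdist_le : (cZ 2%N); apply.
have h3 : `|\int[N]_(x in [set: measurableTypeR R]) trig l (x : R) -
   \int[P]_w trig l (Z i w)| <= e / 10.
  by near: i; move/cvgrPdist_le : ct; apply.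
move: h1 h2 h3 hN; rewrite /= !mul1r.
move: (Rintegral P _ (fun w => Z i w ^+ 2)) => m2.
rewrite !ler_norml => /andP[a1 a2] /andP[b1 b2] /andP[c1 c2] /andP[d1 d2].
have : e / 10 * m2 <= e / 10 * 2 by rewrite ler_wpM2l ?(ltW e10)//; lra.
by move: a1 a2; move: (e / 10 * m2) => z a1 a2 hz; apply/andP; split; lra.
Unshelve. all: by end_near. Qed.

End MethodOfMoments.

(** * Joint cumulants and their decay *)

Section Splits.
Variables (R : realType) (S : Type).
Implicit Types (s a b : seq S).

(** One pair for each subset of positions: the chosen sublist and the remaining one. Repeated
    entries are distributed independently. *)
Fixpoint splits s : seq (seq S * seq S) :=
  if s is x :: s' then
    [seq (x :: p.1, p.2) | p <- splits s'] ++ [seq (p.1, x :: p.2) | p <- splits s']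
  else [:: ([::], [::])].

Lemma big_splits_cons (F : seq S * seq S -> R) x s :
  \sum_(p <- splits (x :: s)) F p =
  \sum_(p <- splits s) (F (x :: p.1, p.2) + F (p.1, x :: p.2)).
Proof. by rewrite big_split /= big_cat !big_map. Qed.

Lemma size_splits s : size (splits s) = (2 ^ size s)%N.
Proof.
by elim: s => //= x s IH; rewrite size_cat !size_map IH addnn -mul2n expnS.
Qed.

(** [S] has no decidable equality here; the inductive invariant [Q] takes the place of membership in
    [splits s]. *)
Lemma ler_sum_splits (Q : seq S -> seq S * seq S -> Prop) :
  Q [::] ([::], [::]) ->
  (forall x s a b, Q s (a, b) -> Q (x :: s) (x :: a, b)) ->
  (forall x s a b, Q s (a, b) -> Q (x :: s) (a, x :: b)) ->
  forall s (F G : seq S * seq S -> R),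
    (forall p, Q s p -> F p <= G p) ->
    \sum_(p <- splits s) F p <= \sum_(p <- splits s) G p.
Proof.
move=> Q0 Q1 Q2; elim=> [|x s IH] F G H.
  by rewrite !big_seq1 H.
rewrite !big_splits_cons; apply: IH => -[a b] /= Qab.
by apply: lerD; apply: H; [exact: Q1|exact: Q2].
Qed.

(** When the first part stays in A, the entries outside A are forced into the second part, and only
    a split of the sublist in A remains to be chosen. *)
Lemma big_splits_filter (A : pred S) (F : seq S -> seq S -> R) s :
  \sum_(p <- splits s) (if all A p.1 then F p.1 [seq x <- p.2 | A x] else 0) =
  \sum_(p <- splits [seq x <- s | A x]) F p.1 p.2.
Proof.
elim: s F => [|x s IH] F; first by rewrite !big_seq1.
rewrite big_splits_cons /=; case: (boolP (A x)) => Ax.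
  rewrite big_splits_cons big_split [RHS]big_split /=; congr (_ + _).
    exact: (IH (fun a b => F (x :: a) b)).
  rewrite -(IH (fun a b => F a (x :: b))).
  by apply: eq_bigr.
rewrite -IH; apply: eq_bigr => p _; first by rewrite add0r.
Qed.

Lemma big_splits_last (F : seq S * seq S -> R) s :
  \sum_(p <- splits s) F p =
  F (s, [::]) + \sum_(p <- splits s) (if nilp p.2 then 0 else F p).
Proof.
elim: s F => [|x s IH] F; first by rewrite !big_seq1 addr0.
rewrite big_splits_cons big_splits_cons !big_split /= (IH (fun p => F (x :: p.1, p.2))) /=.
by rewrite addrA.
Qed.

End Splits.

Section JointCumulants.
Variables (R : realType) (S : Type) (e : seq S -> R).
Hypothesis e_nil : e [::] = 1.
Implicit Types (s a b : seq S).

(** Joint cumulants of the mixed moments [e]. Sorting set partitions by the block of the head x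
    gives e(x :: s) = sum kap(x :: a) e(b) over the splits (a, b) of s, which is solved here for the
    term with b empty. The fuel n is there because the recursive calls are not structural in the
    list. *)
Fixpoint kap_rec (n : nat) s : R :=
  match n, s with
  | n'.+1, x :: s' => e (x :: s') -
      \sum_(p <- splits s') (if nilp p.2 then 0 else kap_rec n' (x :: p.1) * e p.2)
  | _, _ => 0
  end.

Definition kap s := kap_rec (size s) s.

Lemma sum_splits_size s (F G : seq S * seq S -> R) :
  (forall p, (size p.1 + size p.2 = size s)%N -> F p <= G p) ->
  \sum_(p <- splits s) F p <= \sum_(p <- splits s) G p.
Proof.
apply: (@ler_sum_splits _ _ (fun s p => size p.1 + size p.2 = size s)%N) => //=.
- by move=> x {}s a b /= <-.
- by move=> x {}s a b /= <-; rewrite addnS.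
Qed.

Lemma eq_splits_size s (F G : seq S * seq S -> R) :
  (forall p, (size p.1 + size p.2 = size s)%N -> F p = G p) ->
  \sum_(p <- splits s) F p = \sum_(p <- splits s) G p.
Proof.
move=> H; apply/eqP; rewrite eq_le; apply/andP; split;
  by apply: sum_splits_size => p /H ->.
Qed.

Lemma kap_rec_fuel n n' s : (size s <= n)%N -> (size s <= n')%N ->
  kap_rec n s = kap_rec n' s.
Proof.
elim: n n' s => [|n IH] [|n'] [|x s]//=; rewrite !ltnS => sn sn'.
congr (_ - _); apply: eq_splits_size => -[a b] /= ab.
case: ifP => // /nilP bn; congr (_ * _); apply: IH => /=.
  by case: b bn ab => //= y b _; lia.
by case: b bn ab => //= y b _; lia.
Qed.

Lemma kapE x s : e (x :: s) = \sum_(p <- splits s) kap (x :: p.1) * e p.2.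
Proof.
rewrite big_splits_last /= e_nil mulr1 {1}/kap /= -addrA [X in _ + X](_ : _ = 0) ?addr0//.
rewrite addrC; apply/eqP; rewrite subr_eq0; apply/eqP/eq_splits_size => -[a b] /= ab.
case: ifP => // /nilP bn; congr (_ * _); apply: kap_rec_fuel => //=.
by case: b bn ab => //= y b _; lia.
Qed.

Lemma kap_cons x s : kap (x :: s) = e (x :: s) -
  \sum_(p <- splits s) (if nilp p.2 then 0 else kap (x :: p.1) * e p.2).
Proof. by rewrite kapE big_splits_last /= e_nil mulr1 addrK. Qed.

Fixpoint kap_bound (B : R) (n : nat) : R :=
  if n is n'.+1 then B + 2 ^+ n' * (kap_bound B n' * B) else 0.

Lemma kap_bound_ge0 B n : 0 <= B -> 0 <= kap_bound B n.
Proof. by move=> B0; elim: n => //= n IH; rewrite addr_ge0// !mulr_ge0// exprn_ge0. Qed.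

Lemma sum_splits_const s (c : R) : \sum_(p <- splits s) c = 2 ^+ size s * c.
Proof.
by rewrite big_const_seq count_predT size_splits iter_addr_0 -[LHS]mulr_natl natrX.
Qed.

Lemma kap_le (B : R) m : 0 <= B -> (forall s, (size s <= m)%N -> `|e s| <= B) ->
  forall n s, (n <= m)%N -> (size s <= n)%N -> `|kap s| <= kap_bound B n.
Proof.
move=> B0 eB; elim=> [|n IH] [|x s] nm sn //.
- by rewrite /kap /= normr0.
- by rewrite /kap /= normr0 (kap_bound_ge0 n.+1).
rewrite kap_cons.
apply: le_trans (ler_normB _ _) _; apply: lerD; first by apply: eB; exact: leq_trans sn nm.
apply: le_trans (ler_norm_sum _ _ _) _.
apply: (@le_trans _ _ (\sum_(p <- splits s) kap_bound B n * B)).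
  apply: sum_splits_size => -[a b] /= ab; case: ifP => [_|/nilP bn].
    by rewrite normr0 mulr_ge0// kap_bound_ge0.
  have bs : (0 < size b)%N by case: b bn {ab}.
  rewrite normrM.
  apply: ler_pM => //.
  - by apply: IH; [lia|rewrite /=; move: sn; rewrite /= -ab; lia].
  - by apply: eB; move: sn; rewrite /= -ab; lia.
rewrite sum_splits_const; apply: ler_wpM2r; first by rewrite mulr_ge0// kap_bound_ge0.
by apply: ler_weXn2l => //; rewrite ler1n.
Qed.

(** The 1 accounts for the near factorization of the whole list; a split contributes an error
    weighted by a cumulant, or a shorter mixed cumulant times a moment. *)
Fixpoint mix_bound (B : R) (n : nat) : R :=
  if n is n'.+1 then 1 + 2 ^+ n' * (mix_bound B n' * B + kap_bound B n') else 0.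

Lemma mix_bound_ge0 B n : 0 <= B -> 0 <= mix_bound B n.
Proof.
move=> B0; elim: n => // n IH; rewrite /= addr_ge0// mulr_ge0 ?exprn_ge0// addr_ge0 ?mulr_ge0//.
exact: kap_bound_ge0.
Qed.

(* If [e] nearly factorizes over [A] and its complement, then the cumulants of
   lists meeting both are small: the terms of the recursion with [a] inside [A]
   nearly add up to [e sA * e sB], and the other ones involve cumulants of
   shorter lists still meeting both. *)
Lemma kap_mixing (P : pred S) (B psi : R) m : 0 <= B -> 0 <= psi ->
  (forall s, (size s <= m)%N -> `|e s| <= B) ->
  forall n (A : pred S) s, (n <= m)%N -> (size s <= n)%N -> all P s ->
    (forall s, all P s -> (size s <= m)%N ->
      `|e s - e [seq x <- s | A x] * e [seq x <- s | ~~ A x]| <= psi) ->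
    has A s -> has (predC A) s -> `|kap s| <= mix_bound B n * psi.
Proof.
move=> B0 psi0 eB; elim=> [|n IH] A [|x s] nm // sn0.
have sn : (size s <= n)%N by exact: sn0.
(* The hypotheses are symmetric under exchanging A with its complement. *)
wlog Ax : A / A x.
  move=> H Ps hA hA1 hA2; have [Ax|nAx] := boolP (A x); first exact: H hA hA1 hA2.
  apply: (H (predC A)) => //.
    move=> s1 Ps1 s1m; rewrite mulrC (_ : [seq x <- s1 | ~~ predC A x] = [seq x <- s1 | A x]).
      exact: hA.
    by apply: eq_filter => y /=; rewrite negbK.
  by rewrite (eq_has (a2 := A))// => y /=; rewrite negbK.
move=> Pxs hA _ hnA.
have hnAs : has (predC A) s by move: hnA; rewrite /= Ax.
pose sA := [seq x <- s | A x]; pose sB := [seq x <- s | ~~ A x].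
have eA : e (x :: sA) * e sB =
    \sum_(p <- splits s) if all A p.1 then kap (x :: p.1) * e [seq x <- p.2 | A x] * e sB else 0.
  rewrite kapE mulr_suml -(big_splits_filter A (fun a b => kap (x :: a) * e b * e sB)).
  exact: eq_bigr.
pose D p := (if all A p.1 then kap (x :: p.1) * e [seq x <- p.2 | A x] * e sB else 0) -
  (if nilp p.2 then 0 else kap (x :: p.1) * e p.2).
have kD : kap (x :: s) = (e (x :: s) - e (x :: sA) * e sB) + \sum_(p <- splits s) D p.
  by rewrite /D sumrB -eA addrA subrK kap_cons.
have Dle : \sum_(p <- splits s) `|D p| <=
    \sum_(p <- splits s) (mix_bound B n * B + kap_bound B n) * psi.
  have Ps : all P s by case/andP: Pxs.
  have Px : P x by case/andP: Pxs.
  apply: (@ler_sum_splits _ _ (fun s p => [/\ (size p.1 + size p.2 = size s)%N,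
      all A p.1 -> [seq x <- p.2 | ~~ A x] = [seq x <- s | ~~ A x] &
      all P s -> all P p.1 /\ all P p.2])).
  - by [].
  - move=> y s1 a b /= [h1 h2 h3]; split.
    + by rewrite addSn h1.
    + by move=> /andP[-> /h2].
    + by move=> /andP[-> /h3].
  - move=> y s1 a b /= [h1 h2 h3]; split.
    + by rewrite addnS h1.
    + by move=> /h2 ->.
    + by move=> /andP[-> /h3].
  move=> [a b] /= [ab hB hP]; have [Pa Pb] := hP Ps.
  have sb : (size b <= m)%N.
    by apply: leq_trans (ltnW nm); rewrite (leq_trans _ sn)// -ab leq_addl.
  have kb0 := kap_bound_ge0 n B0; have mb0 := mix_bound_ge0 n B0.
  rewrite /D /=; have [Aa|nAa] := boolP (all A a).
    (* All of [sB] has gone into b. So b is nonempty, and [e b] differs from the product of the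
       moment of its A-part with [e sB] by at most [psi]. *)
    have bB := hB Aa; have bn : ~~ nilp b.
      apply/negP => /nilP b0; have : size sB = 0%N by rewrite /sB -bB b0.
      by move: hnAs; rewrite has_count -size_filter lt0n => /eqP.
    rewrite (negbTE bn) -mulrA -mulrBr normrM /sB -bB.
    have sa : (size (x :: a) <= n)%N.
      by clear -ab bn sn; move: bn; rewrite /nilp /=; lia.
    rewrite (@le_trans _ _ (kap_bound B n * psi))//.
      apply: ler_pM => //; first by apply: (kap_le B0 eB) => //; exact: ltnW.
      by rewrite distrC; apply: hA.
    by rewrite ler_wpM2r// lerDr mulr_ge0.
  case: ifP => bn; first by rewrite subrr normr0 mulr_ge0// addr_ge0// mulr_ge0.
  rewrite sub0r normrN normrM.
  have sa : (size (x :: a) <= n)%N by clear -ab bn sn; move: bn; rewrite /nilp /=; lia.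
  rewrite (@le_trans _ _ (mix_bound B n * psi * B))//.
    apply: ler_pM => //.
      apply: (IH A) => //=; first exact: ltnW.
      - by rewrite Px.
      - by rewrite Ax.
      - by rewrite has_predC nAa orbT.
    exact: eB.
  by rewrite mulrAC ler_wpM2r// lerDl.
rewrite kD; apply: le_trans (ler_normD _ _) _; rewrite /= mulrDl mul1r; apply: lerD.
  by have := hA (x :: s) Pxs (leq_trans sn0 nm); rewrite /= Ax.
apply: le_trans (ler_norm_sum _ _ _) _; apply: le_trans Dle _.
rewrite sum_splits_const -mulrA; apply: ler_wpM2r.
  by rewrite mulr_ge0// addr_ge0 ?mulr_ge0 ?mix_bound_ge0 ?kap_bound_ge0.
by apply: ler_weXn2l => //; rewrite ler1n.
Qed.

End JointCumulants.

(** * Sums over tuples and the cumulants of a sum *)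

Section TupleSums.
Variables (R : realType) (S : Type) (W : seq S).
Implicit Types (f g : seq S -> R).

Fixpoint tsum (n : nat) f : R :=
  if n is n'.+1 then \sum_(x <- W) tsum n' (fun s => f (x :: s)) else f [::].

Lemma eq_tsum n f g : (forall s, f s = g s) -> tsum n f = tsum n g.
Proof.
by elim: n f g => //= n IH f g fg; apply: eq_bigr => x _; apply: IH => s.
Qed.

Lemma tsumD n f g : tsum n (fun s => f s + g s) = tsum n f + tsum n g.
Proof.
elim: n f g => //= n IH f g; rewrite -big_split /=.
by apply: eq_bigr => x _; rewrite IH.
Qed.

Lemma tsumZ n (k : R) f : tsum n (fun s => k * f s) = k * tsum n f.
Proof.
elim: n f => //= n IH f; rewrite mulr_sumr.
by apply: eq_bigr => x _; rewrite IH.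
Qed.

(** Summed over all tuples, a split contributes according to the number k of chosen positions only,
    and there are C(n, k) choices. *)
Lemma tsum_splits n f g : tsum n (fun s => \sum_(p <- splits s) f p.1 * g p.2) =
  \sum_(k < n.+1) 'C(n, k)%:R * (tsum k f * tsum (n - k) g).
Proof.
elim: n f g => [|n IH] f g.
  by rewrite /= big_ord_recl big_ord0 bin0 big_seq1 mul1r addr0.
rewrite (sum_pascal n (fun k => tsum k f * tsum (n.+1 - k) g)) /=.
transitivity (\sum_(x <- W) (
    \sum_(k < n.+1) 'C(n, k)%:R * (tsum k (fun s => f (x :: s)) * tsum (n - k) g) +
    \sum_(k < n.+1) 'C(n, k)%:R * (tsum k f * tsum (n - k) (fun s => g (x :: s))))).
  apply: eq_bigr => x _; rewrite -!IH -tsumD; apply: eq_tsum => s.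
  by rewrite (big_splits_cons (fun p => f p.1 * g p.2)) big_split.
rewrite big_split /= exchange_big [X in _ + X]exchange_big -big_split /=.
apply: eq_bigr => -[k /=]; rewrite ltnS => kn _.
rewrite mulrDr subSS subSn//= -!mulr_sumr -mulr_suml.
by [].
Qed.

(** Multilinearity: the cumulants of a sum of variables are the joint cumulants summed over
    tuples. *)
Lemma tsum_cumulants (e : seq S -> R) : e [::] = 1 ->
  cumulants_of (fun n => tsum n e) (fun n => tsum n (kap e)).
Proof.
move=> e1 j /=.
transitivity (\sum_(x <- W) \sum_(k < j.+1) 'C(j, k)%:R *
    (tsum k (fun s => kap e (x :: s)) * tsum (j - k) e)).
  apply: eq_bigr => x _; rewrite -tsum_splits; apply: eq_tsum => s.
  exact: kapE.
rewrite exchange_big; apply: eq_bigr => k _ /=.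
by rewrite -mulr_sumr -mulr_suml mulrA.
Qed.

Lemma tsum_prod n (F : S -> R) : tsum n (fun s => \prod_(x <- s) F x) = (\sum_(x <- W) F x) ^+ n.
Proof.
elim: n => [|n IH] /=; first by rewrite big_nil.
rewrite exprS mulr_suml; apply: eq_bigr => x _.
rewrite -IH -tsumZ; apply: eq_tsum => s; by rewrite big_cons.
Qed.

Lemma ler_norm_tsum n f g : (forall s, size s = n -> `|f s| <= g s) ->
  `|tsum n f| <= tsum n g.
Proof.
elim: n f g => [|n IH] f g fg /=; first exact: fg.
apply: le_trans (ler_norm_sum _ _ _) _; apply: ler_sum => x _.
by apply: IH => s sn; apply: fg; rewrite /= sn.
Qed.

End TupleSums.

(** * Decay of joint cumulants with the distance between points *)

Section CumulantDecay.
Variables (R : realType) (S : eqType) (dist : S -> S -> nat).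
Hypothesis dist_refl : forall x, dist x x = 0%N.
Hypothesis dist_triangle : forall x y z, (dist x z <= dist x y + dist y z)%N.

(* Pigeonhole: there are [size s + 1] annuli [jg <= dist x y < (j+1)g] and only
   [size s] points, since [x] itself lies in none of them. *)
Lemma radial_gap (x : S) (s : seq S) (g : nat) : (0 < g)%N ->
  exists2 j, (0 < j <= (size s).+1)%N & forall y, y \in x :: s ->
    (dist x y < j * g)%N || (j.+1 * g <= dist x y)%N.
Proof.
move=> g0; pose img := [seq (dist x y %/ g)%N | y <- x :: s].
have [j jm jn] : exists2 j, (j <= (size s).+1)%N & j \notin img.
  apply: contrapT => H.
  have sub : {subset iota 0 (size s).+2 <= img}.
    move=> j; rewrite mem_iota add0n /= => jm; apply: contrapT => /negP jn.
    by apply: H; exists j.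
  by have := uniq_leq_size (iota_uniq 0 (size s).+2) sub; rewrite size_iota size_map ltnn.
exists j.
  rewrite jm andbT lt0n; apply/eqP => j0; move/negP: jn; apply.
  by apply/mapP; exists x; rewrite ?mem_head// dist_refl div0n.
move=> y ys; rewrite orbC -implyNb -ltnNge; apply/implyP => h.
rewrite ltnNge; apply/negP => h2; move/negP: jn; apply.
apply/mapP; exists y => //; apply/eqP; rewrite eqn_leq.
by rewrite leq_divRL// h2 -ltnS ltn_divLR.
Qed.

(** With D the distance from x to y, annuli of width g = D / (size s + 1) have inner radius j g <= D
    for every admissible j. So the empty annulus separates x from y, and by the triangle inequality
    points on its two sides are at least g apart. *)
Lemma kap_decay (e : seq S -> R) (m a : nat) (B C : R) : e [::] = 1 ->
  0 <= B -> 0 <= C ->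
  (forall s, (size s <= m)%N -> `|e s| <= B) ->
  (forall s (A : pred S) g, (size s <= m)%N ->
    (forall y z, y \in s -> z \in s -> A y -> ~~ A z -> (g <= dist y z)%N) ->
    `|e s - e [seq x <- s | A x] * e [seq x <- s | ~~ A x]| <= C / g.+1%:R ^+ a) ->
  forall x s y, (size s < m)%N -> y \in s ->
    `|kap e (x :: s)| <= (mix_bound B m * C + kap_bound B m) * m%:R ^+ a / (dist x y).+1%:R ^+ a.
Proof.
move=> e1 B0 C0 eB emix x s y sm ys.
have mb0 := mix_bound_ge0 m B0; have kb0 := kap_bound_ge0 m B0.
pose D := dist x y; pose g := (D %/ (size s).+1)%N.
have Dpos : 0 < D.+1%:R ^+ a :> R by rewrite exprn_gt0.
have m0 : 0 <= m%:R ^+ a :> R by rewrite exprn_ge0.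
have Dg : (D.+1 <= m * g.+1)%N.
  by rewrite (leq_trans (ltn_ceil D (ltn0Sn (size s))))// mulnC leq_mul2r sm orbT.
rewrite ler_pdivlMr// mulrDl.
(* If g = 0 then D + 1 <= m, and the plain bound [kap_bound] is enough. *)
have [g0|g0] := posnP g.
  rewrite -[leLHS]add0r; apply: lerD; first by rewrite !mulr_ge0.
  apply: ler_pM => //; rewrite ?exprn_ge0//.
    exact: (kap_le e1 B0 eB (leqnn m)).
  by rewrite lerXn2r ?nnegrE// ler_nat; move: Dg; rewrite g0 muln1.
rewrite -[leLHS]addr0; apply: lerD; last by rewrite mulr_ge0.
have [j /andP[j0 js] gapj] := radial_gap x s g0.
pose A z := (dist x z < j * g)%N.
have psi0 : 0 <= C / g.+1%:R ^+ a by rewrite divr_ge0// exprn_ge0.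
have h : `|kap e (x :: s)| <= mix_bound B m * (C / g.+1%:R ^+ a).
  apply: (kap_mixing e1 (P := [in x :: s]) (A := A) B0 psi0 eB (leqnn m)) => //.
  - move=> s1 /allP s1P s1m; apply: emix => // z1 z2 /s1P z1s /s1P z2s Az1 nAz2.
    have := gapj _ z2s; rewrite -/(A z2) (negbTE nAz2) /= => h2.
    have h3 := dist_triangle x z1 z2; rewrite /A in Az1.
    rewrite -(leq_add2l (dist x z1)); apply: leq_trans h3.
    apply: leq_trans h2; rewrite mulSn addnC leq_add2l; exact: ltnW.
  - by rewrite /= /A dist_refl muln_gt0 j0 g0.
  - apply/hasP; exists y; first by rewrite in_cons ys orbT.
    rewrite /= /A -leqNgt -/D; apply: leq_trans (leq_trunc_div D (size s).+1).
    by rewrite mulnC leq_mul2l js orbT.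
apply: le_trans (ler_wpM2r (ltW Dpos) h) _.
rewrite -!mulrA; apply: ler_wpM2l => //; apply: ler_wpM2l => //.
rewrite mulrC ler_pdivrMr ?exprn_gt0// -exprMn -natrM.
by rewrite lerXn2r ?nnegrE// ler_nat.
Qed.

Lemma exists_farthest (x : S) (s : seq S) : s != [::] ->
  exists2 y, y \in s & forall z, z \in s -> (dist x z <= dist x y)%N.
Proof.
elim: s => // y s IH _; have [->|sn] := eqVneq s [::].
  by exists y; rewrite ?mem_head// => z; rewrite inE => /eqP ->.
have [w ws hw] := IH sn; have [h|h] := leqP (dist x w) (dist x y).
  exists y; rewrite ?mem_head// => z; rewrite inE => /orP[/eqP ->//|/hw zw].
  exact: leq_trans h.
exists w; first by rewrite in_cons ws orbT.
by move=> z; rewrite inE => /orP[/eqP ->|/hw//]; exact: ltnW.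
Qed.

(** Decay of order b m in the farthest distance is shared out among the m points other than x: each
    receives the power b, at most that of its own distance. The sum over tuples then factorizes into
    Q^m, and the choice of x contributes [size W]. *)
Lemma tsum_kap_le (W : seq S) (e : seq S -> R) (m b : nat) (B C Q : R) : e [::] = 1 ->
  1 <= B -> 0 <= C -> 0 <= Q ->
  (forall s, (size s <= m.+1)%N -> `|e s| <= B) ->
  (forall s (A : pred S) g, (size s <= m.+1)%N ->
    (forall y z, y \in s -> z \in s -> A y -> ~~ A z -> (g <= dist y z)%N) ->
    `|e s - e [seq x <- s | A x] * e [seq x <- s | ~~ A x]| <= C / g.+1%:R ^+ (b * m)) ->
  (forall x, \sum_(y <- W) ((dist x y).+1%:R ^+ b)^-1 <= Q) ->
  `|tsum W m.+1 (kap e)| <=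
    (mix_bound B m.+1 * C + kap_bound B m.+1) * m.+1%:R ^+ (b * m) * Q ^+ m * (size W)%:R.
Proof.
move=> e1 B1 C0 Q0 eB emix wQ.
have B0 : 0 <= B by exact: le_trans B1.
have mb0 := mix_bound_ge0 m.+1 B0; have kb0 := kap_bound_ge0 m.+1 B0.
set K := (mix_bound _ _ * _ + _) * _.
have K0 : 0 <= K by rewrite /K mulr_ge0// ?exprn_ge0// addr_ge0// mulr_ge0.
rewrite [tsum _ _ _]/=; apply: le_trans (ler_norm_sum _ _ _) _.
apply: (@le_trans _ _ (\sum_(x <- W) K * Q ^+ m)); last first.
  by rewrite big_const_seq count_predT iter_addr_0 mulr_natr.
apply: ler_sum => x _.
apply: (@le_trans _ _ (tsum W m (fun s => K * \prod_(y <- s) ((dist x y).+1%:R ^+ b)^-1))).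
  (* For m = 0 there is no farthest point and the weight is an empty product. *)
  apply: ler_norm_tsum => s sm; have [s0|sn] := eqVneq s [::].
    have m0 : m = 0%N by rewrite -sm s0.
    rewrite s0 big_nil mulr1 (le_trans (kap_le e1 B0 eB (leqnn _) _))//.
    rewrite /K m0 muln0 expr0 mulr1 lerDr mulr_ge0//.
    by move: mb0; rewrite m0.
  have [y ys far] := exists_farthest x sn.
  have sm1 : (size s < m.+1)%N by rewrite sm.
  apply: le_trans (kap_decay e1 B0 C0 eB emix x sm1 ys) _.
  apply: ler_wpM2l => //.
  have -> : ((dist x y).+1%:R ^+ (b * m))^-1 = \prod_(z <- s) ((dist x y).+1%:R ^+ b)^-1 :> R.
    by rewrite big_const_seq count_predT sm iter_mulr_1 exprVn exprM.
  rewrite big_seq [leRHS]big_seq; apply: ler_prod => z zs.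
  rewrite invr_ge0 exprn_ge0//= lef_pV2 ?posrE ?exprn_gt0//.
  by rewrite lerXn2r ?nnegrE// ler_nat ltnS far.
rewrite tsumZ tsum_prod; apply: ler_wpM2l => //.
rewrite lerXn2r ?nnegrE//; apply: sumr_ge0 => y _.
by rewrite invr_ge0 exprn_ge0.
Qed.

End CumulantDecay.

(** * Distances, windows and summable weights on the lattice *)

Section LatticeGeometry.
Variables (R : realType) (d : nat).
Implicit Types x y z : lattice d.

Definition l1dist x y : nat := l1norm (x - y).

Lemma l1dist_refl x : l1dist x x = 0%N.
Proof. by rewrite /l1dist subrr /l1norm big1// => i _; rewrite mxE. Qed.

Lemma l1dist_sym x y : l1dist x y = l1dist y x.
Proof.
apply: eq_bigr => i _; rewrite !mxE.
by move: (x _ _) (y _ _) => a b; clear; lia.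
Qed.

Lemma l1dist_triangle x y z : (l1dist x z <= l1dist x y + l1dist y z)%N.
Proof.
rewrite /l1dist /l1norm -big_split /=; apply: leq_sum => i _; rewrite !mxE.
by move: (x _ _) (y _ _) (z _ _) => a b c; clear; lia.
Qed.

Lemma coord_le_l1dist x y i : (absz (x ord0 i - y ord0 i) <= l1dist x y)%N.
Proof. by rewrite /l1dist /l1norm (bigD1 i)//= !mxE leq_addr. Qed.

Lemma windowE r x y : window r x y = (l1dist x y <= r)%N.
Proof. by []. Qed.

Lemma finite_window r x : finite_set (window r x).
Proof.
pose f (u : {ffun 'I_d -> 'I_(r + r).+1}) : lattice d :=
  \row_i (x ord0 i + (u i : nat)%:Z - r%:Z).
apply: (@sub_finite_set _ _ (f @` setT)); last first.
  apply: finite_image; exact: finite_finset.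
move=> y xy; exists [ffun i => inord (absz (y ord0 i - x ord0 i + r%:Z))] => //.
apply/rowP => i; rewrite mxE ffunE.
have := leq_trans (coord_le_l1dist x y i) xy.
have -> : ord0 = 0 :> 'I_1 by apply/val_inj.
move: (x _ _) (y _ _) => a b h.
rewrite inordK; last by clear -h; lia.
by clear -h; lia.
Qed.

Lemma sum_inv_square (n : nat) : \sum_(j < n) (j.+1%:R ^+ 2)^-1 <= 2 :> R.
Proof.
(* The term -1/(n+1) makes the induction telescope: 1/(n+2)^2 <= 1/(n+1) - 1/(n+2). *)
suff h : \sum_(j < n.+1) (j.+1%:R ^+ 2)^-1 <= 2 - n.+1%:R^-1 :> R.
  apply: (@le_trans _ _ (\sum_(j < n.+1) (j.+1%:R ^+ 2)^-1)).
    by rewrite big_ord_recr /= lerDl invr_ge0 exprn_ge0.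
  by apply: (le_trans h); rewrite gerBl invr_ge0.
elim: n => [|n IH].
  by rewrite big_ord_recl big_ord0 addr0 expr1n invr1; lra.
rewrite big_ord_recr /=; apply: le_trans (lerD IH (lexx _)) _.
have n1 : 0 < n.+1%:R :> R by [].
have n2 : 0 < n.+2%:R :> R by [].
have -> : 2 - n.+2%:R^-1 = 2 - n.+1%:R^-1 + (n.+1%:R * n.+2%:R)^-1 :> R.
  rewrite -[n.+2%:R]natr1 -natr1; field.
  by rewrite nat1r natr1 !pnatr_eq0.
rewrite lerD2l lef_pV2 ?posrE ?mulr_gt0 ?exprn_gt0//.
by rewrite expr2 ler_wpM2r// ler_nat.
Qed.

Lemma sum_inv_square_centered (M : nat) :
  \sum_(t < (M + M).+1) ((absz (t%:Z - M%:Z)).+1%:R ^+ 2)^-1 <= 4 :> R.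
Proof.
rewrite -addnS big_split_ord /= (_ : 4 = 2 + 2 :> R); last by ring.
apply: lerD.
  rewrite (reindex_inj rev_ord_inj) /=.
  apply: le_trans (sum_inv_square M); apply: ler_sum => j _.
  rewrite lef_pV2 ?posrE ?exprn_gt0// lerXn2r ?nnegrE// ler_nat ltnS.
  by move: (ltn_ord j); clear; move: (j : nat) => i; lia.
apply: le_trans (sum_inv_square M.+1); apply: ler_sum => j _.
rewrite lef_pV2 ?posrE ?exprn_gt0// lerXn2r ?nnegrE// ler_nat ltnS.
by clear; move: (j : nat) => i; lia.
Qed.

Lemma ler_sum_uniq_map (F : finType) (W : seq (lattice d))
    (phi : lattice d -> F) (g : F -> R) :
  uniq W -> {in W &, injective phi} -> (forall u, 0 <= g u) ->
  \sum_(y <- W) g (phi y) <= \sum_u g u.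
Proof.
move=> uW iphi g0; rewrite -(big_map phi xpredT g).
rewrite big_uniq ?map_inj_in_uniq//=.
rewrite [leRHS](bigID (fun u => u \in [seq phi y | y <- W])) /= lerDl.
exact: sumr_ge0.
Qed.

(** The l1-distance dominates each coordinate, so the power 2d is at least a product of d squares,
    one per coordinate; the sum is bounded by a product of one-dimensional sums. *)
Lemma sum_l1_weights (W : seq (lattice d)) x : uniq W ->
  \sum_(y <- W) ((l1dist x y).+1%:R ^+ (2 * d))^-1 <= 4 ^+ d :> R.
Proof.
move=> uW; pose M := (\sum_(y <- W) l1dist x y)%N.
(* M serves only to fit all coordinate differences into one finite type; the final bound is free of
   it. *)
have WM y i : y \in W -> (absz (x ord0 i - y ord0 i) <= M)%N.
  move=> yW; rewrite (leq_trans (coord_le_l1dist x y i))// /M.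
  by rewrite (big_rem y)//= leq_addr.
pose phi y : {ffun 'I_d -> 'I_(M + M).+1} :=
  [ffun i => inord (absz (y ord0 i - x ord0 i + M%:Z))].
have phiE y i : y \in W -> (phi y i : nat)%:Z = y ord0 i - x ord0 i + M%:Z.
  move=> /(WM _ i); rewrite ffunE; move: (x _ _) (y _ _) => a b h.
  rewrite inordK; last by clear -h; lia.
  by clear -h; lia.
pose g (u : {ffun 'I_d -> 'I_(M + M).+1}) : R :=
  \prod_i ((absz ((u i : nat)%:Z - M%:Z)).+1%:R ^+ 2)^-1.
apply: (@le_trans _ _ (\sum_(y <- W) g (phi y))).
  rewrite big_seq [leRHS]big_seq; apply: ler_sum => y yW.
  have -> : ((l1dist x y).+1%:R ^+ (2 * d))^-1 = \prod_(i < d) ((l1dist x y).+1%:R ^+ 2)^-1 :> R.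
    by rewrite prodr_const card_ord exprVn exprM.
  apply: ler_prod => i _; rewrite invr_ge0 exprn_ge0//=.
  rewrite lef_pV2 ?posrE ?exprn_gt0// lerXn2r ?nnegrE// ler_nat ltnS phiE//.
  apply: leq_trans (coord_le_l1dist x y i).
  by move: (x _ _) (y _ _) => a b; clear; lia.
apply: le_trans (@ler_sum_uniq_map _ W phi g uW _ _) _.
- move=> y z yW zW /ffunP yz; apply/rowP => i.
  have := phiE y i yW; rewrite yz phiE//.
  have -> : ord0 = 0 :> 'I_1 by apply/val_inj.
  by move: (x _ _) (y _ _) (z _ _) => a b c; clear; lia.
- by move=> u; apply: prodr_ge0 => i _; rewrite invr_ge0 exprn_ge0.
rewrite /g -(bigA_distr_bigA (fun (i : 'I_d) (t : 'I_(M + M).+1) =>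
   ((absz ((t : nat)%:Z - M%:Z)).+1%:R ^+ 2)^-1 : R)).
rewrite prodr_const card_ord lerXn2r ?nnegrE//.
  by apply: sumr_ge0 => t _; rewrite invr_ge0 exprn_ge0.
exact: sum_inv_square_centered.
Qed.

(** The points 0, ..., n on one axis; this crude growth makes 1/w_n tend to 0. *)
Lemma window_size_gt (n : nat) : (0 < d)%N -> (n < window_size d n)%N.
Proof.
move=> d0; pose f (j : nat) : lattice d :=
  \row_i (if (i : nat) == 0%N then j%:Z else 0).
have finj : injective f.
  by move=> j1 j2 /rowP /(_ (Ordinal d0)); rewrite !mxE /= => -[].
rewrite /window_size.
have : {subset [seq f j | j <- iota 0 n.+1] <= enum_fset (fset_set (window n (0 : lattice d)))}.
  move=> y /mapP[j]; rewrite mem_iota add0n => /andP[_ jn] ->.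
  rewrite in_fset_set; last exact: finite_window.
  rewrite inE windowE /l1dist /l1norm (bigD1 (Ordinal d0))//= !mxE /= big1.
    by rewrite addn0 sub0r abszN.
  move=> i; rewrite -val_eqE /= => /negbTE i0; by rewrite !mxE i0 subrr.
have u : uniq [seq f j | j <- iota 0 n.+1] by rewrite map_inj_uniq// iota_uniq.
by move=> /(uniq_leq_size u); rewrite size_map size_iota.
Qed.

End LatticeGeometry.

(** * Cumulants of local scores *)

Section BoundedMeasurable.
Context (R : realType) (dd : measure_display) (T : measurableType dd).
Variable P : probability T R.
Implicit Types f g : T -> R.

(** A class closed under sums, products and powers that contains every variable of the proof, so
    that integrability never has to be discussed separately. *)
Definition bmeas f : Prop :=
  measurable_fun setT f /\ exists B : R, forall w, `|f w| <= B.

Lemma bmeas_cst (c : R) : bmeas (fun=> c).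
Proof. by split; [exact: measurable_cst|exists `|c|]. Qed.

Lemma bmeasD f g : bmeas f -> bmeas g -> bmeas (fun w => f w + g w).
Proof.
move=> [mf [B fB]] [mg [C gC]]; split; first exact: measurable_funD.
exists (B + C) => w; apply: le_trans (ler_normD _ _) _; exact: lerD.
Qed.

Lemma bmeasM f g : bmeas f -> bmeas g -> bmeas (fun w => f w * g w).
Proof.
move=> [mf [B fB]] [mg [C gC]]; split; first exact: measurable_funM.
by exists (B * C) => w; rewrite normrM; apply: ler_pM.
Qed.

Lemma bmeasZ (c : R) f : bmeas f -> bmeas (fun w => c * f w).
Proof. by move=> bf; apply: bmeasM => //; exact: bmeas_cst. Qed.

Lemma bmeasX f k : bmeas f -> bmeas (fun w => f w ^+ k).
Proof.
move=> bf; elim: k => [|k IH]; first exact: bmeas_cst.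
rewrite (_ : (fun w => _) = fun w => f w * f w ^+ k); first exact: bmeasM.
by apply/funext => w; rewrite exprS.
Qed.

Lemma bmeas_sum (I : Type) (r : seq I) (F : I -> T -> R) :
  (forall i, bmeas (F i)) -> bmeas (fun w => \sum_(i <- r) F i w).
Proof.
move=> bF; elim: r => [|i r IH].
  rewrite (_ : (fun w => _) = fun=> 0); first exact: bmeas_cst.
  by apply/funext => w; rewrite big_nil.
rewrite (_ : (fun w => _) = fun w => F i w + \sum_(i <- r) F i w); first exact: bmeasD.
by apply/funext => w; rewrite big_cons.
Qed.

Lemma bmeas_prod (I : Type) (r : seq I) (F : I -> T -> R) :
  (forall i, bmeas (F i)) -> bmeas (fun w => \prod_(i <- r) F i w).
Proof.
move=> bF; elim: r => [|i r IH].
  rewrite (_ : (fun w => _) = fun=> 1); first exact: bmeas_cst.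
  by apply/funext => w; rewrite big_nil.
rewrite (_ : (fun w => _) = fun w => F i w * \prod_(i <- r) F i w); first exact: bmeasM.
by apply/funext => w; rewrite big_cons.
Qed.

Lemma bmeas_integrable f : bmeas f -> P.-integrable setT (EFin \o f).
Proof.
move=> [mf [B fB]]; apply: measurable_bounded_integrable => //.
- by rewrite fin_num_fun_lty//; exact: fin_num_measure.
- exists B; split; first exact: num_real.
  by move=> y y1 w _ /=; rewrite (le_trans (fB _))// ltW.
Qed.

Definition mean f : R := \int[P]_w f w.

Lemma expectation_mean f : bmeas f -> ('E_P[f] = (mean f)%:E)%E.
Proof.
move=> bf; rewrite unlock /mean /Rintegral fineK//.
exact: integrable_fin_num (bmeas_integrable bf).
Qed.

Lemma eq_mean f g : (forall w, f w = g w) -> mean f = mean g.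
Proof. by move=> fg; apply: eq_Rintegral => w _. Qed.

Lemma mean_cst (c : R) : mean (fun=> c) = c.
Proof.
rewrite /mean Rintegral_cst//; transitivity (c * fine 1%E); last by rewrite mulr1.
by congr (_ * fine _); exact: probability_setT.
Qed.

Lemma meanD f g : bmeas f -> bmeas g -> mean (fun w => f w + g w) = mean f + mean g.
Proof. by move=> bf bg; rewrite /mean RintegralD//; exact: bmeas_integrable. Qed.

Lemma meanZ (c : R) f : bmeas f -> mean (fun w => c * f w) = c * mean f.
Proof. by move=> bf; rewrite /mean RintegralZl//; exact: bmeas_integrable. Qed.

Lemma mean_sum (I : Type) (r : seq I) (F : I -> T -> R) :
  (forall i, bmeas (F i)) ->
  mean (fun w => \sum_(i <- r) F i w) = \sum_(i <- r) mean (F i).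
Proof.
move=> bF; elim: r => [|i r IH].
  rewrite big_nil -[RHS](mean_cst 0); apply: eq_mean => w; exact: big_nil.
rewrite big_cons -IH -meanD//; last exact: bmeas_sum.
by apply: eq_mean => w; rewrite big_cons.
Qed.

Lemma mean_ge0 f : (forall w, 0 <= f w) -> 0 <= mean f.
Proof. by move=> f0; apply: Rintegral_ge0 => w _. Qed.

Lemma mean_norm_le f (B : R) : bmeas f -> (forall w, `|f w| <= B) -> `|mean f| <= B.
Proof.
move=> bf fB; rewrite -[B]mean_cst.
apply: le_trans (le_normr_Rintegral _ (bmeas_integrable bf)) _ => //.
apply: le_Rintegral => //; first exact: eq_integrable (integrable_abse (bmeas_integrable bf)).
by apply: bmeas_integrable; exact: bmeas_cst.
Qed.

Lemma mean_moments_psd f : bmeas f -> psd_moments (fun k => mean (fun w => f w ^+ k)).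
Proof.
move=> bf n q.
have -> : \sum_(i < n) \sum_(l < n) q i * q l * mean (fun w => f w ^+ (i + l)) =
    mean (fun w => (\sum_(i < n) q i * f w ^+ i) ^+ 2).
  rewrite (@eq_mean _ (fun w => \sum_(i < n) \sum_(l < n) q i * q l * f w ^+ (i + l))).
    rewrite mean_sum => [|i].
      apply: eq_bigr => i _; rewrite mean_sum => [|l].
        by apply: eq_bigr => l _; rewrite meanZ//; exact: bmeasX.
      by apply: bmeasZ; exact: bmeasX.
    by apply: bmeas_sum => l; apply: bmeasZ; exact: bmeasX.
  move=> w; rewrite expr2 mulr_suml; apply: eq_bigr => i _.
  by rewrite mulr_sumr; apply: eq_bigr => l _; rewrite exprD; ring.
by apply: mean_ge0 => w; exact: sqr_ge0.
Qed.

End BoundedMeasurable.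

(** * Inclusion probabilities of lists of points *)

Section Inclusion.
Context (R : realType) (dd : measure_display) (T : measurableType dd).
Variables (P : probability T R) (d : nat) (X : {RV P >-> spin_config d}).
Implicit Types s t : seq (lattice d).

Definition incl s (mu : set (lattice d)) : R := (all (fun y => `[< mu y >]) s)%:R.

Lemma incl_cat s t mu : incl (s ++ t) mu = incl s mu * incl t mu.
Proof. by rewrite /incl all_cat -mulnb natrM. Qed.

Lemma incl_le1 s mu : `|incl s mu| <= 1.
Proof. by rewrite /incl; case: all; rewrite ?normr1 ?normr0. Qed.

Lemma incl_ge0 s mu : 0 <= incl s mu.
Proof. by rewrite /incl. Qed.

Lemma measurable_site (y : lattice d) : measurable [set w | (X w : set (lattice d)) y].
Proof.
have m : measurable ([set mu : set (lattice d) | mu y] : set (spin_config d)).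
  by apply: sub_sigma_algebra; exists y.
exact: (measurable_funPTI X m).
Qed.

Lemma measurable_sites s :
  measurable [set w | all (fun y => `[< (X w : set (lattice d)) y >]) s].
Proof.
elim: s => [|y s IH].
  by rewrite (_ : [set w | _] = setT)//; apply/seteqP; split.
rewrite (_ : [set w | _] = [set w | (X w : set (lattice d)) y] `&`
   [set w | all (fun y => `[< (X w : set (lattice d)) y >]) s]).
  by apply: measurableI => //; exact: measurable_site.
apply/seteqP; split => w /=; first by move=> /andP[/asboolP].
by move=> [/asboolP-> ->].
Qed.

Lemma inclE s w : incl s (X w) =
  \1_[set w | all (fun y => `[< (X w : set (lattice d)) y >]) s] w.
Proof. by rewrite indicE /incl mem_setE. Qed.

Lemma bmeas_incl s : bmeas (fun w => incl s (X w)).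
Proof.
split; last by exists 1 => w; exact: incl_le1.
rewrite (_ : (fun w => _) = \1_[set w | all (fun y => `[< (X w : set (lattice d)) y >]) s]).
  by apply: measurable_indic; exact: measurable_sites.
by apply/funext => w; exact: inclE.
Qed.

Definition pr s : R := mean P (fun w => incl s (X w)).

Lemma pr_inclusion s n : n = size s ->
  inclusion_prob X (fun i : 'I_n => nth 0 s i) = pr s.
Proof.
move=> ->; rewrite /pr /mean /Rintegral /inclusion_prob.
have -> : [set w | range (fun i : 'I_(size s) => nth 0 s i) `<=` X w] =
    [set w | all (fun y => `[< (X w : set (lattice d)) y >]) s].
  apply/seteqP; split => w /= H.
    apply/allP => y ys; apply/asboolP; apply: H.
    have ys' := ys; rewrite -index_mem in ys'.
    by exists (Ordinal ys') => //=; rewrite nth_index.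
  move=> _ [i _ <-]; move/allP: H => /(_ (nth 0 s i) (mem_nth _ (ltn_ord i))).
  by move/asboolP.
under [in RHS]eq_integral do rewrite inclE.
by rewrite integral_indic ?setIT//; exact: measurable_sites.
Qed.

Lemma pr_undup s : pr (undup s) = pr s.
Proof.
apply: eq_mean => w; rewrite /incl; congr (nat_of_bool _)%:R.
by apply: eq_all_r => y; rewrite mem_undup.
Qed.

Lemma pr_le1 s : 0 <= pr s <= 1.
Proof.
apply/andP; split; first by apply: mean_ge0 => w; exact: incl_ge0.
apply: le_trans (ler_norm _) _; apply: mean_norm_le; first exact: bmeas_incl.
by move=> w; exact: incl_le1.
Qed.

Lemma pr_cov_le1 s t : `|pr (s ++ t) - pr s * pr t| <= 1.
Proof.
have /andP[a0 a1] := pr_le1 (s ++ t); have /andP[b0 b1] := pr_le1 s.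
have /andP[c0 c1] := pr_le1 t.
by rewrite ler_norml; apply/andP; split; nra.
Qed.

(** [clustering] concerns nonempty families of distinct points. Repetitions do not affect inclusion,
    an empty list has probability 1, and a positive separation makes the two lists disjoint. The
    monotonicity of C, c and [phi] yields a single bound for all sizes up to N. *)
Lemma pr_cov (C c : nat -> R) (phi : R -> R) (N g : nat) s t :
  (forall k, 0 < C k /\ 0 < c k) ->
  {homo C : m n / (m <= n)%N >-> m <= n} ->
  {homo c : m n / (m <= n)%N >-> n <= m} ->
  fast_decreasing phi -> clustering X C c phi ->
  (size s + size t <= N)%N -> (0 < g)%N ->
  (forall y z, y \in s -> z \in t -> (g <= l1dist y z)%N) ->
  `|pr (s ++ t) - pr s * pr t| <= C N * phi (c N * g%:R).
Proof.
move=> Cc0 Cm cm [phi01 phim _] cl stN g0 sep.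
have CN0 : 0 < C N by have [] := Cc0 N.
have cN0 : 0 < c N by have [] := Cc0 N.
have cg0 : 0 <= c N * g%:R by rewrite mulr_ge0// ltW.
have r0 : 0 <= C N * phi (c N * g%:R).
  by rewrite mulr_ge0 ?(ltW CN0)//; have /andP[] := phi01 _ cg0.
have prnil : pr [::] = 1 by rewrite -[RHS](mean_cst P 1); apply: eq_mean.
have [s0|sn0] := eqVneq s [::]; first by rewrite s0 /= prnil mul1r subrr normr0.
have [t0|tn0] := eqVneq t [::]; first by rewrite t0 cats0 prnil mulr1 subrr normr0.
have us0 : (0 < size (undup s))%N.
  by rewrite lt0n size_eq0; apply: contraNneq sn0 => /undup_nil ->.
have ut0 : (0 < size (undup t))%N.
  by rewrite lt0n size_eq0; apply: contraNneq tn0 => /undup_nil ->.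
pose p := (size (undup s)).-1; pose q := (size (undup t)).-1.
have pE : p.+1 = size (undup s) by rewrite prednK.
have qE : q.+1 = size (undup t) by rewrite prednK.
pose u := undup s ++ undup t.
have uE : (p.+1 + q.+1)%N = size u by rewrite size_cat pE qE.
have uu : uniq u.
  rewrite cat_uniq !undup_uniq andbT /=; apply/hasPn => z; rewrite !mem_undup => zt.
  by apply/negP => zs; have := sep _ _ zs zt; rewrite l1dist_refl leqNgt g0.
pose x (i : 'I_(p.+1 + q.+1)) := nth 0 u i.
have xinj : injective x.
  move=> i j /eqP; rewrite /x nth_uniq -?uE// => /eqP ij; exact: val_inj.
have := cl p q x xinj.
have xl i : x (lshift q.+1 i) = nth 0 (undup s) i by rewrite /x /u nth_cat /= -pE ltn_ord.
have xr j : x (rshift p.+1 j) = nth 0 (undup t) j.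
  by rewrite /x /u nth_cat /= -pE ltnNge leq_addr /= addKn.
rewrite (pr_inclusion uE).
rewrite (_ : (fun i => x (lshift q.+1 i)) = fun i : 'I_p.+1 => nth 0 (undup s) i); last exact/funext.
rewrite (_ : (fun j => x (rshift p.+1 j)) = fun j : 'I_q.+1 => nth 0 (undup t) j); last exact/funext.
rewrite (pr_inclusion pE) (pr_inclusion qE) !pr_undup.
have -> : pr u = pr (s ++ t).
  apply: eq_mean => w; rewrite /incl /u; congr (nat_of_bool _)%:R.
  by apply: eq_all_r => y; rewrite !mem_cat !mem_undup.
move=> /le_trans; apply.
have pqN : (p.+1 + q.+1 <= N)%N.
  by rewrite pE qE (leq_trans _ stN)// leq_add// size_undup.
have gsep : (g <= separation x)%N.
  have ij i j : (g <= l1norm (x (lshift q.+1 i) - x (rshift p.+1 j)))%N.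
    have h1 : nth 0 (undup s) i \in s by rewrite -(mem_undup s) mem_nth// -pE.
    have h2 : nth 0 (undup t) j \in t by rewrite -(mem_undup t) mem_nth// -qE.
    by rewrite xl xr; exact: sep.
  rewrite /separation; elim/big_ind: _ => // [a b ga gb|i _]; first by rewrite leq_min ga.
  by elim/big_ind: _ => // a b ga gb; rewrite leq_min ga.
apply: ler_pM.
- by have [/ltW] := Cc0 (p.+1 + q.+1)%N.
- have h0 : 0 <= c (p.+1 + q.+1)%N * (separation x)%:R.
    by rewrite mulr_ge0//; have [_ /ltW] := Cc0 (p.+1 + q.+1)%N.
  by have /andP[] := phi01 _ h0.
- exact: Cm.
- apply: phim => //; apply: ler_pM => //; first exact: ltW.
    exact: cm.
  by rewrite ler_nat.
Qed.

End Inclusion.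

Section FastDecreasing.
Variable R : realType.

Lemma fast_decreasing_poly (phi : R -> R) (a : nat) : fast_decreasing phi ->
  exists2 K : R, 0 <= K & forall s, 0 <= s -> (1 + s) ^+ a * phi s <= K.
Proof.
move=> [phi01 phim phil].
(* The exponent [a.+1] is positive, as the hypothesis on [phi] demands; S >= 1 gives 1 + s <= 2 s
   beyond S. *)
have [S [S0 hS]] : exists S : R, 1 <= S /\ forall s, S < s -> s ^+ a.+1 * phi s <= 1.
  have := phil a.+1 isT; move=> /cvgrPdist_le /(_ 1 ltr01) [S [_ hS]].
  exists (Num.max 1 S); split; first by rewrite le_max lexx.
  move=> s; rewrite gt_max => /andP[s1 sS]; have := hS s sS.
  by rewrite /= sub0r normrN => h; rewrite (le_trans (ler_norm _)).
exists ((1 + S) ^+ a + 2 ^+ a.+1).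
  by rewrite addr_ge0 ?exprn_ge0// addr_ge0// (le_trans ler01).
move=> s s0; have /andP[p0 p1] := phi01 s s0.
have [sS|Ss] := leP s S.
  rewrite -[leLHS]addr0 lerD ?exprn_ge0//.
  rewrite -[leRHS]mulr1 ler_pM ?exprn_ge0 ?addr_ge0//.
  by rewrite lerXn2r ?nnegrE ?addr_ge0// ?lerD2l// (le_trans s0).
have s1 : 1 < s by apply: le_lt_trans Ss.
rewrite -[leLHS]add0r lerD ?exprn_ge0 ?addr_ge0 ?(le_trans ler01)//.
apply: (@le_trans _ _ ((2 * s) ^+ a.+1 * phi s)).
  apply: ler_wpM2r => //; apply: (@le_trans _ _ ((1 + s) ^+ a.+1)).
    by rewrite ler_weXn2l// lerDl.
  by rewrite lerXn2r ?nnegrE ?addr_ge0 ?mulr_ge0//; lra.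
rewrite exprMn -mulrA -[leRHS]mulr1 ler_wpM2l ?exprn_ge0//.
exact: hS.
Qed.

(** Scores at sites g apart see windows of radius k, which are at least g - 2k apart; for g <= 2k
    the trivial bound 1 on a covariance of indicators is used. *)
Lemma fast_decreasing_decay (phi : R -> R) (C c : R) (k a : nat) :
  fast_decreasing phi -> 0 < C -> 0 < c ->
  exists2 C0 : R, 0 <= C0 & forall g : nat,
    (if (g <= k.*2)%N then 1 else C * phi (c * (g - k.*2)%:R)) <= C0 / g.+1%:R ^+ a.
Proof.
move=> fd C0 c0; have [K K0 hK] := fast_decreasing_poly a fd.
(* With h = g - 2k, L satisfies g + 1 <= (2k + 1)(1 + h) <= L (1 + c h). *)
pose L : R := k.*2.+1%:R * (1 + c^-1).
have ci : 0 < c^-1 by rewrite invr_gt0.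
have L0 : 0 <= L by rewrite mulr_ge0// addr_ge0// ltW.
exists (k.*2.+1%:R ^+ a + C * (L ^+ a * K)).
  by rewrite addr_ge0 ?exprn_ge0// !mulr_ge0 ?exprn_ge0// ltW.
move=> g; rewrite ler_pdivlMr ?exprn_gt0//.
case: leqP => gk.
  rewrite mul1r -[leLHS]addr0 lerD// ?mulr_ge0 ?exprn_ge0 ?(ltW C0)//.
  by rewrite lerXn2r ?nnegrE// ler_nat ltnS.
rewrite -[leLHS]add0r lerD ?exprn_ge0// -mulrA ler_wpM2l ?(ltW C0)//.
pose h := (g - k.*2)%N; rewrite -/h.
have gh : g = (k.*2 + h)%N by rewrite subnKC// ltnW.
have ch0 : 0 <= c * h%:R by rewrite mulr_ge0// ltW.
apply: (@le_trans _ _ (L ^+ a * ((1 + c * h%:R) ^+ a * phi (c * h%:R)))); last first.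
  by rewrite ler_wpM2l ?exprn_ge0// hK.
have [phi01 _ _] := fd; have /andP[p0 _] := phi01 _ ch0.
have Lc0 : 0 <= L * (1 + c * h%:R) by rewrite mulr_ge0// addr_ge0.
rewrite mulrA mulrC ler_wpM2r// -exprMn lerXn2r ?nnegrE//.
apply: (@le_trans _ _ (k.*2.+1%:R * (1 + h%:R))).
  rewrite gh -addSn natrD mulrDr mulr1 lerD2l.
  by rewrite ler_peMl// ler1n.
rewrite /L -mulrA ler_wpM2l//.
have -> : (1 + c^-1) * (1 + c * h%:R) = (1 + h%:R) + (c * h%:R + c^-1).
  by field; rewrite gt_eqF.
by rewrite lerDl addr_ge0// ltW.
Qed.

End FastDecreasing.

Section Observables.
Context (R : realType) (dd : measure_display) (T : measurableType dd).
Variables (P : probability T R) (d : nat) (X : {RV P >-> spin_config d}).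
Local Notation obs := (seq (R * seq (lattice d))).
Implicit Types (o : obs) (mu : set (lattice d)).

(* An observable is a linear combination of the indicators [S `<=` mu]. *)
Definition ev o mu : R := \sum_(p <- o) p.1 * incl R p.2 mu.
Definition nrm o : R := \sum_(p <- o) `|p.1|.
Definition omul o1 o2 : obs := [seq (p.1 * q.1, p.2 ++ q.2) | p <- o1, q <- o2].

Lemma nrm_ge0 o : 0 <= nrm o. Proof. exact: sumr_ge0. Qed.

Lemma ev_norm_le o mu : `|ev o mu| <= nrm o.
Proof.
apply: le_trans (ler_norm_sum _ _ _) _; apply: ler_sum => p _.
by rewrite normrM ler_piMr// incl_le1.
Qed.

Lemma ev_omul o1 o2 mu : ev (omul o1 o2) mu = ev o1 mu * ev o2 mu.
Proof.
rewrite /ev big_allpairs_dep mulr_suml; apply: eq_bigr => p _.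
rewrite mulr_sumr; apply: eq_bigr => q _ /=.
by rewrite incl_cat; ring.
Qed.

Lemma nrm_omul o1 o2 : nrm (omul o1 o2) = nrm o1 * nrm o2.
Proof.
rewrite /nrm big_allpairs_dep mulr_suml; apply: eq_bigr => p _.
by rewrite mulr_sumr; apply: eq_bigr => q _ /=; rewrite normrM.
Qed.

Lemma bmeas_ev o : bmeas (fun w => ev o (X w)).
Proof. by apply: bmeas_sum => p; apply: bmeasZ; exact: bmeas_incl. Qed.

Lemma mean_ev o : mean P (fun w => ev o (X w)) = \sum_(p <- o) p.1 * pr X p.2.
Proof.
rewrite mean_sum => [|p]; last by apply: bmeasZ; exact: bmeas_incl.
by apply: eq_bigr => p _; rewrite meanZ//; exact: bmeas_incl.
Qed.

Lemma ev_cov o1 o2 (dl : R) :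
  (forall p q, p \in o1 -> q \in o2 ->
    `|pr X (p.2 ++ q.2) - pr X p.2 * pr X q.2| <= dl) ->
  `|mean P (fun w => ev o1 (X w) * ev o2 (X w)) -
    mean P (fun w => ev o1 (X w)) * mean P (fun w => ev o2 (X w))|
  <= nrm o1 * nrm o2 * dl.
Proof.
move=> H; rewrite (@eq_mean _ _ _ _ _ (fun w => ev (omul o1 o2) (X w))); last first.
  by move=> w; rewrite ev_omul.
rewrite !mean_ev big_allpairs_dep !mulr_suml -sumrB.
apply: le_trans (ler_norm_sum _ _ _) _.
rewrite big_seq [leRHS]big_seq; apply: ler_sum => p po.
rewrite mulr_sumr -sumrB; apply: le_trans (ler_norm_sum _ _ _) _.
rewrite mulr_sumr mulr_suml big_seq [leRHS]big_seq; apply: ler_sum => q qo.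
rewrite /= mulrACA -mulrBr !normrM.
by apply: ler_wpM2l; [exact: mulr_ge0|exact: H].
Qed.

Definition oprod (I : Type) (F : I -> obs) (s : seq I) : obs :=
  foldr (fun x o => omul (F x) o) [:: (1, [::])] s.

Lemma ev_oprod (I : Type) (F : I -> obs) (s : seq I) mu :
  ev (oprod F s) mu = \prod_(x <- s) ev (F x) mu.
Proof.
elim: s => [|x s IH].
  by rewrite big_nil /ev big_seq1 /= mul1r.
by rewrite big_cons /= ev_omul IH.
Qed.

Lemma nrm_oprod_le (I : Type) (F : I -> obs) (s : seq I) (N : R) :
  (forall x, nrm (F x) <= N) -> nrm (oprod F s) <= N ^+ size s.
Proof.
move=> FN; elim: s => [|x s IH]; first by rewrite /nrm big_seq1 normr1.
by rewrite /= nrm_omul exprS ler_pM// nrm_ge0.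
Qed.

Lemma mem_oprod (I : eqType) (F : I -> obs) (s : seq I) (u : nat) p :
  (forall x q, q \in F x -> (size q.2 <= u)%N) -> p \in oprod F s ->
  (size p.2 <= u * size s)%N /\
  (forall z, z \in p.2 -> exists x, x \in s /\ exists q, q \in F x /\ z \in q.2).
Proof.
move=> Fu; elim: s p => [|x s IH] p /=.
  by rewrite inE => /eqP ->; split.
move=> /allpairsP[[q r] /= [qF rs ->]] /=; have [h1 h2] := IH r rs.
rewrite size_cat mulnS; split; first exact: leq_add (Fu _ _ qF) h1.
move=> z; rewrite mem_cat => /orP[zq|/h2[y [ys hy]]].
  by exists x; rewrite mem_head; split => //; exists q.
by exists y; rewrite in_cons ys orbT.
Qed.

(* Moebius inversion over the subsets of [U]. *)
Fixpoint moebius (U : seq (lattice d)) (G : set (lattice d) -> R) : obs :=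
  if U is y :: U' then
    [seq (p.1, y :: p.2) | p <- moebius U' (fun mu => G (y |` mu))] ++
    (moebius U' G ++ [seq (- p.1, y :: p.2) | p <- moebius U' G])
  else [:: (G set0, [::])].

(** If y is in mu, the second and third parts of the list cancel and the first one evaluates G with
    y added; otherwise only the second part survives. *)
Lemma ev_moebius U G mu : ev (moebius U G) mu = G (mu `&` [set` U]).
Proof.
elim: U G => [|y U IH] G.
  by rewrite /ev big_seq1 /= /incl /= mulr1 set_nil setI0.
rewrite /ev /= !big_cat !big_map /=.
have step (c : R -> R) V : (forall a b, c a * b = c (a * b)) ->
    (forall a b, c (a + b) = c a + c b) -> c 0 = 0 ->
    \sum_(p <- V) c p.1 * incl R (y :: p.2) mu = (`[< mu y >])%:R * c (ev V mu).
  move=> cM cD c0; rewrite /ev; elim: V => [|p V IHV].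
    by rewrite !big_nil c0 mulr0.
  rewrite !big_cons IHV cD mulrDr; congr (_ + _).
  by rewrite -cat1s incl_cat -cM /incl /= andbT; ring.
rewrite (step id)// (step -%R _ (@mulNr R) (@opprD R) (oppr0 R)).
rewrite -/(ev _ _) !IH.
have [my|nmy] := asboolP (mu y).
  rewrite !mul1r addrC subrr add0r.
  congr G; apply/seteqP; split => z /=.
    by move=> [->|[mz zU]]; rewrite inE ?eqxx ?zU ?orbT.
  by rewrite inE => -[mz /orP[/eqP ->|zU]]; [left|right].
rewrite !mul0r add0r addr0; congr G; apply/seteqP; split => z /=.
  by move=> [mz zU]; rewrite inE zU orbT.
by rewrite inE => -[mz /orP[/eqP zy|zU]]; [case: nmy; rewrite -zy|split].
Qed.

(** Each point of U triples the list, which accounts for the base 3. *)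
Lemma nrm_moebius U G (B : R) : (forall mu, `|G mu| <= B) ->
  nrm (moebius U G) <= 3 ^+ size U * B.
Proof.
elim: U G => [|y U IH] G GB; first by rewrite /nrm big_seq1 expr0 mul1r GB.
rewrite /nrm /= !big_cat !big_map /=.
have -> : \sum_(p <- moebius U G) `|- p.1| = \sum_(p <- moebius U G) `|p.1|.
  by apply: eq_bigr => p _; rewrite normrN.
have h1 := IH _ GB; have h2 := IH (fun mu => G (y |` mu)) (fun mu => GB _).
rewrite /nrm in h1 h2; rewrite exprS -mulrA.
by move: h1 h2; move: (3 ^+ _ * B) => z; lra.
Qed.

Lemma mem_moebius U G p : p \in moebius U G ->
  (size p.2 <= size U)%N /\ {subset p.2 <= U}.
Proof.
elim: U G p => [|y U IH] G p /=; first by rewrite inE => /eqP ->.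
have aux q : (size q.2 <= size U)%N /\ {subset q.2 <= U} ->
    ((size (y :: q.2) <= (size U).+1)%N /\ {subset y :: q.2 <= y :: U}).
  move=> [h1 h2]; split => // z; rewrite !inE => /orP[->//|/h2 ->].
  by rewrite orbT.
rewrite !mem_cat => /or3P[/mapP[q /IH hq ->]|/IH[h1 h2]|/mapP[q /IH hq ->]].
- exact: aux.
- by split; [exact: leqW|move=> z /h2 zU; rewrite inE zU orbT].
- exact: aux.
Qed.

End Observables.

Section Scores.
Context (R : realType) (d k : nat) (h : (window k (0 : lattice d) -> bool) -> R).
Implicit Types (x y : lattice d) (mu : set (lattice d)).

(* There are finitely many configurations on the window, coded here by boolean
   functions on an initial segment of the integers. *)
Lemma local_score_bounded : exists2 B : R, 0 <= B & forall x mu, `|local_score h x mu| <= B.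
Proof.
pose s : seq (lattice d) := enum_fset (fset_set (window k (0 : lattice d))).
pose ix (z : window k (0 : lattice d)) : 'I_(size s).+1 := inord (index (set_val z) s).
pose decode (c : {ffun 'I_(size s).+1 -> bool}) : window k (0 : lattice d) -> bool :=
  fun z => c (ix z).
pose code (f : window k (0 : lattice d) -> bool) : {ffun 'I_(size s).+1 -> bool} :=
  [ffun i => `[< exists z, ix z = i /\ f z >]].
have ixinj z z' : ix z = ix z' -> z = z'.
  move=> /(congr1 val); rewrite /= !inordK ?ltnS ?index_size// => e.
  have inS (u : window k (0 : lattice d)) : set_val u \in s.
    have : set_val u \in fset_set (window k (0 : lattice d)).
      by rewrite in_fset_set; [exact: valP|exact: finite_window].
    by [].
  have := nth_index 0 (inS z); rewrite e (nth_index 0 (inS z')) => zz.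
  by apply: val_inj; exact: esym zz.
have codeK f : decode (code f) = f.
  apply/funext => z; rewrite /decode /code ffunE; apply/idP/idP.
    by move=> /asboolP[z' [/ixinj <-]].
  by move=> fz; apply/asboolP; exists z.
exists (\sum_c `|h (decode c)|); first exact: sumr_ge0.
move=> x mu; rewrite /local_score -[local_config _ _]codeK.
by rewrite (bigD1 (code (local_config x mu)))//= lerDl sumr_ge0.
Qed.

Definition window_seq (r : nat) x : seq (lattice d) := enum_fset (fset_set (window r x)).

Lemma mem_window_seq r x y : (y \in window_seq r x) = (l1dist x y <= r)%N.
Proof.
have -> : (y \in window_seq r x) = (y \in fset_set (window r x)) by [].
rewrite in_fset_set; last exact: finite_window.
by apply/idP/idP; rewrite inE.
Qed.

Lemma size_window_seq r x : (size (window_seq r x) <= size (window_seq r 0))%N.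
Proof.
rewrite -(size_map (fun y => y - x)); apply: uniq_leq_size.
  by rewrite map_inj_uniq; [exact: fset_uniq|exact: addIr].
move=> z /mapP[y]; rewrite !mem_window_seq => xy ->.
by move: xy; rewrite /l1dist sub0r opprB.
Qed.

(** Extension of the score by 0 off the configuration, so that H_n becomes a sum over the
    deterministic window. *)
Definition site_score (n : nat) x mu : R :=
  if `[< (mu `&` window n 0) x >] then local_score h x (mu `&` window n 0) else 0.

(** This locality is what allows the score to be expanded by Moebius inversion over the finite
    window of x. *)
Lemma site_score_local n x mu :
  site_score n x (mu `&` [set` window_seq k x]) = site_score n x mu.
Proof.
have xx : x \in window_seq k x by rewrite mem_window_seq l1dist_refl.
rewrite /site_score.
have e : `[< (mu `&` [set` window_seq k x] `&` window n 0) x >] = `[< (mu `&` window n 0) x >].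
  by apply/asboolP/asboolP => [[[]]|[]].
rewrite e; case: ifP => // _; rewrite /local_score; congr h.
apply/funext => z; rewrite /local_config.
have zk : x + set_val z \in window_seq k x.
  rewrite mem_window_seq /l1dist opprD addrA subrr add0r -sub0r.
  exact: (set_mem (valP z)).
by apply/asboolP/asboolP => [[[]]|[]].
Qed.

Lemma total_scoreE n mu :
  total_score h n mu = \sum_(x <- window_seq n 0) site_score n x mu.
Proof.
rewrite /total_score.
transitivity (\sum_(x \in mu `&` window n 0) site_score n x mu).
  apply: eq_fsbigr => x; rewrite inE => xm.
  by rewrite /site_score asboolT.
rewrite (@fsbig_widen _ _ _ _ _ (window n 0)).
- by rewrite fsbig_finite//; exact: finite_window.
- exact: subIsetr.
- by move=> x [_ nx]; rewrite /= /site_score; case: asboolP => // /nx.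
Qed.

End Scores.

Section ScoreCumulants.
Context (R : realType) (dd : measure_display) (T : measurableType dd).
Variables (P : probability T R) (d : nat) (X : {RV P >-> spin_config d}).
Variables (k : nat) (h : (window k (0 : lattice d) -> bool) -> R).
Implicit Types x y : lattice d.

(** The centred score as an observable: the empty list carries the constant. *)
Definition score_obs (n : nat) x : seq (R * seq (lattice d)) :=
  (- mean P (fun w => site_score h n x (X w)), [::]) ::
    moebius (window_seq k x) (site_score h n x).

Lemma ev_score_obs n x mu : ev (score_obs n x) mu =
  site_score h n x mu - mean P (fun w => site_score h n x (X w)).
Proof.
rewrite /ev big_cons -/(ev _ _) ev_moebius site_score_local /incl /= mulr1.
by rewrite addrC.
Qed.

Lemma bmeas_site_score n x : bmeas (fun w => site_score h n x (X w)).
Proof.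
have := bmeas_ev X (moebius (window_seq k x) (site_score h n x)).
by congr bmeas; apply/funext => w; rewrite ev_moebius site_score_local.
Qed.

Lemma bmeas_total_score n : bmeas (fun w => total_score h n (X w)).
Proof.
rewrite (_ : (fun w => _) = fun w => \sum_(x <- window_seq n 0) site_score h n x (X w)).
  by apply: bmeas_sum => x; exact: bmeas_site_score.
by apply/funext => w; exact: total_scoreE.
Qed.

Lemma centered_total_score n w :
  \sum_(x <- window_seq n 0) ev (score_obs n x) (X w) =
  total_score h n (X w) - mean P (fun w => total_score h n (X w)).
Proof.
under eq_bigr do rewrite ev_score_obs.
rewrite sumrB -total_scoreE -mean_sum; last by move=> x; exact: bmeas_site_score.
by congr (_ - _); apply: eq_mean => w'; rewrite total_scoreE.
Qed.

Lemma nrm_score_obs : exists2 N : R, 1 <= N & forall n x, nrm (score_obs n x) <= N.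
Proof.
have [B B0 hB] := local_score_bounded h.
have sB n x mu : `|site_score h n x mu| <= B.
  by rewrite /site_score; case: ifP => // _; rewrite normr0.
exists (1 + (B + 3 ^+ size (window_seq k (0 : lattice d)) * B)).
  by rewrite lerDl addr_ge0// mulr_ge0// exprn_ge0.
move=> n x; rewrite /nrm big_cons -/(nrm _) /= normrN.
apply: (@le_trans _ _ (B + 3 ^+ size (window_seq k (0 : lattice d)) * B)); last first.
  by rewrite lerDr.
apply: lerD; first by apply: mean_norm_le => //; exact: bmeas_site_score.
apply: le_trans (nrm_moebius _ (sB n x)) _; apply: ler_wpM2r => //.
apply: ler_weXn2l; first by rewrite ler1n.
exact: size_window_seq.
Qed.

Lemma mem_score_obs n x p : p \in score_obs n x ->
  (size p.2 <= size (window_seq k (0 : lattice d)))%N /\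
  (forall z, z \in p.2 -> (l1dist x z <= k)%N).
Proof.
rewrite inE => /orP[/eqP ->|/mem_moebius[h1 h2]] //.
split; first exact: leq_trans (size_window_seq k x).
by move=> z /h2; rewrite mem_window_seq.
Qed.

Definition score_moment n (s : seq (lattice d)) : R :=
  mean P (fun w => \prod_(x <- s) ev (score_obs n x) (X w)).

Lemma score_moment_nil n : score_moment n [::] = 1.
Proof. by rewrite -[RHS](mean_cst P 1); apply: eq_mean => w; rewrite big_nil. Qed.

Lemma score_moment_le (N : R) m n s : 1 <= N -> (forall n x, nrm (score_obs n x) <= N) ->
  (size s <= m)%N -> `|score_moment n s| <= N ^+ m.
Proof.
move=> N1 hN sm; apply: mean_norm_le.
  by apply: bmeas_prod => x; exact: bmeas_ev.
move=> w; rewrite -ev_oprod; apply: le_trans (ev_norm_le _ _) _.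
by apply: le_trans (nrm_oprod_le _ (hN n)) _; exact: ler_weXn2l.
Qed.

Lemma score_moment_mixing (C c : nat -> R) (phi : R -> R) (N C0 : R) (m a n g : nat)
    (s : seq (lattice d)) (A : pred (lattice d)) :
  (forall k, 0 < C k /\ 0 < c k) ->
  {homo C : m n / (m <= n)%N >-> m <= n} ->
  {homo c : m n / (m <= n)%N >-> n <= m} ->
  fast_decreasing phi -> clustering X C c phi ->
  1 <= N -> (forall n x, nrm (score_obs n x) <= N) ->
  0 <= C0 ->
  (let M := (size (window_seq k (0 : lattice d)) * m)%N in
   forall g : nat,
    (if (g <= k.*2)%N then 1 else C M * phi (c M * (g - k.*2)%:R)) <= C0 / g.+1%:R ^+ a) ->
  (size s <= m)%N ->
  (forall y z, y \in s -> z \in s -> A y -> ~~ A z -> (g <= l1dist y z)%N) ->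
  `|score_moment n s - score_moment n [seq x <- s | A x] * score_moment n [seq x <- s | ~~ A x]|
    <= N ^+ m * C0 / g.+1%:R ^+ a.
Proof.
move=> Cc0 Cm cm fd cl N1 hN C00 hC0 sm sep.
set sA := [seq x <- s | A x]; set sB := [seq x <- s | ~~ A x].
pose oA := oprod (score_obs n) sA; pose oB := oprod (score_obs n) sB.
have sAB : (size sA + size sB = size s)%N.
  by rewrite !size_filter count_predC.
have mE (t : seq (lattice d)) : score_moment n t = mean P (fun w => ev (oprod (score_obs n) t) (X w)).
  by apply: eq_mean => w; rewrite ev_oprod.
have -> : score_moment n s = mean P (fun w => ev oA (X w) * ev oB (X w)).
  apply: eq_mean => w; rewrite !ev_oprod [LHS](bigID A) /=.
  by rewrite /sA /sB !big_filter.
rewrite (mE sA) (mE sB) -/oA -/oB.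
have N0 : 0 <= N by exact: le_trans N1.
apply: le_trans (ev_cov (dl := C0 / g.+1%:R ^+ a) _) _.
  move=> p q po qo.
  have su n' x' q' : q' \in score_obs n' x' -> (size q'.2 <= size (window_seq k (0 : lattice d)))%N.
    by move=> /mem_score_obs[].
  have [sp hp] := mem_oprod (su n) po; have [sq hq] := mem_oprod (su n) qo.
  (* For g > 2k, points in the supports of the two products lie within k of sites separated by A,
     hence at least g - 2k apart. *)
  apply: le_trans (hC0 g); case: leqP => gk; first exact: pr_cov_le1.
  apply: pr_cov Cc0 Cm cm fd cl _ _ _.
  - rewrite (leq_trans (leq_add sp sq))// -mulnDr sAB leq_mul2l sm orbT//.
  - by rewrite subn_gt0.
  move=> z z' /hp[y [yA [p' [/mem_score_obs[_ hp'] zp']]]] /hq[y' [yB [q' [/mem_score_obs[_ hq'] zq']]]].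
  move: yA yB; rewrite !mem_filter => /andP[Ay ys] /andP[nAy' ys'].
  have h1 := sep y y' ys ys' Ay nAy'.
  have h2 := l1dist_triangle y z y'; have h3 := l1dist_triangle z z' y'.
  have h4 := hp' _ zp'; have h5 := hq' _ zq'; rewrite l1dist_sym in h5.
  by clear -h1 h2 h3 h4 h5; lia.
rewrite -[leRHS]mulrA; apply: ler_wpM2r.
  by rewrite divr_ge0// exprn_ge0.
apply: (@le_trans _ _ (N ^+ size sA * N ^+ size sB)).
  by apply: ler_pM; rewrite ?nrm_ge0 ?nrm_oprod_le.
by rewrite -exprD sAB ler_weXn2l.
Qed.

Lemma score_cumulant_le (m : nat) : clustering_spin_model X ->
  exists2 K : R, 0 <= K & forall n,
    `|tsum (window_seq n 0) m.+1 (kap (score_moment n))| <= K * (window_size d n)%:R.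
Proof.
move=> [_ _ [C [c [phi [Cc0 Cm cm fd cl]]]]].
(* The decay exponent a below provides the summable weight of power 2d for each of the m points
   besides the first; M bounds the number of lattice points in a product of m + 1 scores. *)
have [N N1 hN] := nrm_score_obs.
pose a := ((2 * d) * m)%N.
pose M := (size (window_seq k (0 : lattice d)) * m.+1)%N.
have [CM0 cM0] := Cc0 M.
have [C0 C00 hC0] := fast_decreasing_decay k a fd CM0 cM0.
have N0 : 0 <= N by exact: le_trans N1.
have B1 : 1 <= N ^+ m.+1 by exact: exprn_ege1.
have B0 : 0 <= N ^+ m.+1 by exact: exprn_ge0.
have C1 : 0 <= N ^+ m.+1 * C0 by exact: mulr_ge0.
exists ((mix_bound (N ^+ m.+1) m.+1 * (N ^+ m.+1 * C0) + kap_bound (N ^+ m.+1) m.+1) *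
   m.+1%:R ^+ a * (4 ^+ d) ^+ m).
  rewrite !mulr_ge0 ?exprn_ge0// addr_ge0 ?mulr_ge0//.
    exact: mix_bound_ge0.
  exact: kap_bound_ge0.
move=> n.
have fw : uniq (window_seq n (0 : lattice d)) by exact: fset_uniq.
apply: (tsum_kap_le (@l1dist_refl d) (@l1dist_triangle d) (score_moment_nil n) B1 C1) => //.
- by move=> s sm; exact: score_moment_le.
- move=> s A g sm sep.
  exact: (score_moment_mixing _ Cc0 Cm cm fd cl N1 hN C00 hC0 sm sep).
- by move=> x; exact: sum_l1_weights.
Qed.

Lemma mean_tsum (W : seq (lattice d)) (j : nat) (F : seq (lattice d) -> T -> R) :
  (forall s, bmeas (F s)) ->
  mean P (fun w => tsum W j (fun s => F s w)) = tsum W j (fun s => mean P (F s)).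
Proof.
have bt i (G : seq (lattice d) -> T -> R) : (forall s, bmeas (G s)) ->
    bmeas (fun w => tsum W i (fun s => G s w)).
  elim: i G => [|i IH] G bG; first exact: bG.
  by apply: bmeas_sum => x; exact: (IH (fun s => G (x :: s))).
elim: j F => [|j IH] F bF //=.
rewrite mean_sum => [|x]; last by exact: (bt j (fun s => F (x :: s))).
by apply: eq_bigr => x _; exact: (IH (fun s => F (x :: s))).
Qed.

Lemma score_moments n j :
  mean P (fun w => (total_score h n (X w) - mean P (fun w => total_score h n (X w))) ^+ j) =
  tsum (window_seq n 0) j (score_moment n).
Proof.
rewrite /score_moment -mean_tsum; last first.
  by move=> s; apply: bmeas_prod => x; exact: bmeas_ev.
by apply: eq_mean => w; rewrite tsum_prod centered_total_score.
Qed.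

End ScoreCumulants.

(** * The central limit theorem *)

Section CumulantCLT.
Variable R : realType.

(** If the preimage of a neighbourhood V were not in F, some ultrafilter finer than F would contain
    its complement. This transfers the ultrafilter limits of the moments to ordinary convergence. *)
Lemma cvg_ultra (I : Type) (F : set_system I) (FF : ProperFilter F) (f : I -> R) (l : R) :
  (forall U : set_system I, UltraFilter U -> F `<=` U -> f @ U --> l) -> f @ F --> l.
Proof.
move=> H V Vl; apply: contrapT => nFV.
have pf : ProperFilter (within (~` (f @^-1` V)) F).
  split; last exact: within_filter.
  rewrite /within /= => F0; apply: nFV; apply: filterS F0 => i /= h.
  by apply: contrapT.
have [U [UU sU]] := ultraFilterLemma pf.
have UV : U (f @^-1` V).
  by apply: H Vl => // A FA; apply: sU; rewrite /within /=; apply: filterS FA.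
have UnV : U (~` (f @^-1` V)).
  by apply: sU; rewrite /within /=; apply: filterS filterT.
by have [i []] := filter_ex (filterI UV UnV).
Qed.

Lemma cumulants_scale (m c : nat -> R) (s : R) : cumulants_of m c ->
  cumulants_of (fun j => s ^+ j * m j) (fun j => s ^+ j * c j).
Proof.
move=> mc j; rewrite mc mulr_sumr; apply: eq_bigr => -[i /=].
rewrite ltnS => ij _.
have -> : s ^+ j.+1 = s ^+ i.+1 * s ^+ (j - i) by rewrite -exprD addSn subnKC.
by ring.
Qed.

Lemma cumulant1 (m c : nat -> R) : cumulants_of m c -> m 0%N = 1 -> c 1%N = m 1%N.
Proof. by move=> mc m0; rewrite mc big_ord_recl big_ord0 bin0 m0 mulr1 mul1r addr0. Qed.

Lemma cumulant2 (m c : nat -> R) : cumulants_of m c -> m 0%N = 1 -> m 1%N = 0 ->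
  c 2%N = m 2%N.
Proof.
move=> mc m0 m1; have c1 := cumulant1 mc m0.
by rewrite mc !big_ord_recl big_ord0 /= c1 m1 m0 /bump /= binn; ring.
Qed.

Lemma cumulant_clt (dd : measure_display) (T : measurableType dd)
    (P : probability T R) (Z : nat -> T -> R) (c : nat -> nat -> R) (K : nat)
    (f : R -> R) (B : R) :
  (forall n, bmeas (Z n)) ->
  (forall n, cumulants_of (fun j => mean P (fun w => Z n w ^+ j)) (c n)) ->
  (forall n, c n 1%N = 0) -> c^~ 2%N @ \oo --> (1 : R) ->
  (forall j, (K <= j)%N -> c^~ j @ \oo --> (0 : R)) ->
  continuous f -> (forall x, `|f x| <= B) ->
  mean P (fun w => f (Z n w)) @[n --> \oo] -->
  \int[normal_prob 0 1]_(x in [set: measurableTypeR R]) f (x : R).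
Proof.
move=> bZ mc c1 c2 cK cf fB.
apply: method_of_moments cf fB => //.
- by move=> n; have [] := bZ n.
- by move=> n k; apply: bmeas_integrable; exact: bmeasX.
move=> k; apply: cvg_ultra => U UU sU.
apply: (@janson_ultra _ _ U UU (fun n j => mean P (fun w => Z n w ^+ j)) c K) => //.
- by move=> n; rewrite -[RHS](mean_cst P 1); apply: eq_mean.
- by move=> n; exact: mean_moments_psd.
- by move=> A /c2; exact: sU.
- by move=> j Kj A /(cK j Kj); exact: sU.
Qed.

End CumulantCLT.

Section NormalisedScore.
Context (R : realType) (dd : measure_display) (T : measurableType dd).
Variables (P : probability T R).

Lemma variance_mean (g : T -> R) : bmeas g ->
  fine 'V_P[g]%E = mean P (fun w => (g w - mean P g) ^+ 2).
Proof.
move=> bg; rewrite /variance unlock (expectation_mean P bg).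
set u := ('E_P[_])%E.
have -> : u = ('E_P[(fun w => (g w - mean P g) ^+ 2)%R])%E by [].
by rewrite expectation_mean//; apply: bmeasX; apply: bmeasD => //; exact: bmeas_cst.
Qed.

(** The source of the constant 4: nu j / 2 >= 2 gives V^(j/2) >= a^(j/2) w^2, which beats the growth
    w of the cumulants and leaves a factor 1/w. *)
Lemma powR_decay (V a w nu : R) (j : nat) : 0 < a -> 1 <= w -> 4 <= nu * j%:R ->
  a * w `^ nu <= V ->
  (V `^ (- 2^-1)) ^+ j * w <= (a `^ (2^-1 * j%:R))^-1 * w^-1.
Proof.
move=> a0 w1 nuj aV.
have w0 : 0 < w by exact: lt_le_trans w1.
have wn0 : 0 < w `^ nu by exact: powR_gt0.
have aw0 : 0 < a * w `^ nu by exact: mulr_gt0.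
have V0 : 0 < V by exact: lt_le_trans aV.
have ap0 : 0 < a `^ (2^-1 * j%:R) by exact: powR_gt0.
have -> : (V `^ (- 2^-1)) ^+ j = (V `^ (2^-1 * j%:R))^-1.
  by rewrite -powR_mulrn ?powR_ge0// -powRrM mulNr powRN.
have h1 : a `^ (2^-1 * j%:R) * w ^+ 2 <= V `^ (2^-1 * j%:R).
  apply: (@le_trans _ _ ((a * w `^ nu) `^ (2^-1 * j%:R))).
    rewrite powRM ?(ltW a0) ?(ltW wn0)// ler_pM2l// -powRrM -powR_mulrn ?(ltW w0)//.
    by apply: ler_powR => //; lra.
  have j0 : 0 <= 2^-1 * j%:R :> R by rewrite mulr_ge0.
  by apply: (ge0_ler_powR j0); rewrite ?nnegrE // ltW.
rewrite ler_pdivrMl; last exact: powR_gt0.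
rewrite -invfM ler_pdivlMr ?mulr_gt0//.
rewrite (_ : w * _ = a `^ (2^-1 * j%:R) * w ^+ 2)//; ring.
Qed.

Context (d : nat) (X : {RV P >-> spin_config d}).
Variables (k : nat) (h : (window k (0 : lattice d) -> bool) -> R).

Let H n w := total_score h n (X w).
Let M n j := mean P (fun w => (H n w - mean P (H n)) ^+ j).
Let C n j := tsum (window_seq n (0 : lattice d)) j (kap (score_moment X h n)).

Let M_cumulants n : cumulants_of (M n) (C n).
Proof.
rewrite (_ : M n = fun j => tsum (window_seq n 0) j (score_moment X h n)).
  by apply: tsum_cumulants; exact: score_moment_nil.
by apply/funext => j; exact: score_moments.
Qed.

Let bH n : bmeas (H n). Proof. exact: bmeas_total_score. Qed.

Let bHc n : bmeas (fun w => H n w - mean P (H n)).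
Proof. by apply: bmeasD => //; exact: bmeas_cst. Qed.

Let M0 n : M n 0%N = 1.
Proof. by rewrite -[RHS](mean_cst P 1); apply: eq_mean. Qed.

Let M1 n : M n 1%N = 0.
Proof. by rewrite /M (meanD P (bH n) (bmeas_cst T (- mean P (H n)))) mean_cst subrr. Qed.

Lemma scaled_cumulant_cvg0 (s : nat -> R) (a nu : R) (m : nat) :
  (0 < d)%N -> clustering_spin_model X -> 0 < a -> 4 <= nu * m.+1%:R ->
  (forall n, s n = M n 2%N `^ (- 2^-1)) ->
  (\forall n \near \oo, a * (window_size d n)%:R `^ nu <= M n 2%N) ->
  (fun n => s n ^+ m.+1 * C n m.+1) @ \oo --> (0 : R).
Proof.
move=> d0 cX a0 nuj sE aV.
have [L L0 hL] := score_cumulant_le h m cX.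
pose b : R := L * (a `^ (2^-1 * m.+1%:R))^-1.
apply/norm_cvg0P; apply: (@squeeze_cvgr _ _ _ _ (fun=> 0) (fun n => b * harmonic n)).
- near=> n; rewrite normr_ge0/= normrM ger0_norm; last by rewrite sE exprn_ge0 ?powR_ge0.
  have wn : (n < window_size d n)%N by exact: window_size_gt.
  have w1 : 1 <= (window_size d n)%:R :> R by rewrite ler1n (leq_ltn_trans _ wn).
  have Vn : a * (window_size d n)%:R `^ nu <= M n 2%N by near: n.
  have := powR_decay a0 w1 nuj Vn; rewrite -sE => hp.
  apply: (@le_trans _ _ (s n ^+ m.+1 * (L * (window_size d n)%:R))).
    by apply: ler_wpM2l; [rewrite sE exprn_ge0 ?powR_ge0|exact: hL].
  rewrite mulrCA /b -mulrA; apply: ler_wpM2l => //.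
  apply: le_trans hp _.
  apply: ler_wpM2l; first by rewrite invr_ge0 powR_ge0.
  by rewrite lef_pV2 ?posrE ?ler_nat// ltr0n (leq_ltn_trans _ wn).
- exact: cvg_cst.
- by rewrite -(mulr0 b); apply: cvgMr; exact: cvg_harmonic.
Unshelve. all: by end_near.
Qed.

Lemma score_clt (nu : R) (f : R -> R) (B : R) :
  (0 < d)%N -> clustering_spin_model X -> 0 < nu ->
  eventually_Omega (fun n => M n 2%N) (fun n => (window_size d n)%:R `^ nu) ->
  continuous f -> (forall x, `|f x| <= B) ->
  mean P (fun w => f (M n 2%N `^ (- 2^-1) * (H n w - mean P (H n)))) @[n --> \oo] -->
  \int[normal_prob 0 1]_(x in [set: measurableTypeR R]) f (x : R).
Proof.
move=> d0 cX nu0 [a a0 aV] fc fB.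
pose s n := M n 2%N `^ (- 2^-1).
(* From this order on nu j >= 4, as [powR_decay] requires. *)
pose K := (Num.bound (4 / nu)).+1.
apply: (@cumulant_clt _ _ _ P (fun n w => s n * (H n w - mean P (H n)))
  (fun n j => s n ^+ j * C n j) K f B) => //.
- by move=> n; exact: bmeasZ.
- move=> n; rewrite (_ : (fun j => _) = fun j => s n ^+ j * M n j).
    exact: cumulants_scale.
  apply/funext => j; rewrite /M -meanZ; last exact: bmeasX.
  by apply: eq_mean => w; rewrite exprMn.
- by move=> n; rewrite (cumulant1 (M_cumulants n) (M0 n)) M1 mulr0.
- apply: cvg_near_cst; near=> n.
  have wn : (n < window_size d n)%N by exact: window_size_gt.
  have V0 : 0 < M n 2%N.
    have : a * (window_size d n)%:R `^ nu <= M n 2%N by near: n.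
    apply: lt_le_trans; rewrite mulr_gt0// powR_gt0// ltr0n.
    exact: leq_ltn_trans wn.
  rewrite (cumulant2 (M_cumulants n) (M0 n) (M1 n)) /s.
  by rewrite -powR_mulrn ?powR_ge0// -powRrM mulNr mulVf// powRN powRr1 ?(ltW V0)// mulVf// gt_eqF.
- move=> [//|m] Km; apply: (@scaled_cumulant_cvg0 s a nu m) => //.
  have h0 : 0 <= 4 / nu by rewrite divr_ge0// ltW.
  have := archi_boundP h0; rewrite ltr_pdivrMr// => /ltW/le_trans; apply.
  rewrite mulrC; apply: ler_wpM2l; first exact: ltW.
  by rewrite ler_nat; exact: ltnW.
Unshelve. all: by end_near.
Qed.

End NormalisedScore.

Theorem theorem2p6 (R : realType) (disp : measure_display)
    (T : measurableType disp) (P : probability T R)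
    (d : nat) (hd : (0 < d)%N) (X : {RV P >-> spin_config d})
    (hX : clustering_spin_model X)
    (k : nat) (hk : (0 < k)%N)
    (h : (window k (0 : lattice d) -> bool) -> R) :
  let H : nat -> T -> R := fun n w => total_score h n (X w) in
  forall nu : R, 0 < nu ->
  eventually_Omega (fun n => fine 'V_P[H n]%E)
                   (fun n => (window_size d n)%:R `^ nu) ->
  converges_in_distribution P
    (fun n w => fine 'V_P[H n]%E `^ (- 2^-1) * (H n w - fine 'E_P[H n]%E))
    (normal_prob 0 1).
Proof.
move=> H nu nu0 VH f fc [B0 [_ hB]].
have fB x : `|f x| <= `|B0| + 1.
  (* [bounded_fun] gives a bound only for numbers strictly above B0. *)
  by apply: hB => //; rewrite (le_lt_trans (ler_norm _))// ltrDl.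
have bH n : bmeas (H n) by exact: bmeas_total_score.
have mf : measurable_fun setT f by exact: continuous_measurable_fun.
have bE n : fine 'E_P[H n]%E = mean P (H n) by rewrite expectation_mean.
have VE n : fine 'V_P[H n]%E = mean P (fun w => (H n w - mean P (H n)) ^+ 2).
  exact: variance_mean.
have Zb n : bmeas (fun w => fine 'V_P[H n]%E `^ (- 2^-1) * (H n w - fine 'E_P[H n]%E)).
  by apply: bmeasZ; apply: bmeasD => //; exact: bmeas_cst.
have bf n : bmeas (f \o (fun w => fine 'V_P[H n]%E `^ (- 2^-1) * (H n w - fine 'E_P[H n]%E))).
  split; last by exists (`|B0| + 1) => w; exact: fB.
  by apply: measurableT_comp => //; have [] := Zb n.
have fN : bmeas (f : measurableTypeR R -> R).
  by split; [exact: mf|exists (`|B0| + 1)].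
rewrite -(fineK (integrable_fin_num measurableT (bmeas_integrable (normal_prob 0 1) fN))).
under eq_fun do rewrite expectation_mean//.
apply: cvg_EFin; first by near=> n.
under eq_fun do rewrite bE VE.
apply: (score_clt hd hX nu0 _ fc fB).
by have [a a0 aV] := VH; exists a => //; near=> n; rewrite -VE; near: n.
Unshelve. all: by end_near.
Qed.
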